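(* Let $\lambda>-1/2$, $\eta\in\mathbb R$, $b=\lambda+\mathrm i\eta$, and let $\nu(z)=(-z)^{-\overline b}(1-z)^{b+\overline b}H(z)$, where $H$ is an entire function and $\nu$ is a positive weight on $\mathbb T\setminus\{1\}$. Then, for every $n\in\mathbb N$, the structure matrix $M_n$ is a holomorphic function in $\mathbb C\setminus\{0,1\}$ (after holomorphic extension across $\mathbb T\setminus\{1\}$) with a simple pole at $z=0$ and a removable singularity or a simple pole at $z=1$.
   Context: $\mathbb N=\{1,2,\dots\}$, $\mathbb T=\{|z|=1\}$ (counterclockwise), $d\mu(z)=\frac{\nu(z)}{\mathrm i z}dz$ is a positive measure on $\mathbb T$. The powers $(-z)^{-\overline b}$, $(1-z)^{b+\overline b}$ are principal branches, so $\nu(e^{\mathrm i\theta})=e^{-\eta(\theta-\pi)}\big(4\sin^2(\theta/2)\big)^{\lambda}H(e^{\mathrm i\theta})$ for $0<\theta<2\pi$. $\Phi_n$ is the monic polynomial of degree $n$ with $\int_{\mathbb T}\Phi_n\overline{\Phi_m}\,d\mu=\kappa_n^{-2}\delta_{n,m}$, $\kappa_n>0$; $\Phi_n^*(z)=z^n\overline{\Phi_n(1/\bar z)}$. To avoid confusion with the parameter $b$: $b_n=2\pi\kappa_n^2$. For $z\notin\mathbb T$, $$G_n(z)=\frac1{2\pi \mathrm i}\int_{\mathbb T}\frac{\Phi_n(t)}{t-z}\frac{\nu(t)}{t^n}dt,\quad G_{n-1}^*(z)=\frac1{2\pi \mathrm i}\int_{\mathbb T}\frac{\Phi_{n-1}^*(t)}{t-z}\frac{\nu(t)}{t^n}dt,\quad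 Y_n=\begin{bmatrix}\Phi_n&G_n\\-b_{n-1}\Phi_{n-1}^*&-b_{n-1}G_{n-1}^*\end{bmatrix}\quad(n\in\mathbb N).$$ $C_n(z)=\operatorname{diag}\big(z^{-n/2}\nu(z)^{1/2},\,z^{n/2}\nu(z)^{-1/2}\big)$, $Z_n=Y_nC_n$, and the structure matrix is $M_n=Z_n'Z_n^{-1}=Y_n'Y_n^{-1}+Y_nC_n'C_n^{-1}Y_n^{-1}$. Local analytic branches are used for the powers; $C_n'C_n^{-1}=\big(-\frac{n}{2z}+\frac{\nu'(z)}{2\nu(z)}\big)\operatorname{diag}(1,-1)$, with $\frac{\nu'}{\nu}=-\frac{\overline b}{z}-\frac{b+\overline b}{1-z}+\frac{H'}{H}$, and $M_n$ do not depend on the branches. For a matrix function, a simple pole at $a$ means that $(z-a)M_n(z)$ has a nonzero finite (matrix) limit as $z\to a$. *)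

(* Defs.v *)
From HB Require Import structures.
From mathcomp Require Import all_boot all_order all_algebra.
From mathcomp Require Import complex.
From mathcomp Require Import all_classical all_reals all_analysis.

Set Implicit Arguments.
Unset Strict Implicit.
Unset Printing Implicit Defensive.

Import Order.TTheory GRing.Theory Num.Theory.
Import numFieldNormedType.Exports.

Local Open Scope classical_set_scope.
Local Open Scope ring_scope.

(* R[i] typed as a numClosedFieldType: this is what gives it its norm topology
   as a normed module over itself, so that [derivable f z 1] is complex
   differentiability and matrices over it are normed modules over it.
   In its order, [0 < w] means that w is real and positive. *)
Definition Cx (R : realType) : numClosedFieldType := R[i].

Definition ofR (R : realType) (x : R) : Cx R := (x%:C)%C.

Definition cexp (R : realType) (z : Cx R) : Cx R :=
  ofR (expR (complex.Re z)) *
  (cos (complex.Im z) +i* sin (complex.Im z))%C.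

(* Principal argument, in ]-pi, pi]; the values at 0 of [carg], [clog] and
   [cpow] are irrelevant. *)
Definition carg (R : realType) (z : Cx R) : R :=
  let t := acos (complex.Re (z / `|z|)) in
  if 0 <= complex.Im z then t else - t.

Definition clog (R : realType) (z : Cx R) : Cx R :=
  (ln (complex.Re `|z|) +i* carg z)%C.

Definition cpow (R : realType) (z a : Cx R) : Cx R := cexp (a * clog z).

Definition entire (R : realType) (f : Cx R -> Cx R) : Prop :=
  forall z : Cx R, derivable f z 1.

Definition unit_pt (R : realType) (t : R) : Cx R := (cos t +i* sin t)%C.

(* Integral of f(z) dz over the counterclockwise unit circle: Lebesgue integral
   of f(e^(it)) i e^(it) over 0 < t < 2 pi, so the point 1, where the weight
   need not be defined, is left out. *)
Definition circle_int (R : realType) (f : Cx R -> Cx R) : Cx R :=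
  let g := fun t : R => f (unit_pt t) * ('i * unit_pt t) in
  ((\int[lebesgue_measure]_(t in `]0%R, (2 * pi)%R[) complex.Re (g t)) +i*
   (\int[lebesgue_measure]_(t in `]0%R, (2 * pi)%R[) complex.Im (g t)))%C.

Definition weight (R : realType) (b : Cx R) (H : Cx R -> Cx R) (z : Cx R) :
    Cx R :=
  cpow (- z) (- b^*) * cpow (1 - z) (b + b^*) * H z.

Definition mu_int (R : realType) (nu f : Cx R -> Cx R) : Cx R :=
  circle_int (fun z => f z * (nu z / ('i * z))).

Definition monic_orthogonal (R : realType) (nu : Cx R -> Cx R)
    (Phi : nat -> {poly Cx R}) (kappa : nat -> R) : Prop :=
  [/\ forall n, Phi n \is monic /\ size (Phi n) = n.+1,
      forall n, 0 < kappa n &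
      forall n m, mu_int nu (fun z => (Phi n).[z] * ((Phi m).[z])^*) =
                  ofR ((kappa n) ^- 2) *+ (n == m)].

(* The formula for the reversed polynomial; not the right value at z = 0,
   where it is never used. *)
Definition reversed (R : realType) (n : nat) (p : {poly Cx R}) (z : Cx R) :
    Cx R :=
  z ^+ n * (p.[1 / z^*])^*.

Definition Gfun (R : realType) (nu : Cx R -> Cx R) (Phi : nat -> {poly Cx R})
    (n : nat) (z : Cx R) : Cx R :=
  (2 * ofR pi * 'i)^-1 *
  circle_int (fun t => (Phi n).[t] / (t - z) * (nu t / t ^+ n)).

(* [Gstar nu Phi n] is G^*_{n-1}: the polynomial has index n - 1, but the power
   of t is n. *)
Definition Gstar (R : realType) (nu : Cx R -> Cx R) (Phi : nat -> {poly Cx R})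
    (n : nat) (z : Cx R) : Cx R :=
  (2 * ofR pi * 'i)^-1 *
  circle_int (fun t => reversed n.-1 (Phi n.-1) t / (t - z) * (nu t / t ^+ n)).

Definition mx2 (K : Type) (a11 a12 a21 a22 : K) : 'M[K]_2 :=
  \matrix_(i < 2, j < 2)
    if i == ord0 then (if j == ord0 then a11 else a12)
    else (if j == ord0 then a21 else a22).

Definition bcoef (R : realType) (kappa : nat -> R) (n : nat) : Cx R :=
  ofR (2 * pi * kappa n ^+ 2).

Definition Ymx (R : realType) (nu : Cx R -> Cx R) (Phi : nat -> {poly Cx R})
    (kappa : nat -> R) (n : nat) (z : Cx R) : 'M[Cx R]_2 :=
  mx2 (Phi n).[z]
      (Gfun nu Phi n z)
      (- bcoef kappa n.-1 * reversed n.-1 (Phi n.-1) z)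
      (- bcoef kappa n.-1 * Gstar nu Phi n z).

(* l is an analytic branch of log f near z. *)
Definition log_branch (R : realType) (f l : Cx R -> Cx R) (z : Cx R) : Prop :=
  \forall w \near z, derivable l w 1 /\ cexp (l w) = f w.

(* D is, near z, the diagonal matrix with entries w^(-n/2) nu(w)^(1/2) and
   w^(n/2) nu(w)^(-1/2), for some analytic branches near z of all the powers
   involved, those inside nu included: each f^a is exp(a l) with l a branch of
   log f. *)
Definition Cmx_branch (R : realType) (b : Cx R) (H : Cx R -> Cx R) (n : nat)
    (z : Cx R) (D : Cx R -> 'M[Cx R]_2) : Prop :=
  exists l lm l1 lnu : Cx R -> Cx R,
    [/\ log_branch (fun w => w) l z,
        log_branch (fun w => - w) lm z,
        log_branch (fun w => 1 - w) l1 z,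
        log_branch (fun w => cexp (- b^* * lm w) *
                             cexp ((b + b^*) * l1 w) * H w) lnu z &
        \forall w \near z,
          D w = mx2 (cexp (- (n%:R / 2) * l w) * cexp (2^-1 * lnu w)) 0
                    0 (cexp (n%:R / 2 * l w) * cexp (- 2^-1 * lnu w))].

(* M is the value at z of the structure matrix Z' Z^-1, Z = Y C: local branches
   of C exist at z, and M is obtained from each of them. *)
Definition structure_matrix_at (R : realType) (b : Cx R) (H : Cx R -> Cx R)
    (Phi : nat -> {poly Cx R}) (kappa : nat -> R) (n : nat) (z : Cx R)
    (M : 'M[Cx R]_2) : Prop :=
  (exists D, Cmx_branch b H n z D) /\
  forall D, Cmx_branch b H n z D ->
    let Z := fun w => Ymx (weight b H) Phi kappa n w *m D w in
    [/\ derivable Z z 1, Z z \in unitmx & M = 'D_1 Z z *m invmx (Z z)].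

Definition removable_singularity (R : realType) (f : Cx R -> 'M[Cx R]_2)
    (a : Cx R) : Prop :=
  exists g : Cx R -> 'M[Cx R]_2,
    (\forall z \near a, derivable g z 1) /\ (\forall z \near a^', f z = g z).

Definition simple_pole (R : realType) (f : Cx R -> 'M[Cx R]_2) (a : Cx R) :
    Prop :=
  exists2 L : 'M[Cx R]_2, L != 0 & (z - a) *: f z @[z --> a^'] --> L.

(* Main.v *)
Require Import Defs.
From mathcomp Require Import all_boot all_order all_algebra.
From mathcomp Require Import complex.
From mathcomp Require Import all_classical all_reals all_analysis measurable_realfun.
From mathcomp Require Import ring lra.
Set Implicit Arguments.
Unset Strict Implicit.
Unset Printing Implicit Defensive.
Import Order.TTheory GRing.Theory Num.Theory.
Import numFieldNormedType.Exports.
Local Open Scope classical_set_scope.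
Local Open Scope ring_scope.

(* The proof avoids the Riemann-Hilbert problem. On the circle the powers in the
   weight multiply to a positive number, so [H] is positive there, in particular
   real; an entire function that is real on the unit circle is constant, by the
   maximum principle inside and, outside, by the maximum modulus principle for
   [(H - c) / z^k]. Hence [nu] satisfies the Pearson equation
   [z (1 - z) nu' = - (b^* + b z) nu].

   Integrating by parts on the circle, [z (1 - z)] times the derivatives of
   [Phi_n] and [Phi_{n-1}^*] are orthogonal to so many powers of [z] that they are
   combinations of [Phi_n], [z Phi_n], [Phi_{n-1}^*] and [z Phi_{n-1}^*] with
   constant coefficients. Integrating by parts against the Cauchy kernel, [G_n]
   and [G_{n-1}^*] satisfy the same system up to the scalar term coming from [C_n].
   Together with [det Y_n = 1] this gives
   [M_n z = (N0 + z N1) / (z (1 - z))] with constant matrices [N0] and [N1].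
   If [N0] vanished, the second equation at [z = 0] would give [n + b^* = 0],
   contradicting [lambda > -1/2]. *)

(** * Epsilon forms of derivative, continuity and neighbourhoods *)

Section Eps.
Variable K : numFieldType.

(** Why one matrix serves both columns of [Y_n]: after multiplication by z (1 - z), the diagonal
    coefficients found for the Cauchy transforms differ from those found for the polynomials by - n
    - b^* + (n - b) z, the same amount in both rows, and the off-diagonal ones agree. This amount is
    twice z (1 - z) times the logarithmic derivative of z^(-n/2) nu^(1/2). The two diagonal entries
    of [C_n] carry half of it each, with opposite signs, so after multiplication by [C_n] both
    columns obey the same system. The constants of the system are coefficients of polynomials and
    values at 0. They do not depend on the side of the circle on which z lies, so one formula holds
    inside and outside, and being rational it is its own extension across the circle. At z = 1 the
    limit of (z - 1) M_n is - (N0 + N1). The sum may vanish, and then M_n = N0 / z near 1; this is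
    the source of the alternative at 1. *)

Lemma is_derive_epsP (f : K -> K) (x d : K) :
  is_derive x 1 f d <->
  forall e : K, 0 < e -> exists2 r : K, 0 < r &
    forall h, `|h| < r -> `|f (x + h) - f x - d * h| <= e * `|h|.
Proof.
split.
  case=> df fd e e0.
  have : (fun h => h^-1 *: ((f \o shift x) (h *: 1) - f x)) @ 0^' --> d.
    by rewrite -fd; exact: df.
  move/cvgrPdist_le/(_ _ e0)/nbhs_ballP => [r /= r0 Hr].
  exists r => // h hr.
  have [->|h0] := eqVneq h 0.
    by rewrite addr0 mulr0 !subrr normr0 mulr0.
  have := Hr h; rewrite /ball /= sub0r normrN => /(_ hr h0).
  rewrite /= -[h *: 1]/(h * 1) mulr1 -[h^-1 *: _]/(h^-1 * _) (addrC h x) => Hh.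
  have -> : f (x + h) - f x - d * h = - ((d - h^-1 * (f (x + h) - f x)) * h).
    by field.
  by rewrite normrN normrM ler_wpM2r.
move=> H.
have cv : (fun h => h^-1 *: ((f \o shift x) (h *: 1) - f x)) @ 0^' --> d.
  apply/cvgrPdist_le => e e0; have [r r0 Hr] := H _ e0.
  apply/nbhs_ballP; exists r => //= h; rewrite /ball /= sub0r normrN => hr h0.
  rewrite /= -[h *: 1]/(h * 1) mulr1 -[h^-1 *: _]/(h^-1 * _) (addrC h x).
  have := Hr h hr.
  have -> : f (x + h) - f x - d * h = - ((d - h^-1 * (f (x + h) - f x)) * h).
    by field.
  by rewrite normrN normrM ler_pM2r ?normr_gt0.
split; first by apply/cvg_ex; exists d.
exact: cvg_lim cv.
Qed.

Lemma continuous_epsP (T : normedModType K) (U : normedModType K) (f : T -> U) (x : T) :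
  {for x, continuous f} <->
  forall e : K, 0 < e -> exists2 r : K, 0 < r &
    forall y, `|y - x| < r -> `|f y - f x| <= e.
Proof.
split.
  move=> /cvgrPdist_le H e e0; have /nbhs_ballP[r /= r0 Hr] := H _ e0.
  exists r => // y yr; rewrite distrC; apply: Hr.
  by rewrite -ball_normE /ball_/= distrC.
move=> H; apply/cvgrPdist_le => e e0; have [r r0 Hr] := H _ e0.
apply/nbhs_ballP; exists r => //= y; rewrite -ball_normE /ball_ /= => yr.
by rewrite distrC; apply: Hr; rewrite distrC.
Qed.

Lemma near_epsP (T : normedModType K) (x : T) (P : T -> Prop) :
  (\forall y \near x, P y) <-> exists2 r : K, 0 < r & forall y, `|y - x| < r -> P y.
Proof.
split.
  move=> /nbhs_ballP[r /= r0 Hr]; exists r => // y yr; apply: Hr.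
  by rewrite -ball_normE /ball_/= distrC.
move=> [r r0 Hr]; apply/nbhs_ballP; exists r => //= y.
rewrite -ball_normE /ball_ /= => yr; apply: Hr; by rewrite distrC.
Qed.

End Eps.

(** * Real-valued modulus, real and imaginary parts *)

Section ComplexBasics.
Variable R : realType.
Local Notation C := (Cx R).
Local Notation Re := (@complex.Re R).
Local Notation Im := (@complex.Im R).
Implicit Types z w : C.

(** The norm of [Cx R] takes its values in [Cx R]; [nrm] is the same number as a real, so that
    estimates take place in the ordered field [R]. *)
Definition nrm (z : C) : R := Re `|z|.

Lemma ofRD (x y : R) : ofR (x + y) = ofR x + ofR y.
Proof. exact: (rmorphD (real_complex R)). Qed.
Lemma ofRM (x y : R) : ofR (x * y) = ofR x * ofR y.
Proof. exact: (rmorphM (real_complex R)). Qed.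
Lemma ofR0 : ofR 0 = 0 :> C. Proof. by []. Qed.
Lemma ofR1 : ofR 1 = 1 :> C. Proof. by []. Qed.
Lemma ofRn n : ofR n%:R = n%:R :> C.
Proof. exact: (rmorph_nat (real_complex R)). Qed.
Lemma ofRV (x : R) : ofR x^-1 = (ofR x)^-1.
Proof. exact: (fmorphV (real_complex R)). Qed.
Lemma ofRX (x : R) n : ofR (x ^+ n) = ofR x ^+ n.
Proof. exact: (rmorphXn (real_complex R)). Qed.
Lemma ofR_inj : injective (@ofR R).
Proof. exact: complexI. Qed.

Lemma ler_ofR (x y : R) : (ofR x <= ofR y) = (x <= y).
Proof. exact: lecR. Qed.
Lemma ltr_ofR (x y : R) : (ofR x < ofR y) = (x < y).
Proof. exact: ltcR. Qed.

Lemma normE z : `|z| = ofR (nrm z).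
Proof. by rewrite /nrm normc_def. Qed.

Lemma nrmE z : nrm z = Num.sqrt (Re z ^+ 2 + Im z ^+ 2).
Proof. by rewrite /nrm normc_def. Qed.

Lemma Re_D z w : Re (z + w) = Re z + Re w. Proof. by case: z; case: w. Qed.
Lemma Im_D z w : Im (z + w) = Im z + Im w. Proof. by case: z; case: w. Qed.
Lemma Re_N z : Re (- z) = - Re z. Proof. by case: z. Qed.
Lemma Im_N z : Im (- z) = - Im z. Proof. by case: z. Qed.
Lemma Re_M z w : Re (z * w) = Re z * Re w - Im z * Im w.
Proof. by case: z; case: w. Qed.
Lemma Im_M z w : Im (z * w) = Re z * Im w + Im z * Re w.
Proof. by case: z; case: w. Qed.
Lemma Re_ofR x : Re (ofR x) = x. Proof. by []. Qed.
Lemma Im_ofR x : Im (ofR x) = 0. Proof. by []. Qed.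
Lemma Re_1 : Re (1 : C) = 1. Proof. by []. Qed.
Lemma Im_1 : Im (1 : C) = 0. Proof. by []. Qed.
Lemma Re_i : Re ('i : C) = 0. Proof. by rewrite -complexiE. Qed.
Lemma Im_i : Im ('i : C) = 1. Proof. by rewrite -complexiE. Qed.
Lemma Re_conj z : Re z^* = Re z. Proof. by case: z. Qed.
Lemma Im_conj z : Im z^* = - Im z. Proof. by case: z. Qed.
Definition cpt (x y : R) : C := (x +i* y)%C.
Lemma Re_cpt x y : Re (cpt x y) = x. Proof. by []. Qed.
Lemma Im_cpt x y : Im (cpt x y) = y. Proof. by []. Qed.
Lemma Re_unit_pt (t : R) : Re (unit_pt t) = cos t. Proof. by []. Qed.
Lemma Im_unit_pt (t : R) : Im (unit_pt t) = sin t. Proof. by []. Qed.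
Definition ReIm := (Re_cpt, Im_cpt, Re_unit_pt, Im_unit_pt, Re_D, Im_D, Re_N,
  Im_N, Re_M, Im_M, Re_ofR, Im_ofR, Re_1, Im_1, Re_i, Im_i, Re_conj, Im_conj).

Lemma Cx_eqP z w : Re z = Re w -> Im z = Im w -> z = w.
Proof. by case: z => a b; case: w => c d /= -> ->. Qed.

Lemma CxE z : z = ofR (Re z) + 'i * ofR (Im z).
Proof. by apply: Cx_eqP; rewrite !ReIm; ring. Qed.

Lemma nrm_ge0 z : 0 <= nrm z.
Proof. by rewrite nrmE sqrtr_ge0. Qed.

Lemma nrm_ofR x : nrm (ofR x) = `|x|.
Proof. by rewrite nrmE /= expr0n addr0 sqrtr_sqr. Qed.

Lemma nrmM z w : nrm (z * w) = nrm z * nrm w.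
Proof. by apply: ofR_inj; rewrite ofRM -!normE normrM. Qed.

Lemma nrm1 : nrm 1 = 1.
Proof. by apply: ofR_inj; rewrite -normE normr1. Qed.

Lemma nrm0 : nrm 0 = 0.
Proof. by apply: ofR_inj; rewrite -normE normr0. Qed.

Lemma nrm_eq0 z : (nrm z == 0) = (z == 0).
Proof. by rewrite -(inj_eq ofR_inj) -normE normr_eq0. Qed.

Lemma nrm_gt0 z : (0 < nrm z) = (z != 0).
Proof. by rewrite lt_neqAle nrm_ge0 andbT eq_sym nrm_eq0. Qed.

Lemma nrmX z n : nrm (z ^+ n) = nrm z ^+ n.
Proof. by apply: ofR_inj; rewrite ofRX -!normE normrX. Qed.

Lemma nrmV z : nrm z^-1 = (nrm z)^-1.
Proof. by apply: ofR_inj; rewrite ofRV -!normE normfV. Qed.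

Lemma nrmN z : nrm (- z) = nrm z.
Proof. by apply: ofR_inj; rewrite -!normE normrN. Qed.

Lemma nrmB z w : nrm (z - w) = nrm (w - z).
Proof. by rewrite -nrmN opprB. Qed.

Lemma nrmD z w : nrm (z + w) <= nrm z + nrm w.
Proof. by rewrite -ler_ofR ofRD -!normE ler_normD. Qed.

Lemma nrm_conj z : nrm z^* = nrm z.
Proof. by rewrite !nrmE !ReIm sqrrN. Qed.

Lemma nrm_sqr z : nrm z ^+ 2 = Re z ^+ 2 + Im z ^+ 2.
Proof. by rewrite nrmE sqr_sqrtr // addr_ge0 ?sqr_ge0. Qed.

Lemma Re_le_nrm z : `|Re z| <= nrm z.
Proof.
rewrite nrmE -sqrtr_sqr ler_wsqrtr // lerDl; exact: sqr_ge0.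
Qed.

Lemma Im_le_nrm z : `|Im z| <= nrm z.
Proof.
rewrite nrmE -sqrtr_sqr ler_wsqrtr // lerDr; exact: sqr_ge0.
Qed.

Lemma nrm_le z : nrm z <= `|Re z| + `|Im z|.
Proof.
rewrite {1}(CxE z); apply: le_trans (nrmD _ _) _.
rewrite nrmM !nrm_ofR (_ : nrm 'i = 1) ?mul1r //.
by rewrite nrmE !ReIm expr0n add0r expr1n sqrtr1.
Qed.

Lemma pos_ofR (e : C) : 0 < e -> exists2 x : R, 0 < x & e = ofR x.
Proof.
case: e => a b; rewrite ltcE /= => /andP[/eqP-> a0]; by exists a.
Qed.

Lemma nrm_i : nrm 'i = 1.
Proof. by rewrite nrmE !ReIm expr0n add0r expr1n sqrtr1. Qed.

Lemma Ci_neq0 : ('i : C) != 0.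
Proof. by rewrite -nrm_gt0 nrm_i. Qed.

Lemma Cderive_epsP (f : C -> C) (x d : C) :
  is_derive x 1 f d <->
  forall e : R, 0 < e -> exists2 r : R, 0 < r &
    forall h, nrm h < r -> nrm (f (x + h) - f x - d * h) <= e * nrm h.
Proof.
rewrite is_derive_epsP; split=> H e e0.
  have [|r /pos_ofR[s s0 ->] Hr] := H (ofR e); first by rewrite -ofR0 ltr_ofR.
  exists s => // h hs; rewrite -ler_ofR ofRM -!normE; apply: Hr.
  by rewrite normE ltr_ofR.
have [s s0 ->] := pos_ofR e0; have [r r0 Hr] := H _ s0.
exists (ofR r); first by rewrite -ofR0 ltr_ofR.
by move=> h; rewrite !normE ltr_ofR -ofRM ler_ofR; exact: Hr.
Qed.

Lemma Ccontinuous_epsP (f : C -> C) (x : C) :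
  {for x, continuous f} <->
  forall e : R, 0 < e -> exists2 r : R, 0 < r &
    forall y, nrm (y - x) < r -> nrm (f y - f x) <= e.
Proof.
rewrite continuous_epsP; split=> H e e0.
  have [|r /pos_ofR[s s0 ->] Hr] := H (ofR e); first by rewrite -ofR0 ltr_ofR.
  exists s => // h hs; rewrite -ler_ofR -!normE; apply: Hr.
  by rewrite normE ltr_ofR.
have [s s0 ->] := pos_ofR e0; have [r r0 Hr] := H _ s0.
exists (ofR r); first by rewrite -ofR0 ltr_ofR.
by move=> h; rewrite !normE ltr_ofR ler_ofR; exact: Hr.
Qed.

Lemma Cnear_epsP (x : C) (P : C -> Prop) :
  (\forall y \near x, P y) <-> exists2 r : R, 0 < r & forall y, nrm (y - x) < r -> P y.
Proof.
rewrite near_epsP; split.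
  move=> [r /pos_ofR[s s0 ->] Hr]; exists s => // y ys; apply: Hr.
  by rewrite normE ltr_ofR.
move=> [r r0 Hr]; exists (ofR r); first by rewrite -ofR0 ltr_ofR.
by move=> y; rewrite normE ltr_ofR; exact: Hr.
Qed.

End ComplexBasics.

(** * Integrals over segments and Goursat's theorem *)

Section Segments.
Variable R : realType.
Local Notation mu := (@lebesgue_measure R).
Implicit Types (f g : R -> R) (a b c : R).

Definition segint a b f : R := \int[mu]_(t in `[a, b]) f t.

Lemma continuous_segment_integrable a b f : continuous f ->
  mu.-integrable `[a, b] (EFin \o f).
Proof.
move=> cf; apply: continuous_compact_integrable; first exact: segment_compact.
exact: continuous_subspaceT.
Qed.

Lemma segint_split a b c f : continuous f -> a <= c <= b ->
  segint a b f = segint a c f + segint c b f.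
Proof.
move=> cf /andP[ac cb].
have := @Rintegral_itvB R f (BLeft a) (BRight b) c.
rewrite !bnd_simp => /(_ (continuous_segment_integrable a b cf)).
rewrite -[(a <= c)%O]/(a <= c) -[(c <= b)%O]/(c <= b) => /(_ ac cb) H.
rewrite /segint -(@Rintegral_itv_obnd_cbnd R c) -?H.
  by rewrite addrC subrK.
apply: integrableS (continuous_segment_integrable c b cf) => //.
by apply: subset_itvr; rewrite bnd_simp.
Qed.

Lemma segint_bound a b f (k M : R) : continuous f -> a <= b ->
  (forall t, a <= t <= b -> `|f t - k| <= M) ->
  `|segint a b f - k * (b - a)| <= M * (b - a).
Proof.
move=> cf ab H.
have e c : segint a b (fun=> c) = c * (b - a).
  rewrite /segint Rintegral_cst //= lebesgue_measure_itv /= lte_fin.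
  by case: ltP => // ba; rewrite (le_anti (introT andP (conj ab ba))) subrr !mulr0.
have ic c : mu.-integrable `[a, b] (EFin \o fun=> c : R).
  by apply: continuous_segment_integrable; move=> x; exact: cvg_cst.
have if_ := continuous_segment_integrable a b cf.
have le1 : segint a b f <= segint a b (fun=> k + M).
  apply: le_Rintegral => // t /=; rewrite in_itv /= => /H.
  by rewrite ler_norml lerBlDr (addrC M) => /andP[].
have le2 : segint a b (fun=> k - M) <= segint a b f.
  apply: le_Rintegral => // t /=; rewrite in_itv /= => /H.
  by rewrite ler_norml => /andP[+ _]; rewrite lerBrDr (addrC (- M)).
rewrite ler_norml; rewrite !e in le1 le2; apply/andP; split; lra.
Qed.

Lemma segintB a b f g : continuous f -> continuous g ->
  segint a b (fun t => f t - g t) = segint a b f - segint a b g.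
Proof.
by move=> cf cg; apply: RintegralB => //; exact: continuous_segment_integrable.
Qed.

Lemma eq_segint a b f g : f =1 g -> segint a b f = segint a b g.
Proof. by move=> fg; apply: eq_Rintegral => t _; exact: fg. Qed.

(** Nested intervals for a bisection: [u n] is the left end and [w / 2 ^+ n] the length at stage
    [n]. The supremum of the left ends lies in all of them. *)
Lemma nested_dyadic (u : nat -> R) (w : R) :
  0 <= w ->
  (forall n, u n <= u n.+1 /\ u n.+1 + w / 2 ^+ n.+1 <= u n + w / 2 ^+ n) ->
  exists x, forall n, u n <= x <= u n + w / 2 ^+ n.
Proof.
move=> w0 H.
have mon n k : u n <= u (n + k)%N.
  elim: k => [|k IH]; first by rewrite addn0.
  by rewrite addnS (le_trans IH) //; case: (H (n + k)%N).
have mon2 n k : u (n + k)%N + w / 2 ^+ (n + k) <= u n + w / 2 ^+ n.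
  elim: k => [|k IH]; first by rewrite addn0.
  by rewrite addnS (le_trans _ IH) //; case: (H (n + k)%N).
have pos n : 0 <= w / 2 ^+ n by rewrite divr_ge0 // exprn_ge0.
have bd m n : u m <= u n + w / 2 ^+ n.
  have [mn|nm] := leqP m n.
    rewrite -(subnKC mn); apply: le_trans (mon m (n - m)%N) _.
    by rewrite lerDl subnKC.
  rewrite -(subnKC (ltnW nm)); apply: le_trans _ (mon2 n (m - n)%N).
  by rewrite lerDl.
have hs : has_sup (range u).
  split; first by exists (u 0%N), 0%N.
  by exists (u 0%N + w / 2 ^+ 0) => _ [m _ <-].
exists (sup (range u)) => n; apply/andP; split.
  by apply: ub_le_sup; [case: hs | exists n].
by apply: ge_sup; [case: hs | move=> _ [m _ <-]].
Qed.

End Segments.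

Section Goursat.
Variable R : realType.
Variables P Q : R -> R -> R.
(** The Cauchy-Riemann equations in first-order form: [P + i Q] has the complex derivative [a - i b]
    at [x + i y]. *)
Hypothesis CR : forall x y, exists a b : R, forall e, 0 < e ->
  exists2 d, 0 < d & forall h k, `|h| < d -> `|k| < d ->
    `|P (x + h) (y + k) - P x y - (a * h + b * k)| <= e * (`|h| + `|k|) /\
    `|Q (x + h) (y + k) - Q x y - (a * k - b * h)| <= e * (`|h| + `|k|).
Hypothesis Py : forall x, continuous (P x).
Hypothesis Qx : forall y, continuous (Q ^~ y).

(** The imaginary part of the counterclockwise integral of [(P + i Q) dz] around the rectangle with
    corner [(x, y)], width [w] and height [h]. The mean value property of real parts only uses this
    component. *)
Let flux x w y h : R :=
  segint y (y + h) (P (x + w)) - segint y (y + h) (P x)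
  - (segint x (x + w) (Q ^~ (y + h)) - segint x (x + w) (Q ^~ y)).

Let flux_split x w y h : 0 <= w -> 0 <= h ->
  flux x (w + w) y (h + h) =
  flux x w y h + flux (x + w) w y h + (flux x w (y + h) h + flux (x + w) w (y + h) h).
Proof.
move=> w0 h0; rewrite /flux !addrA.
rewrite !(@segint_split _ x (x + w + w) (x + w)) ?(@segint_split _ y (y + h + h) (y + h)) //;
  try by rewrite !lerDl ?w0 ?h0.
all: try (apply/andP; split; lra).
ring.
Qed.

(** The linear parts of [P] and [Q] contribute [a * w * h] to both differences and cancel. What
    remains is an error of order [e * (w + h)] on each side, integrated over sides of length [w] and
    [h]. *)
Let flux_local x y : exists2 c : R, 0 <= c & forall e, 0 < e -> exists2 d, 0 < d &
  forall x0 w y0 h, x0 <= x <= x0 + w -> y0 <= y <= y0 + h -> w < d -> h < d ->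
    `|flux x0 w y0 h| <= c * e * (w + h) ^+ 2.
Proof.
have [a [b H]] := CR x y; exists 2 => // e e0.
have [d d0 Hd] := H _ e0; exists d => // x0 w y0 h /andP[xl xr] /andP[yl yr] wd hd.
have w0 : 0 <= w by lra.
have h0 : 0 <= h by lra.
have est s t : x0 <= s <= x0 + w -> y0 <= t <= y0 + h ->
   `|P s t - P x y - (a * (s - x) + b * (t - y))| <= e * (w + h) /\
   `|Q s t - Q x y - (a * (t - y) - b * (s - x))| <= e * (w + h).
  move=> /andP[s1 s2] /andP[t1 t2].
  have sx : `|s - x| <= w by rewrite ler_norml; apply/andP; split; lra.
  have ty : `|t - y| <= h by rewrite ler_norml; apply/andP; split; lra.
  have [] := Hd (s - x) (t - y); [exact: le_lt_trans sx wd|exact: le_lt_trans ty hd|].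
  rewrite !(addrC x) !(addrC y) !subrK => e1 e2.
  have le_e : e * (`|s - x| + `|t - y|) <= e * (w + h) by rewrite ler_pM2l // lerD.
  by split; [apply: le_trans e1 _ | apply: le_trans e2 _].
have cP s1 s2 : continuous (fun t => P s1 t - P s2 t).
  by move=> t; apply: cvgB; exact: Py.
have cQ s1 s2 : continuous (fun t => Q t s1 - Q t s2).
  by move=> t; apply: cvgB; exact: Qx.
have B1 : `|segint y0 (y0 + h) (fun t => P (x0 + w) t - P x0 t) - a * w * h| <= 2 * (e * (w + h)) * h.
  have := @segint_bound _ y0 (y0 + h) (fun t => P (x0 + w) t - P x0 t) (a * w) (2 * (e * (w + h))).
  rewrite addrAC subrr add0r; apply => //; first by rewrite lerDl.
  move=> t th; have [||e1 _] := est (x0 + w) t; rewrite ?lexx ?lerDl ?andbT //.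
  have [||e2 _] := est x0 t; rewrite ?lexx ?lerDl //.
  rewrite !ler_norml in e1 e2 *; move: e1 e2 => /andP[? ?] /andP[? ?].
  by apply/andP; split; nra.
have B2 : `|segint x0 (x0 + w) (fun t => Q t (y0 + h) - Q t y0) - a * h * w| <= 2 * (e * (w + h)) * w.
  have := @segint_bound _ x0 (x0 + w) (fun t => Q t (y0 + h) - Q t y0) (a * h) (2 * (e * (w + h))).
  rewrite addrAC subrr add0r; apply => //; first by rewrite lerDl.
  move=> t th; have [||_ e1] := est t (y0 + h); rewrite ?lexx ?lerDl ?andbT //.
  have [||_ e2] := est t y0; rewrite ?lexx ?lerDl //.
  rewrite !ler_norml in e1 e2 *; move: e1 e2 => /andP[? ?] /andP[? ?].
  by apply/andP; split; nra.
rewrite /flux -segintB // -segintB //.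
move: B1 B2; rewrite !ler_norml => /andP[? ?] /andP[? ?].
by apply/andP; split; nra.
Qed.

(** The flux is additive over the four quarters, so one of them carries at least a quarter of it. *)
Let quarter x w y h (e : R) : 0 <= w -> 0 <= h ->
  e <= `|flux x w y h| ->
  exists2 xy : R * R, [/\ x <= xy.1, xy.1 + w / 2 <= x + w, y <= xy.2 & xy.2 + h / 2 <= y + h] &
    e / 4 <= `|flux xy.1 (w / 2) xy.2 (h / 2)|.
Proof.
move=> w0 h0 He.
have w20 : 0 <= w / 2 by lra.
have h20 : 0 <= h / 2 by lra.
have le1 (s t : R) : 0 <= t -> s + t / 2 <= s + t.
  by move=> t0; rewrite lerD2l ler_pdivrMr // ler_peMr // ler1n.
have le2 (s t : R) : s + t / 2 + t / 2 <= s + t by rewrite -addrA -splitr.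
have := flux_split x y w20 h20; rewrite -!splitr => E.
have [H1|H1] := leP (e / 4) `|flux x (w / 2) y (h / 2)|.
  by exists (x, y) => //=; split; rewrite ?lerDl ?le1 ?le2.
have [H2|H2] := leP (e / 4) `|flux (x + w / 2) (w / 2) y (h / 2)|.
  by exists (x + w / 2, y) => //=; split; rewrite ?lerDl ?le1 ?le2.
have [H3|H3] := leP (e / 4) `|flux x (w / 2) (y + h / 2) (h / 2)|.
  by exists (x, y + h / 2) => //=; split; rewrite ?lerDl ?le1 ?le2.
have [H4|H4] := leP (e / 4) `|flux (x + w / 2) (w / 2) (y + h / 2) (h / 2)|.
  by exists (x + w / 2, y + h / 2) => //=; split; rewrite ?lerDl ?le1 ?le2.
move: He; rewrite E => /(le_trans _).
have := ler_normD (flux x (w / 2) y (h / 2) + flux (x + w / 2) (w / 2) y (h / 2))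
  (flux x (w / 2) (y + h / 2) (h / 2) + flux (x + w / 2) (w / 2) (y + h / 2) (h / 2)).
have := ler_normD (flux x (w / 2) y (h / 2)) (flux (x + w / 2) (w / 2) y (h / 2)).
have := ler_normD (flux x (w / 2) (y + h / 2) (h / 2)) (flux (x + w / 2) (w / 2) (y + h / 2) (h / 2)).
move=> N1 N2 N3 /(_ _ (lexx _)) He.
by exfalso; lra.
Qed.

Lemma goursat x w y h : 0 <= w -> 0 <= h ->
  segint y (y + h) (P (x + w)) - segint y (y + h) (P x) =
  segint x (x + w) (Q ^~ (y + h)) - segint x (x + w) (Q ^~ y).
Proof.
move=> w0 h0; apply/eqP; rewrite -subr_eq0 -/(flux x w y h).
apply: contraT => F0; set e := `|flux x w y h|.
have e0 : 0 < e by rewrite normr_gt0.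
pose inv n (p : R * R) := e / 4 ^+ n <= `|flux p.1 (w / 2 ^+ n) p.2 (h / 2 ^+ n)|.
(* The invariant is a premise inside the existential, with a dummy witness when it fails, so that
   [choice] gives one total function to iterate. *)
have step (q : nat * (R * R)) : exists p : R * R, inv q.1 q.2 ->
    [/\ inv q.1.+1 p, q.2.1 <= p.1 /\ p.1 + w / 2 ^+ q.1.+1 <= q.2.1 + w / 2 ^+ q.1 &
       q.2.2 <= p.2 /\ p.2 + h / 2 ^+ q.1.+1 <= q.2.2 + h / 2 ^+ q.1].
  case: q => n [a b] /=; have [Hp|] := pselect (inv n (a, b)); last by exists (0, 0).
  have [||[a' b'] /= [? ? ? ?] Hq] := quarter _ _ Hp; rewrite ?divr_ge0 ?exprn_ge0 //.
  have e1 (t : R) : t / 2 ^+ n / 2 = t / 2 ^+ n.+1.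
    by rewrite exprS invfM mulrA mulrAC.
  have e2 : e / 4 ^+ n / 4 = e / 4 ^+ n.+1 by rewrite exprS invfM mulrA mulrAC.
  rewrite !e1 e2 in Hq.
  by exists (a', b') => _; rewrite /= -!e1; split.
have [st Hst] := choice step.
pose t := fix t n : R * R := if n is n.+1 then st (n, t n) else (x, y).
have inv_t n : inv n (t n).
  by elim: n => [|n IH]; [rewrite /inv !expr0 !divr1 | case: (Hst (n, t n) IH)].
have [|x' Hx'] := @nested_dyadic _ (fun n => (t n).1) w w0.
  by move=> n; case: (Hst (n, t n) (inv_t n)).
have [|y' Hy'] := @nested_dyadic _ (fun n => (t n).2) h h0.
  by move=> n; case: (Hst (n, t n) (inv_t n)).
have [c c0 Hc] := flux_local x' y'.
(* With this [ep] the local bound at stage [n] is at most [e / (2 * 4 ^+ n)], against the lower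
   bound [e / 4 ^+ n]. The added ones keep the denominator positive. *)
pose ep := e / (2 * ((c + 1) * (w + h + 1) ^+ 2)).
have den : 0 < (c + 1) * (w + h + 1) ^+ 2 by rewrite mulr_gt0 ?exprn_gt0 //; lra.
have ep0 : 0 < ep by rewrite divr_gt0 // mulr_gt0.
have [d d0 Hd] := Hc _ ep0.
have [n Hn] : exists n : nat, (w + h + 1) / 2 ^+ n < d.
  exists (Num.bound ((w + h + 1) / d)).
  rewrite ltr_pdivrMr ?exprn_gt0 // mulrC -ltr_pdivrMr //.
  apply: lt_trans (archi_boundP _) _; first by rewrite divr_ge0 ?(ltW d0) // !addr_ge0.
  by rewrite -natrX ltr_nat ltn_expl.
have p2 : 0 < 2 ^+ n :> R by rewrite exprn_gt0.
have wn : w / 2 ^+ n < d by apply: le_lt_trans Hn; rewrite ler_pM2r ?invr_gt0 //; lra.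
have hn : h / 2 ^+ n < d by apply: le_lt_trans Hn; rewrite ler_pM2r ?invr_gt0 //; lra.
have := le_trans (inv_t n) (Hd _ _ _ _ (Hx' n) (Hy' n) wn hn).
have -> : 4 ^+ n = 2 ^+ n * 2 ^+ n :> R by rewrite -exprMn; congr (_ ^+ _); ring.
rewrite -mulrDl expr_div_n expr2 mulrA.
rewrite ler_pM2r ?invr_gt0 ?mulr_gt0 // => C.
have eE : ep * (2 * ((c + 1) * (w + h + 1) ^+ 2)) = e by rewrite divfK // gt_eqF // mulr_gt0.
have D : c * (w + h) ^+ 2 <= (c + 1) * (w + h + 1) ^+ 2.
  apply: ler_pM => //; [exact: sqr_ge0| lra |].
  by rewrite ler_sqr ?nnegrE; lra.
have : ep * (c * (w + h) ^+ 2) <= ep * ((c + 1) * (w + h + 1) ^+ 2) by rewrite ler_pM2l.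
have : 0 < ep * ((c + 1) * (w + h + 1) ^+ 2) by rewrite mulr_gt0.
rewrite -eE in C; move: C; rewrite expr2 => C; lra.
Qed.

End Goursat.

(** * Complex exponential and mean value property *)

Section Derivatives.
Variable K : numFieldType.

Lemma is_derive_comp (f g : K -> K) (x df dg : K) :
  is_derive x 1 f df -> is_derive (f x) 1 g dg ->
  is_derive x 1 (g \o f) (dg * df).
Proof.
move=> [fx fxE] [gx gxE].
have dfx : differentiable f x by exact/derivable1_diffP.
have dgx : differentiable g (f x) by exact/derivable1_diffP.
have dgf : differentiable (g \o f) x by exact: differentiable_comp.
split; first exact: diff_derivable.
have e1 : 'd f x 1 = df by rewrite -deriveE.
have e2 : 'd g (f x) 1 = dg by rewrite -deriveE.
have e3 : 'D_1 (g \o f) x = 'd (g \o f) x 1 by exact: deriveE.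
have e4 : 'd (g \o f) x = 'd g (f x) \o 'd f x :> (K -> K) by exact: diff_comp.
have e5 : 'd g (f x) df = dg * df.
  by rewrite -[df in LHS]mulr1 linearZ /= e2 mulrC.
rewrite -[in LHS]e1 in e5.
exact: (etrans e3 (etrans (congr1 (@^~ 1) e4) e5)).
Qed.

Lemma is_derive_continuous (f : K -> K) (x df : K) :
  is_derive x 1 f df -> {for x, continuous f}.
Proof. by move=> [fx _]; exact/differentiable_continuous/derivable1_diffP. Qed.

Lemma is_derive_add (f g : K -> K) (x df dg : K) :
  is_derive x 1 f df -> is_derive x 1 g dg ->
  is_derive x 1 (fun t => f t + g t) (df + dg).
Proof. by move=> Hf Hg; exact: is_deriveD. Qed.

Lemma is_derive_opp (f : K -> K) (x df : K) :
  is_derive x 1 f df -> is_derive x 1 (fun t => - f t) (- df).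
Proof. by move=> Hf; exact: is_deriveN. Qed.

Lemma is_derive_sub (f g : K -> K) (x df dg : K) :
  is_derive x 1 f df -> is_derive x 1 g dg ->
  is_derive x 1 (fun t => f t - g t) (df - dg).
Proof. by move=> Hf Hg; apply: is_derive_add => //; exact: is_derive_opp. Qed.

Lemma is_derive_mul (f g : K -> K) (x df dg : K) :
  is_derive x 1 f df -> is_derive x 1 g dg ->
  is_derive x 1 (fun t => f t * g t) (df * g x + f x * dg).
Proof.
move=> Hf Hg; have H := @is_deriveM K K f g x 1 df dg Hf Hg.
by apply: is_derive_eq H _; rewrite addrC -[f x *: _]/(f x * _) -[g x *: _]/(g x * _) (mulrC df).
Qed.

Lemma is_derive_const (c x : K) : is_derive x 1 (fun=> c) (0 : K).
Proof. exact: is_derive_cst. Qed.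

Lemma is_derive_inv (f : K -> K) (x df : K) : f x != 0 ->
  is_derive x 1 f df ->
  is_derive x 1 (fun t => (f t)^-1) (- df / f x ^+ 2).
Proof.
move=> f0 [fx fxE]; split; first exact: derivableV.
rewrite deriveV // fxE -[_ *: _]/(_ * _); by field.
Qed.

Lemma is_derive_pow (f : K -> K) (x df : K) n :
  is_derive x 1 f df ->
  is_derive x 1 (fun t => f t ^+ n) (n%:R * f x ^+ n.-1 * df).
Proof.
move=> Hf; elim: n => [|n IH]; first by rewrite !mul0r; exact: is_derive_const.
have -> : (fun t => f t ^+ n.+1) = (fun t => f t * f t ^+ n).
  by apply/funext => t; rewrite exprS.
apply: is_derive_eq (is_derive_mul Hf IH) _ => /=.
case: n {IH} => [|n]; first by rewrite !mul0r mulr0 addr0 mul1r mulrC.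
by rewrite -natr1 /= exprS; ring.
Qed.

Lemma is_derive_horner (p : {poly K}) (x : K) :
  is_derive x 1 (fun t => p.[t]) p^`().[x].
Proof.
elim/poly_ind: p => [|p c IH].
  rewrite deriv0 horner0; have -> : (fun t => 0.[t]) = (fun=> 0) :> (K -> K).
    by apply/funext => t; rewrite horner0.
  exact: is_derive_const.
have -> : (fun t => (p * 'X + c%:P).[t]) = (fun t => p.[t] * t + c).
  by apply/funext => t; rewrite hornerMXaddC.
have H := is_derive_add (is_derive_mul IH (is_derive_id x 1)) (is_derive_const c x).
apply: is_derive_eq H _.
by rewrite derivD derivM derivX derivC !hornerE.
Qed.

End Derivatives.

Section ComplexExp.
Variable R : realType.
Local Notation C := (Cx R).
Local Notation Re := (@complex.Re R).
Local Notation Im := (@complex.Im R).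
Implicit Types z w : C.

Lemma cexpE z : cexp z = ofR (expR (Re z)) * unit_pt (Im z).
Proof. by []. Qed.

Lemma unit_ptD (s t : R) : unit_pt (s + t) = unit_pt s * unit_pt t.
Proof. by apply: Cx_eqP; rewrite !ReIm /= ?cosD ?sinD //; ring. Qed.

Lemma cexpD z w : cexp (z + w) = cexp z * cexp w.
Proof. by rewrite !cexpE !ReIm unit_ptD expRD ofRM; ring. Qed.

Lemma unit_pt0 : unit_pt 0 = 1 :> C.
Proof. by apply: Cx_eqP; rewrite /= ?cos0 ?sin0. Qed.

Lemma nrm_unit_pt (t : R) : nrm (unit_pt t) = 1.
Proof. by rewrite nrmE /= cos2Dsin2 sqrtr1. Qed.

Lemma cexp0 : cexp 0 = 1 :> C.
Proof. by rewrite cexpE expR0 unit_pt0 mulr1. Qed.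

Lemma nrm_cexp z : nrm (cexp z) = expR (Re z).
Proof. by rewrite cexpE nrmM nrm_unit_pt nrm_ofR mulr1 ger0_norm // expR_ge0. Qed.

Lemma cexp_neq0 z : cexp z != 0.
Proof. by rewrite -nrm_gt0 nrm_cexp expR_gt0. Qed.

Lemma cexpN z : cexp (- z) = (cexp z)^-1.
Proof.
apply: (mulfI (cexp_neq0 z)).
by rewrite divff ?cexp_neq0 // -cexpD subrr cexp0.
Qed.

Lemma is_derive_cexp0 : is_derive (0 : C) 1 (@cexp R) 1.
Proof.
apply/Cderive_epsP => e e0.
(* The error is split into six terms, five of size at most [e' * nrm h] and one at most twice that,
   seven in total. The bound [e' <= 1] controls the factors [1 + x] and [x]. *)
have [e' [e'0 e'1 e'e]] : exists e', [/\ 0 < e', e' <= 1 & e' <= e / 8].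
  exists (Num.min (e / 8) 1); rewrite lt_min ltr01 divr_gt0 //.
  by rewrite !ge_min !lexx orbT.
have [r1 r10 H1] := (is_derive_epsP _ _ _).1 (is_derive_expR (0 : R)) _ e'0.
have [r2 r20 H2] := (is_derive_epsP _ _ _).1 (is_derive_cos (0 : R)) _ e'0.
have [r3 r30 H3] := (is_derive_epsP _ _ _).1 (is_derive_sin (0 : R)) _ e'0.
exists (Num.min (Num.min r1 r2) (Num.min r3 e')); first by rewrite !lt_min r10 r20 r30.
move=> h; rewrite !lt_min => /andP[/andP[h1 h2] /andP[h3 h4]].
set x := Re h; set y := Im h.
have xh : `|x| <= nrm h := Re_le_nrm h.
have yh : `|y| <= nrm h := Im_le_nrm h.
have E1 := H1 x (le_lt_trans xh h1); rewrite add0r expR0 mul1r in E1.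
have E2 := H2 y (le_lt_trans yh h2); rewrite add0r cos0 sin0 oppr0 mul0r subr0 in E2.
have E3 := H3 y (le_lt_trans yh h3); rewrite add0r sin0 cos0 subr0 mul1r in E3.
have nh := nrm_ge0 h.
rewrite add0r cexp0 mul1r; apply: le_trans (nrm_le _) _.
rewrite !ReIm /= -/x -/y subr0 !(mulr0, mul0r, subr0, addr0, add0r).
have cy := cos_max y.
have -> : expR x * cos y - 1 - x = (expR x - 1 - x) * cos y + (1 + x) * (cos y - 1) by ring.
have -> : expR x * sin y - y = (expR x - 1 - x) * sin y + x * (sin y - y) + x * y + (sin y - y) by ring.
have sy := sin_max y.
have x1 : `|x| <= e' := le_trans xh (ltW h4).
have T1 : `|(expR x - 1 - x) * cos y| <= e' * nrm h.
  rewrite normrM -[leRHS]mulr1 ler_pM //.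
  by apply: le_trans E1 _; rewrite ler_pM2l.
have T2 : `|(1 + x) * (cos y - 1)| <= 2 * (e' * nrm h).
  rewrite normrM ler_pM //.
    apply: le_trans (ler_normD _ _) _; rewrite normr1; lra.
  by apply: le_trans E2 _; rewrite ler_pM2l.
have T3 : `|(expR x - 1 - x) * sin y| <= e' * nrm h.
  rewrite normrM -[leRHS]mulr1 ler_pM //.
  by apply: le_trans E1 _; rewrite ler_pM2l.
have T4 : `|sin y - y| <= e' * nrm h.
  by apply: le_trans E3 _; rewrite ler_pM2l.
have T5 : `|x * (sin y - y)| <= e' * nrm h.
  by rewrite normrM -[leRHS]mul1r ler_pM // (le_trans x1).
have T6 : `|x * y| <= e' * nrm h by rewrite normrM ler_pM.
have S1 := ler_normD ((expR x - 1 - x) * cos y) ((1 + x) * (cos y - 1)).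
have S2 := ler_normD ((expR x - 1 - x) * sin y + x * (sin y - y) + x * y) (sin y - y).
have S3 := ler_normD ((expR x - 1 - x) * sin y + x * (sin y - y)) (x * y).
have S4 := ler_normD ((expR x - 1 - x) * sin y) (x * (sin y - y)).
have : 8 * (e' * nrm h) <= e * nrm h.
  by rewrite mulrA ler_wpM2r // mulrC -ler_pdivlMr.
have en : 0 <= e' * nrm h by rewrite mulr_ge0 // ltW.
clear -T1 T2 T3 T4 T5 T6 S1 S2 S3 S4 en; lra.
Qed.

Lemma is_derive_cexp z : is_derive z 1 (@cexp R) (cexp z).
Proof.
apply/Cderive_epsP => e e0.
have c0 : 0 < nrm (cexp z) by rewrite nrm_gt0 cexp_neq0.
have [|r r0 Hr] := (Cderive_epsP _ _ _).1 is_derive_cexp0 (e / nrm (cexp z)).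
  by rewrite divr_gt0.
exists r => // h /Hr; rewrite add0r cexp0 mul1r.
move=> H; rewrite cexpD.
have -> : cexp z * cexp h - cexp z - cexp z * h = cexp z * (cexp h - 1 - h) by ring.
rewrite nrmM.
rewrite -ler_pdivlMl //; apply: le_trans H _.
by rewrite (mulrC e) -mulrA.
Qed.

(** The angle ranges over a closed interval, so that a closed disc is the image of a compact
    rectangle on which maxima are attained. *)
Lemma polar z : exists2 t : R, 0 <= t <= 2 * pi & z = ofR (nrm z) * unit_pt t.
Proof.
have [->|z0] := eqVneq z 0.
  by exists 0; [rewrite lexx mulr_ge0 // pi_ge0 | rewrite nrm0 mul0r].
have n0 : nrm z != 0 by rewrite nrm_eq0.
have n1 : ofR (nrm z) != 0 by rewrite -(inj_eq (@ofR_inj R)) in n0.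
set a := Re z / nrm z; set b := Im z / nrm z.
have ab : a ^+ 2 + b ^+ 2 = 1.
  by rewrite /a /b !expr_div_n -mulrDl -nrm_sqr divff // expf_neq0.
have a1 : -1 <= a <= 1.
  rewrite -ler_norml -(@expr_le1 _ 2) // -normrX ger0_norm ?sqr_ge0 //.
  by rewrite -ab lerDl sqr_ge0.
have [p0 p1] := (acos_ge0 a1, acos_lepi a1).
have ca : cos (acos a) = a by apply: acosK; rewrite in_itv /= a1.
have sa : sin (acos a) = `|b|.
  by rewrite sin_acos // -ab addrAC subrr add0r sqrtr_sqr.
have zE t : cos t = a -> sin t = b -> z = ofR (nrm z) * unit_pt t.
  move=> ct st; apply: Cx_eqP; rewrite !ReIm /= ?ct ?st !(mul0r, subr0, addr0);
    by rewrite mulrC divfK.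
have pp := pi_ge0 R.
have [b0|b0] := leP 0 b.
  exists (acos a); first by apply/andP; split; lra.
  by apply: zE; rewrite // sa ger0_norm.
exists (2 * pi - acos a); first by apply/andP; split; lra.
have e : 2 * pi - acos a = (- acos a) + pi *+ 2 by rewrite mulr2n; ring.
by apply: zE; rewrite e ?cosD2pi ?sinD2pi ?cosN ?sinN ?ca ?sa // ltr0_norm // opprK.
Qed.

End ComplexExp.

Section MeanValue.
Variable R : realType.
Local Notation C := (Cx R).
Local Notation Re := (@complex.Re R).
Local Notation Im := (@complex.Im R).

Lemma continuous_along_horizontal (g : C -> C) (y : R) : continuous g ->
  continuous (fun x => Im (g (cpt x y))).
Proof.
move=> cg x; apply/continuous_epsP => e e0.
have [r r0 Hr] := (Ccontinuous_epsP _ _).1 (cg (cpt x y)) _ e0.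
exists r => // x' xr; rewrite -Im_N -Im_D; apply: le_trans (Im_le_nrm _) _; apply: Hr.
rewrite (_ : _ - _ = ofR (x' - x)) ?nrm_ofR //.
by apply: Cx_eqP; rewrite !ReIm //= subrr.
Qed.

Lemma continuous_along_vertical (g : C -> C) (x : R) : continuous g ->
  continuous (fun y => Re (g (cpt x y))).
Proof.
move=> cg y; apply/continuous_epsP => e e0.
have [r r0 Hr] := (Ccontinuous_epsP _ _).1 (cg (cpt x y)) _ e0.
exists r => // y' yr; rewrite -Re_N -Re_D; apply: le_trans (Re_le_nrm _) _; apply: Hr.
rewrite (_ : _ - _ = 'i * ofR (y' - y)).
  by rewrite nrmM nrm_ofR nrm_i mul1r.
by apply: Cx_eqP; rewrite !ReIm /=; ring.
Qed.

Lemma entire_continuous (f : C -> C) : entire f -> continuous f.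
Proof. by move=> ef z; exact/differentiable_continuous/derivable1_diffP. Qed.

Lemma entire_comp (f g : C -> C) : entire f -> entire g -> entire (g \o f).
Proof.
move=> ef eg z; have := is_derive_comp (derivableP (ef z)) (derivableP (eg (f z))).
by case.
Qed.

Lemma entire_CR (g : C -> C) : entire g ->
  forall x y : R, exists a b : R, forall e, 0 < e ->
  exists2 d, 0 < d & forall h k, `|h| < d -> `|k| < d ->
    `|Re (g (cpt (x + h) (y + k))) - Re (g (cpt x y)) - (a * h + b * k)| <= e * (`|h| + `|k|) /\
    `|Im (g (cpt (x + h) (y + k))) - Im (g (cpt x y)) - (a * k - b * h)| <= e * (`|h| + `|k|).
Proof.
move=> eg x y; have [d Hd] : exists d, is_derive (cpt x y) 1 g d.
  by eexists; exact: derivableP.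
exists (Re d), (- Im d) => e e0.
have [r r0 Hr] := (Cderive_epsP _ _ _).1 Hd _ e0.
exists (r / 2); first by rewrite divr_gt0.
move=> h k hr kr; have n1 := nrm_le (cpt h k); rewrite /= in n1.
have n2 : nrm (cpt h k) < r by lra.
have := Hr _ n2; rewrite (_ : cpt x y + _ = cpt (x + h) (y + k)) // => H.
have le_e : e * nrm (cpt h k) <= e * (`|h| + `|k|) by rewrite ler_pM2l.
split.
  apply: le_trans le_e; apply: le_trans H; apply: le_trans (Re_le_nrm _).
  by rewrite !ReIm /= mulNr.
apply: le_trans le_e; apply: le_trans H; apply: le_trans (Im_le_nrm _).
by rewrite !ReIm /= mulNr opprK.
Qed.

Lemma unit_pt2pi : unit_pt (2 * pi) = 1 :> C.
Proof.
by apply: Cx_eqP; rewrite /= mulr_natl ?cos2pi ?sin2pi.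
Qed.

(** The function [f (a + cexp s)] is entire and [2 pi i]-periodic. On a rectangle of height [2 * pi]
    the horizontal sides cancel, so the integral over the circle of radius [expR x] does not depend
    on [x]; for [x] very negative it is close to [2 * pi * Re (f a)]. *)
Lemma mean_value (f : C -> C) (a : C) (r : R) : entire f -> 0 < r ->
  segint 0 (2 * pi) (fun t => Re (f (a + ofR r * unit_pt t))) = 2 * pi * Re (f a).
Proof.
move=> ef r0.
pose g := f \o (fun s : C => a + cexp s).
have eg : entire g.
  have ea : entire (fun s : C => a + cexp s).
    by move=> z; have [] := is_derive_add (is_derive_const a z) (is_derive_cexp z).
  exact: entire_comp ea ef.
have cg := entire_continuous eg.
have pi2 : 0 <= 2 * pi :> R by rewrite mulr_ge0 // pi_ge0.
pose J x := segint 0 (2 * pi) (fun t => Re (g (cpt x t))).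
have Jw x w : 0 <= w -> J (x + w) = J x.
  move=> w0; have := goursat (entire_CR eg) (fun x => @continuous_along_vertical g x cg)
     (fun y => @continuous_along_horizontal g y cg) x 0 w0 pi2.
  rewrite !add0r => E; apply/eqP; rewrite -subr_eq0 /J E subr_eq0; apply/eqP.
  apply: eq_segint => t; rewrite /g /= !cexpE /=.
  by rewrite unit_pt2pi unit_pt0.
have Jln : J (ln r) = segint 0 (2 * pi) (fun t => Re (f (a + ofR r * unit_pt t))).
  by apply: eq_segint => t; rewrite /g /= cexpE /= lnK.
rewrite -Jln; apply/eqP; rewrite -subr_eq0 -normr_le0; apply/ler_addgt0Pl => e e0; rewrite addr0.
have p0 : 0 < 2 * pi + 1 :> R by rewrite ltr_wpDl.
have [|d d0 Hd] := (Ccontinuous_epsP f a).1 (@entire_continuous f ef a) (e / (2 * pi + 1)).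
  by rewrite divr_gt0.
pose x := Num.min (ln r) (ln (d / 2)).
have -> : J (ln r) = J x.
  by rewrite -[ln r](subrK x) (addrC _ x) Jw // subr_ge0 ge_min lexx.
have := @segint_bound _ 0 (2 * pi) (fun t => Re (g (cpt x t))) (Re (f a)) (e / (2 * pi + 1))
  (@continuous_along_vertical g x cg) pi2.
rewrite subr0 (mulrC (Re _)) => H; apply: le_trans (H _) _.
  move=> t _; rewrite -Re_N -Re_D; apply: le_trans (Re_le_nrm _) _; apply: Hd.
  rewrite addrAC subrr add0r nrm_cexp /=.
  apply: (@le_lt_trans _ _ (expR (ln (d / 2)))).
    by rewrite ler_expR ge_min lexx orbT.
  by rewrite lnK ?posrE ?divr_gt0 // ltr_pdivrMr // ltr_pMr // ltr1n.
rewrite mulrAC ler_pdivrMr // ler_pM2l //.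
by rewrite lerDl.
Qed.

End MeanValue.

(** * Derivatives of complex-valued curves *)

Section Curves.
Variable R : realType.
Local Notation C := (Cx R).
Local Notation Re := (@complex.Re R).
Local Notation Im := (@complex.Im R).

Definition is_cderive (t : R) (g : R -> C) (v : C) : Prop :=
  is_derive t 1 (fun s => Re (g s)) (Re v) /\ is_derive t 1 (fun s => Im (g s)) (Im v).

Lemma is_cderive_epsP (t : R) (g : R -> C) (v : C) :
  is_cderive t g v <->
  forall e : R, 0 < e -> exists2 r : R, 0 < r &
    forall h, `|h| < r -> nrm (g (t + h) - g t - v * ofR h) <= e * `|h|.
Proof.
split.
  move=> [/is_derive_epsP H1 /is_derive_epsP H2] e e0.
  have e20 : 0 < e / 2 by rewrite divr_gt0.
  have [r1 r10 K1] := H1 _ e20; have [r2 r20 K2] := H2 _ e20.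
  exists (Num.min r1 r2); first by rewrite lt_min r10.
  move=> h; rewrite lt_min => /andP[/K1 E1 /K2 E2].
  apply: le_trans (nrm_le _) _; rewrite !ReIm !mulr0 subr0 add0r.
  by rewrite (splitr e) mulrDl lerD.
move=> H; split; apply/is_derive_epsP => e e0; have [r r0 K] := H _ e0;
  exists r => // h /K; apply: le_trans.
  by apply: le_trans (Re_le_nrm _); rewrite !ReIm mulr0 subr0.
by apply: le_trans (Im_le_nrm _); rewrite !ReIm mulr0 add0r.
Qed.

Lemma is_cderive_comp (t : R) (g : R -> C) (v : C) (f : C -> C) (d : C) :
  is_cderive t g v -> is_derive (g t) 1 f d -> is_cderive t (fun s => f (g s)) (d * v).
Proof.
move=> /is_cderive_epsP Hg /Cderive_epsP Hf; apply/is_cderive_epsP => e e0.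
have nv := nrm_ge0 v; have nd := nrm_ge0 d.
(* Each of the two errors gets [e / 2]. The tolerance for [g] is capped at 1, which bounds the
   increment [D] by [(nrm v + 1) * |h|]; the tolerance for [f] is divided by this factor, that for
   [g] by [nrm d + 1]. *)
have a0 : 0 < e / (2 * (nrm v + 1)) by rewrite divr_gt0 // mulr_gt0 // ltr_wpDl.
have b0 : 0 < Num.min 1 (e / (2 * (nrm d + 1))).
  by rewrite lt_min ltr01 divr_gt0 // mulr_gt0 // ltr_wpDl.
have [r r0 Kf] := Hf _ a0; have [s s0 Kg] := Hg _ b0.
exists (Num.min s (r / (nrm v + 1))); first by rewrite lt_min s0 divr_gt0 // ltr_wpDl.
move=> h; rewrite lt_min ltr_pdivlMr ?ltr_wpDl // => /andP[/Kg Eg hr].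
set D := g (t + h) - g t.
have E1 : nrm (D - v * ofR h) <= `|h|.
  by apply: le_trans Eg _; rewrite ler_piMl // ge_min lexx.
have E2 : nrm (D - v * ofR h) <= e / (2 * (nrm d + 1)) * `|h|.
  by apply: le_trans Eg _; rewrite ler_wpM2r // ge_min lexx orbT.
have ED : nrm D <= (nrm v + 1) * `|h|.
  have := nrmD (D - v * ofR h) (v * ofR h); rewrite subrK nrmM nrm_ofR mulrDl mul1r.
  by move/le_trans; apply; rewrite addrC lerD2l.
have := Kf D; rewrite {1}/D (addrC (g t)) subrK => Kf'.
have EF := Kf' (le_lt_trans ED (etrans (congr1 (fun x => x < r) (mulrC _ _)) hr)).
have -> : f (g (t + h)) - f (g t) - d * v * ofR h =
  (f (g (t + h)) - f (g t) - d * D) + d * (D - v * ofR h) by ring.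
apply: le_trans (nrmD _ _) _; rewrite nrmM (splitr e) mulrDl lerD //.
  apply: le_trans EF _; rewrite -[leRHS](_ : e / (2 * (nrm v + 1)) * ((nrm v + 1) * `|h|) = _).
    by rewrite ler_pM2l.
  by rewrite invfM !mulrA mulrAC -!mulrA; field; rewrite gt_eqF // ltr_wpDl.
apply: (@le_trans _ _ ((nrm d + 1) * (e / (2 * (nrm d + 1)) * `|h|))).
  by apply: ler_pM => //; [exact: nrm_ge0 | rewrite lerDl].
rewrite le_eqVlt; apply/orP; left; apply/eqP; field.
by rewrite gt_eqF // ltr_wpDl.
Qed.

Lemma is_cderive_mul (t : R) (f g : R -> C) (v w : C) :
  is_cderive t f v -> is_cderive t g w ->
  is_cderive t (fun s => f s * g s) (v * g t + f t * w).
Proof.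
move=> [f1 f2] [g1 g2]; split.
  under eq_fun do rewrite Re_M.
  apply: is_derive_eq (is_derive_sub (is_derive_mul f1 g1) (is_derive_mul f2 g2)) _.
  by rewrite !ReIm; ring.
under eq_fun do rewrite Im_M.
apply: is_derive_eq (is_derive_add (is_derive_mul f1 g2) (is_derive_mul f2 g1)) _.
by rewrite !ReIm; ring.
Qed.

Lemma is_cderive_unit_pt (t : R) : is_cderive t (@unit_pt R) ('i * unit_pt t).
Proof.
split; rewrite !ReIm /= ?(mul0r, mul1r, add0r, sub0r, subr0, addr0).
  exact: is_derive_cos.
exact: is_derive_sin.
Qed.

Lemma is_cderive_ofR (t : R) (f : R -> R) (d : R) :
  is_derive t 1 f d -> is_cderive t (fun s => ofR (f s)) (ofR d).
Proof. by move=> H; split; [exact: H | exact: is_derive_const]. Qed.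

Lemma eq_is_cderive (t : R) (f g : R -> C) v w :
  f =1 g -> v = w -> is_cderive t f v -> is_cderive t g w.
Proof. by move=> /funext -> ->. Qed.

End Curves.

(** * Maximum principle and Liouville-type rigidity *)

Section MaximumPrinciple.
Variable R : realType.
Local Notation C := (Cx R).
Local Notation Re := (@complex.Re R).
Local Notation Im := (@complex.Im R).

Lemma cvg_cpt (T : Type) (F : set_system T) {FF : Filter F} (a b : T -> R) (x y : R) :
  a @ F --> x -> b @ F --> y -> (fun t => cpt (a t) (b t)) @ F --> cpt x y.
Proof.
move=> /cvgrPdist_lt Ha /cvgrPdist_lt Hb; apply/cvgrPdist_lt => e /pos_ofR[d d0 ->].
have d20 : 0 < d / 2 by rewrite divr_gt0.
near=> t; rewrite normE ltr_ofR; apply: le_lt_trans (nrm_le _) _.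
rewrite !ReIm /= (splitr d) ltrD //; near: t; [exact: Ha | exact: Hb].
Unshelve. all: by end_near. Qed.

Lemma continuous_Re : continuous (Re : C -> R).
Proof.
move=> z; apply/(@cvgrPdist_lt R R C (nbhs z) (nbhs_filter z)) => e e0.
apply/Cnear_epsP; exists e => // y.
by apply: le_lt_trans; rewrite -Re_N -Re_D nrmB; exact: Re_le_nrm.
Qed.

Lemma continuous_Im : continuous (Im : C -> R).
Proof.
move=> z; apply/(@cvgrPdist_lt R R C (nbhs z) (nbhs_filter z)) => e e0.
apply/Cnear_epsP; exists e => // y.
by apply: le_lt_trans; rewrite -Im_N -Im_D nrmB; exact: Im_le_nrm.
Qed.

Lemma continuous_polar_Re (f : C -> C) (e : R) : continuous f ->
  continuous (fun p : R * R => Re (f (ofR p.1 * unit_pt p.2)) + e * p.1 ^+ 2).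
Proof.
move=> cf p; apply: cvgD; last first.
  by apply: cvgMr; apply: cvgM; exact: cvg_fst.
have H : (fun p : R * R => ofR p.1 * unit_pt p.2 : C) @ p --> (ofR p.1 * unit_pt p.2 : C).
  have E (q : R * R) : ofR q.1 * unit_pt q.2 = cpt (q.1 * cos q.2) (q.1 * sin q.2) :> C.
    by apply: Cx_eqP; rewrite !ReIm /= !(mul0r, subr0, addr0).
  rewrite E; under eq_cvg do rewrite E.
  apply: cvg_cpt; apply: cvgM; try exact: cvg_fst.
    by apply: cvg_comp; [exact: cvg_snd | exact: continuous_cos].
  by apply: cvg_comp; [exact: cvg_snd | exact: continuous_sin].
have H2 := cvg_comp _ _ H (cf _).
exact: (cvg_comp _ _ H2 (@continuous_Re _)).
Qed.

(* The perturbation [e |z|^2] makes the mean value property strict, so that a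
   maximum over the disc has to be on the boundary. *)
Lemma Re_maximum_principle (f : C -> C) (rho m : R) : entire f ->
  (forall t, Re (f (ofR rho * unit_pt t)) <= m) ->
  forall z, nrm z <= rho -> Re (f z) <= m.
Proof.
move=> ef Hm z zr; apply/ler_addgt0Pl => e' e'0.
have r0 : 0 <= rho := le_trans (nrm_ge0 z) zr.
pose e := e' / (rho ^+ 2 + 1).
have e0 : 0 < e by rewrite divr_gt0 // ltr_wpDl // sqr_ge0.
pose v (w : C) := Re (f w) + e * nrm w ^+ 2.
have pi2 : 0 <= 2 * pi :> R by rewrite mulr_ge0 // pi_ge0.
pose F (p : R * R) := Re (f (ofR p.1 * unit_pt p.2)) + e * p.1 ^+ 2.
have FE r t : 0 <= r -> F (r, t) = v (ofR r * unit_pt t).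
  by move=> r1; rewrite /F /v nrmM nrm_unit_pt nrm_ofR ger0_norm //= mulr1.
have cK : compact (`[0, rho] `*` `[0, 2 * pi] : set (R * R)).
  by apply: compact_setX; exact: segment_compact.
have [] := @compact_EVT_max _ R F (`[0, rho] `*` `[0, 2 * pi]) _ cK.
- by exists (0, 0); split; rewrite /= in_itv /= lexx.
- exact/continuous_subspaceT/continuous_polar_Re/entire_continuous.
move=> [r t] /set_mem[/=]; rewrite !in_itv /= => /andP[r1 r2] _ Hmax.
set a := ofR r * unit_pt t.
have na : nrm a = r by rewrite nrmM nrm_unit_pt nrm_ofR ger0_norm // mulr1.
have vmax w : nrm w <= rho -> v w <= v a.
  move=> wr; have [s sr wE] := polar w.
  rewrite /a -FE // wE -FE ?nrm_ge0 //; apply: Hmax; apply/mem_set.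
  by split; rewrite /= in_itv /= ?nrm_ge0.
have rE : r = rho.
  apply/eqP; move: r2; rewrite le_eqVlt => /orP[//|r2]; exfalso.
  pose d := rho - r; have d0 : 0 < d by rewrite subr_gt0.
  (* On the circle of radius [d] about [a], the term [e |a + w|^2] consists of a constant, of
     [e * d ^+ 2] and of the real part of a linear function of [w]. Moving the latter into the
     entire function [f2], maximality of [v a] puts [Re f2] on the circle at least [e * d ^+ 2]
     below its value at the centre, against the mean value property. *)
  pose f2 (w : C) := f w + (2 * ofR e * a^*) * w.
  have ef2 : entire f2.
    move=> w; have [] := is_derive_add (derivableP (ef w))
       (is_derive_mul (is_derive_const (2 * ofR e * a^*) w) (is_derive_id w 1)).
    by [].
  have MV := mean_value a ef2 d0.
  have B s : Re (f2 (a + ofR d * unit_pt s)) <= Re (f2 a) - e * d ^+ 2.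
    set w := ofR d * unit_pt s.
    have nw : nrm w = d by rewrite nrmM nrm_unit_pt nrm_ofR gtr0_norm // mulr1.
    have /vmax : nrm (a + w) <= rho.
      by apply: le_trans (nrmD _ _) _; rewrite na nw /d addrC subrK.
    rewrite /v /f2 -nw !nrm_sqr !ReIm => vm.
    by rewrite !(mulr0, mul0r, subr0, addr0, add0r); lra.
  have c2 : continuous (fun s => Re (f2 (a + ofR d * unit_pt s))).
    move=> s.
    have E (q : R) : a + ofR d * unit_pt q = cpt (Re a + d * cos q) (Im a + d * sin q) :> C.
      by apply: Cx_eqP; rewrite !ReIm /= !(mul0r, subr0, addr0).
    have H : (fun q : R => a + ofR d * unit_pt q : C) @ s --> (a + ofR d * unit_pt s : C).
      rewrite E; under eq_cvg do rewrite E.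
      apply: cvg_cpt; apply: cvgD; try exact: cvg_cst; apply: cvgMr.
        exact: continuous_cos.
      exact: continuous_sin.
    have H2 := cvg_comp _ _ H (@entire_continuous _ f2 ef2 _).
    exact: (cvg_comp _ _ H2 (@continuous_Re _)).
  have : segint 0 (2 * pi) (fun s => Re (f2 (a + ofR d * unit_pt s))) <=
         segint 0 (2 * pi) (fun=> Re (f2 a) - e * d ^+ 2).
    apply: le_Rintegral => //; apply: continuous_segment_integrable => //.
    by move=> ?; exact: cvg_cst.
  rewrite MV /segint Rintegral_cst //= lebesgue_measure_itv /= lte_fin.
  rewrite mulr_gt0 ?pi_gt0 //= subr0.
  rewrite (mulrC (2 * pi)) ler_pM2r ?mulr_gt0 ?pi_gt0 //.
  by rewrite lerBrDr gerDl leNgt mulr_gt0 // exprn_gt0.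
have va : v a <= m + e'.
  rewrite /v lerD //; first by rewrite /a rE; exact: Hm.
  rewrite na rE /e mulrAC ler_pdivrMr; last by rewrite ltr_wpDl // sqr_ge0.
  by rewrite ler_pM2l // lerDl.
rewrite (addrC e'); apply: le_trans va; apply: le_trans (vmax z zr).
by rewrite /v lerDl mulr_ge0 ?sqr_ge0 // ltW.
Qed.

(** For fixed [z], the unimodular constant [c] rotates [f z] to its modulus, and the principle for
    real parts applies to [c * f]. *)
Lemma maximum_modulus (f : C -> C) (rho M : R) : entire f ->
  (forall t, nrm (f (ofR rho * unit_pt t)) <= M) ->
  forall z, nrm z <= rho -> nrm (f z) <= M.
Proof.
move=> ef HM z zr; have [f0|f0] := eqVneq (f z) 0.
  by rewrite f0 nrm0; apply: le_trans (HM 0); exact: nrm_ge0.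
pose c : C := (f z)^* / ofR (nrm (f z)).
have nf : 0 < nrm (f z) by rewrite nrm_gt0.
have nc : nrm c = 1.
  by rewrite nrmM nrm_conj nrmV nrm_ofR gtr0_norm // divff // gt_eqF.
have ec : entire (fun w => c * f w).
  by move=> w; have [] := is_derive_mul (is_derive_const c w) (derivableP (ef w)).
have H t : Re (c * f (ofR rho * unit_pt t)) <= M.
  apply: le_trans (ler_norm _) _; apply: le_trans (Re_le_nrm _) _.
  by rewrite nrmM nc mul1r.
have := Re_maximum_principle ec H zr.
rewrite /c mulrAC -ofRV mulrC !ReIm mulNr opprK -!expr2 -nrm_sqr mul0r subr0.
by rewrite expr2 mulrA mulVf ?mul1r // gt_eqF.
Qed.

(** If the derivative [d] at a point were nonzero, a small step along ['i * d^*] would change [f],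
    to first order, by a purely imaginary amount. Hence the derivative vanishes on the disc, and [f]
    is constant along the segment from 0 to [z]. *)
Lemma real_on_disc_const (f : C -> C) (z : C) : entire f ->
  (forall w, nrm w < 1 -> Im (f w) = 0) -> nrm z < 1 -> f z = f 0.
Proof.
move=> ef Hf z1.
have d0 w : nrm w < 1 -> is_derive w 1 f 0.
  move=> w1; have [d Hd] : exists d, is_derive w 1 f d by eexists; exact: derivableP.
  suff dE : d = 0 by rewrite dE in Hd.
  apply/eqP; rewrite -nrm_eq0; apply: contraT => nd.
  have nd0 : 0 < nrm d by rewrite lt_neqAle eq_sym nd nrm_ge0.
  have [r r0 Hr] := (Cderive_epsP _ _ _).1 Hd _ (divr_gt0 nd0 (ltr0n R 2) : 0 < nrm d / 2).
  have K (h : C) : nrm h < r -> nrm h < 1 - nrm w -> `|Im (d * h)| <= nrm d / 2 * nrm h.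
    move=> hr hw; have := Hr h hr; apply: le_trans.
    apply: le_trans (Im_le_nrm _); rewrite 2!Im_D !Im_N !Hf // ?subr0 ?sub0r ?normrN //.
    by apply: le_lt_trans (nrmD _ _) _; rewrite addrC -ltrBrDr.
  pose k := Num.min (r / 2) ((1 - nrm w) / 2) / nrm d.
  have k0 : 0 < k by rewrite divr_gt0 // lt_min !divr_gt0 // subr_gt0.
  have k1 : k * nrm d < r /\ k * nrm d < 1 - nrm w.
    have h (x : R) : 0 < x -> x / 2 < x by move=> x0; rewrite ltr_pdivrMr // ltr_pMr // ltr1n.
    rewrite /k divfK //; split; [apply: le_lt_trans (h r r0)|apply: le_lt_trans (h _ _)];
      by rewrite ?ge_min ?lexx ?orbT // subr_gt0.
  have := K (ofR k * ('i * d^*)).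
  have -> : nrm (ofR k * ('i * d^*)) = k * nrm d.
    by rewrite !nrmM nrm_conj nrm_ofR gtr0_norm // nrm_i mul1r.
  move=> /(_ k1.1 k1.2).
  have -> : Im (d * (ofR k * ('i * d^*))) = k * nrm d ^+ 2 by rewrite nrm_sqr !ReIm; ring.
  rewrite ger0_norm; last by rewrite mulr_ge0 ?sqr_ge0 // ltW.
  have x0 : 0 < k * nrm d ^+ 2 by rewrite mulr_gt0 // exprn_gt0.
  rewrite (_ : nrm d / 2 * (k * nrm d) = k * nrm d ^+ 2 / 2); last by ring.
  by rewrite leNgt ltr_pdivrMr // ltr_pMr // ltr1n.
have C0 (s : R) : 0 <= s <= 1 -> is_cderive s (fun s => f (ofR s * z)) 0.
  move=> /andP[s0 s1]; rewrite -(mul0r (1 * z + ofR s * 0)).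
  apply: (@is_cderive_comp _ s (fun s => ofR s * z) _ f).
    apply: is_cderive_mul; first by rewrite -ofR1; apply: is_cderive_ofR; exact: is_derive_id.
    by split; exact: is_derive_const.
  apply: d0; rewrite nrmM nrm_ofR ger0_norm //; apply: le_lt_trans z1.
  by rewrite ler_piMl ?nrm_ge0.
have E (g : R -> R) : (forall s : R, 0 <= s <= 1 -> is_derive s 1 g 0) -> g 1 = g 0.
  move=> Hg; have [||c _] := @MVT_segment R g (fun=> 0) 0 1 ler01.
  - by move=> s; rewrite in_itv /= => /andP[s0 s1]; apply: Hg; rewrite !ltW.
  - apply: derivable_within_continuous => s; rewrite in_itv /= => sb.
    by have [] := Hg s sb.
  by rewrite mul0r => /eqP; rewrite subr_eq0 => /eqP.
apply: Cx_eqP.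
  by have := E _ (fun s sb => (C0 s sb).1); rewrite ofR1 mul1r ofR0 mul0r.
by have := E _ (fun s sb => (C0 s sb).2); rewrite ofR1 mul1r ofR0 mul0r.
Qed.

Lemma nrm_bounded_on_circle (f : C -> C) (rho : R) : entire f ->
  exists M, forall t, nrm (f (ofR rho * unit_pt t)) <= M.
Proof.
move=> ef.
have bd (g : C -> C) : entire g -> exists M, forall z : C, nrm z = `|rho| -> Re (g z) <= M.
  (* The zero term gives [F] the form of [continuous_polar_Re] with [e = 0]. Upper bounds for the
     real parts of [f], [- f], ['i * f] and [- 'i * f] together bound the modulus. *)
  move=> eg; pose F (p : R * R) := Re (g (ofR p.1 * unit_pt p.2)) + 0 * p.1 ^+ 2.
  have pi2 : 0 <= 2 * pi :> R by rewrite mulr_ge0 // pi_ge0.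
  have cK : compact (`[0, `|rho|] `*` `[0, 2 * pi] : set (R * R)).
    by apply: compact_setX; exact: segment_compact.
  have [] := @compact_EVT_max _ R F (`[0, `|rho|] `*` `[0, 2 * pi]) _ cK.
  - by exists (0, 0); split; rewrite /= in_itv /= lexx ?normr_ge0.
  - exact/continuous_subspaceT/continuous_polar_Re/entire_continuous.
  move=> p _ Hp; exists (F p) => z zr; have [t tb ->] := polar z.
  have := Hp (nrm z, t); rewrite {1}/F /= mul0r addr0; apply; apply/mem_set.
  by split; rewrite /= in_itv //= zr normr_ge0 lexx.
have ec (c : C) : entire (fun w => c * f w).
  by move=> w; have [] := is_derive_mul (is_derive_const c w) (derivableP (ef w)).
have [M1 H1] := bd _ (ec 1); have [M2 H2] := bd _ (ec (-1)).
have [M3 H3] := bd _ (ec 'i); have [M4 H4] := bd _ (ec (- 'i)).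
exists (Num.max M1 M2 + Num.max M3 M4) => t.
have nz : nrm (ofR rho * unit_pt t) = `|rho| by rewrite nrmM nrm_ofR nrm_unit_pt mulr1.
have := H1 _ nz; have := H2 _ nz; have := H3 _ nz; have := H4 _ nz.
rewrite !ReIm !(mul0r, oppr0, mul1r, mulN1r, add0r, sub0r, subr0, addr0, opprK) => K4 K3 K2 K1.
apply: le_trans (nrm_le _) _; rewrite lerD // ler_norml lerNl !le_max.
  by rewrite K1 K2 orbT.
by rewrite K3 K4 orbT.
Qed.

(* [(f - c) / z^k] is entire for every [k], so the maximum modulus principle on
   the circle of radius [2 |z|] gives [|f z - c| <= M / 2^k]. *)
Lemma const_on_disc_const (f : C -> C) (c : C) : entire f ->
  (forall z, nrm z < 1 -> f z = c) -> forall z, f z = c.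
Proof.
move=> ef Hf z.
have [z1|z1] := ltP (nrm z) 1; first exact: Hf.
have efc : entire (fun w => f w - c).
  by move=> w; have [] := is_derive_sub (derivableP (ef w)) (is_derive_const c w).
have [M HM] := nrm_bounded_on_circle (2 * nrm z) efc.
have eg k : entire (fun w => (f w - c) * w ^- k).
  move=> w; have [w0|w0] := eqVneq w 0.
    (* Near 0 the factor [f - c] vanishes identically, so the quotient is locally zero, at 0 as
       well, whatever value the inverse takes there. *)
    have Z : is_derive w 1 (fun=> 0 : C) (0 : C) by exact: is_derive_const.
    suff N : \forall t \near w, (fun=> 0) t = (f t - c) * t ^- k :> C.
      by have [] := near_eq_is_derive N Z.
    apply/Cnear_epsP; exists 1 => // y; rewrite w0 subr0 => y1.
    by rewrite Hf // subrr mul0r.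
  have wk : w ^+ k != 0 by rewrite expf_neq0.
  by have [] := is_derive_mul (derivableP (efc w))
       (is_derive_inv (f := fun w => w ^+ k) wk (is_derive_pow k (is_derive_id w 1))).
have zp : 0 < nrm z := lt_le_trans ltr01 z1.
have B k : nrm (f z - c) <= M / 2 ^+ k.
  have := @maximum_modulus _ (2 * nrm z) (M / (2 * nrm z) ^+ k) (eg k) _ z.
  rewrite nrmM nrmV nrmX exprMn invfM mulrA ler_pM2r ?invr_gt0 ?exprn_gt0 //; apply.
    move=> t; rewrite nrmM nrmV nrmX nrmM nrm_unit_pt nrm_ofR mulr1.
    rewrite gtr0_norm ?mulr_gt0 // exprMn invfM -mulrA ler_wpM2r ?HM //.
    by rewrite mulr_ge0 // invr_ge0 exprn_ge0 // ltW.
  by rewrite ler_peMl ?ler1n // ltW.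
apply/eqP; rewrite -subr_eq0 -nrm_eq0; apply: contraT => n0.
have np : 0 < nrm (f z - c) by rewrite lt_neqAle eq_sym n0 nrm_ge0.
have M0 : 0 <= M by apply: le_trans (HM 0); exact: nrm_ge0.
pose k := Num.bound (M / nrm (f z - c)).
have := B k; rewrite leNgt => /negP; case.
rewrite ltr_pdivrMr ?exprn_gt0 // mulrC -ltr_pdivrMr //.
apply: lt_trans (archi_boundP _) _; first by rewrite divr_ge0 // ltW.
by rewrite -natrX ltr_nat ltn_expl.
Qed.

Theorem entire_real_on_circle_const (f : C -> C) : entire f ->
  (forall t, Im (f (unit_pt t)) = 0) -> forall z, f z = f 0.
Proof.
move=> ef Hf; apply: const_on_disc_const => // z z1.
apply: real_on_disc_const => // w w1.
have ec (c : C) : entire (fun w => c * f w).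
  by move=> x; have [] := is_derive_mul (is_derive_const c x) (derivableP (ef x)).
(* The real parts of ['i * f] and [- 'i * f] are [- Im f] and [Im f]; both vanish on the circle,
   hence both are at most 0 inside. *)
have H1 : Re ('i * f w) <= 0.
  apply: (Re_maximum_principle (rho := 1) (ec 'i)); last exact: ltW.
  by move=> t; rewrite ofR1 mul1r !ReIm Hf mul0r mulr0 subr0.
have H2 : Re (- 'i * f w) <= 0.
  apply: (Re_maximum_principle (rho := 1) (ec (- 'i))); last exact: ltW.
  by move=> t; rewrite ofR1 mul1r !ReIm Hf oppr0 mul0r mulr0 subr0.
move: H1 H2; rewrite !ReIm oppr0 !mul0r mul1r mulN1r opprK !sub0r ?add0r => H1 H2.
by apply/eqP; rewrite eq_le; apply/andP; split; lra.
Qed.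

End MaximumPrinciple.

(** * Weighted integrals on the circle *)

Section ImproperFTC.
Variable R : realType.
Local Notation mu := (@lebesgue_measure R).

(** The integrand may be unbounded at the ends, as the weight is for negative [lambda]. The
    indefinite integral [G] of the zero extension of [f] is continuous on the closed interval and
    differs from [k] by a function with zero derivative inside, hence by a constant. *)
Lemma integral_derivative_oo (a b : R) (f k : R -> R) : a < b ->
  mu.-integrable `]a, b[ (EFin \o f) ->
  (forall x, x \in `]a, b[ -> {for x, continuous f}) ->
  (forall x, x \in `]a, b[ -> is_derive x 1 k (f x)) ->
  {within `[a, b], continuous k} ->
  \int[mu]_(x in `]a, b[) f x = k b - k a.
Proof.
move=> ab fi fc kd kc.
pose g := f \_ `]a, b[.
have gE x : x \in `]a, b[ -> g x = f x.
  by move=> xab; rewrite /g patchE mem_setE xab.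
have gi : mu.-integrable `[a, b] (EFin \o g).
  apply: (@integrableS _ _ _ _ setT) => //.
  have [H _] := @integrable_mkcond _ _ _ mu `]a, b[ (EFin \o f) (measurable_itv _).
  by rewrite -restrict_EFin; exact: H.
have gc x : x \in `]a, b[ -> {for x, continuous g}.
  move=> xab; have H : {near x, f =1 g}.
    have := @near_in_itvoo _ a b x xab; apply: filterS => y yab.
    by rewrite gE.
  rewrite /prop_for /continuous_at gE //.
  by apply: cvg_trans (fc x xab); apply: near_eq_cvg; apply: filterS H => y.
pose G x := \int[mu]_(t in `[a, x]) g t.
have Gc : {within `[a, b], continuous G} := parameterized_integral_continuous (ltW ab) gi.
have dk (x : R) : x \in `]a, b[ -> is_derive x 1 (fun y => k y - G y) (f x - f x).
  move=> xab; apply: is_derive_sub; first exact: kd.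
  move: (xab); rewrite in_itv /= => /andP[ax xb].
  have [dG GE] := continuous_FTC1_closed xb gi ax (gc x xab).
  by split=> //; rewrite -derive1E GE gE.
have kGc : {within `[a, b], continuous (fun y => k y - G y)}.
  by move=> x; apply: cvgB; [exact: kc | exact: Gc].
have [c _ ] := @MVT R (fun y => k y - G y) (fun x => f x - f x) a b ab dk kGc.
rewrite subrr mul0r => /eqP; rewrite subr_eq0 => /eqP E.
have Ga : G a = 0 by rewrite /G set_itv1 Rintegral_set1.
rewrite Ga subr0 in E.
have -> : \int[mu]_(x in `]a, b[) f x = G b.
  transitivity (\int[mu]_(x in `]a, b[) g x).
    by apply: eq_Rintegral => x; rewrite mem_setE => /gE ->.
  have gi2 : mu.-integrable `]a, b[ (EFin \o g).
    by apply: integrableS gi => //; exact: subset_itv_oo_cc.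
  rewrite /G /Rintegral; congr fine; symmetry; apply: integral_itv_bndoo.
  by case/integrableP : gi2.
by rewrite -E subKr.
Qed.

End ImproperFTC.

Section WeightedIntegral.
Variable R : realType.
Local Notation C := (Cx R).
Local Notation Re := (@complex.Re R).
Local Notation Im := (@complex.Im R).
Local Notation mu := (@lebesgue_measure R).
Variables (a b : R) (w : R -> R).
Hypothesis ab : a < b.
Hypothesis w_int : mu.-integrable `]a, b[ (EFin \o w).
Hypothesis w_ge0 : forall t, t \in `]a, b[ -> 0 <= w t.

Definition ccont (F : R -> C) :=
  continuous (fun t => Re (F t)) /\ continuous (fun t => Im (F t)).

Lemma ccontM F G : ccont F -> ccont G -> ccont (fun t => F t * G t).
Proof.
move=> [f1 f2] [g1 g2]; split => t.
  under eq_fun do rewrite Re_M; apply: cvgB; apply: cvgM;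
    solve [exact: f1|exact: g1|exact: f2|exact: g2].
under eq_fun do rewrite Im_M; apply: cvgD; apply: cvgM;
  solve [exact: f1|exact: g1|exact: f2|exact: g2].
Qed.

Lemma ccont_unit_pt : ccont (@unit_pt R).
Proof. by split => t /=; [exact: continuous_cos | exact: continuous_sin]. Qed.

Lemma ccont_comp (f : C -> C) (F : R -> C) :
  ccont F -> (forall t, {for F t, continuous f}) -> ccont (fun t => f (F t)).
Proof.
move=> [F1 F2] fc.
have H t : F @ t --> F t.
  have E u : F u = cpt (Re (F u)) (Im (F u)) by apply: Cx_eqP.
  by rewrite E; under eq_cvg do rewrite E; apply: cvg_cpt; [exact: F1|exact: F2].
split => t.
  exact: (cvg_comp _ _ (cvg_comp _ _ (H t) (fc t)) (@continuous_Re R _)).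
exact: (cvg_comp _ _ (cvg_comp _ _ (H t) (fc t)) (@continuous_Im R _)).
Qed.

Definition wint (F : R -> C) : C :=
  cpt (\int[mu]_(t in `]a, b[) (Re (F t) * w t)) (\int[mu]_(t in `]a, b[) (Im (F t) * w t)).

Lemma continuous_mul_integrable (g : R -> R) : continuous g ->
  mu.-integrable `]a, b[ (EFin \o (fun t => g t * w t)).
Proof.
move=> gc; apply: (@integrableMr _ _ _ mu _ _ g _ _ _ w_int) => //.
  by apply: measurable_funTS; exact: continuous_measurable_fun.
have [c _ Hc] := EVT_max (ltW ab) (continuous_subspaceT gc).
have [d _ Hd] := EVT_min (ltW ab) (continuous_subspaceT gc).
exists (Num.max `|g c| `|g d|); split; first exact: num_real.
move=> M; rewrite gt_max => /andP[Mc Md] x /= xab.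
have xab' : x \in `[a, b] by apply: subset_itv_oo_cc xab.
rewrite ler_norml; apply/andP; split.
  rewrite lerNl; apply: le_trans (ltW Md); rewrite -normrN.
  by apply: le_trans (ler_norm _); rewrite lerN2 Hd.
by apply: le_trans (ltW Mc); apply: le_trans (ler_norm _); exact: Hc.
Qed.

Lemma eq_wint F G : {in `]a, b[, F =1 G} -> wint F = wint G.
Proof.
move=> FG; congr cpt; apply: eq_Rintegral => t;
  by rewrite mem_setE => /FG ->.
Qed.

Lemma wintD F G : ccont F -> ccont G ->
  wint (fun t => F t + G t) = wint F + wint G.
Proof.
move=> [f1 f2] [g1 g2]; apply: Cx_eqP; rewrite ReIm /=.
  under eq_Rintegral do rewrite Re_D mulrDl.
  by apply: RintegralD => //; exact: continuous_mul_integrable.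
under eq_Rintegral do rewrite Im_D mulrDl.
by apply: RintegralD => //; exact: continuous_mul_integrable.
Qed.

Lemma wintZ c F : ccont F -> wint (fun t => c * F t) = c * wint F.
Proof.
move=> [f1 f2].
have i1 := continuous_mul_integrable f1.
have i2 := continuous_mul_integrable f2.
have RZ (x : R) (g : R -> R) : continuous g ->
  \int[mu]_(t in `]a, b[) (x * (g t * w t)) = x * \int[mu]_(t in `]a, b[) (g t * w t).
  by move=> gc; apply: RintegralZl => //; exact: continuous_mul_integrable.
have z1 (x : R) := @integrableZl _ _ _ mu _ (measurable_itv `]a, b[) x _ i1.
have z2 (x : R) := @integrableZl _ _ _ mu _ (measurable_itv `]a, b[) x _ i2.
apply: Cx_eqP; rewrite ReIm /=.
  under eq_Rintegral do rewrite Re_M mulrBl -!mulrA.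
  by rewrite -!RZ //; apply: RintegralB => //; [exact: z1 | exact: z2].
under eq_Rintegral do rewrite Im_M mulrDl -!mulrA.
by rewrite -!RZ //; apply: RintegralD => //; [exact: z2 | exact: z1].
Qed.

(** The factor 2 comes from bounding real and imaginary parts separately; the applications only use
    that some constant works for all [F]. *)
Lemma wint_bound F M : ccont F -> 0 <= M ->
  (forall t, t \in `]a, b[ -> nrm (F t) <= M) ->
  nrm (wint F) <= 2 * M * \int[mu]_(t in `]a, b[) w t.
Proof.
move=> [f1 f2] M0 HM; apply: le_trans (nrm_le _) _ => /=.
have B (g : R -> R) : continuous g -> (forall t, t \in `]a, b[ -> `|g t| <= M) ->
  `|\int[mu]_(t in `]a, b[) (g t * w t)| <= M * \int[mu]_(t in `]a, b[) w t.
  move=> gc gM; have gi := continuous_mul_integrable gc.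
  apply: le_trans (le_normr_Rintegral _ gi) _ => //.
  have <- : \int[mu]_(t in `]a, b[) (M * w t) = M * \int[mu]_(t in `]a, b[) w t.
    exact: RintegralZl.
  apply: le_Rintegral => //.
  - exact: integrable_norm.
  - exact: (@integrableZl _ _ _ mu _ (measurable_itv `]a, b[) M _ w_int).
  move=> t /= tab; rewrite normrM (ger0_norm (w_ge0 tab)).
  by rewrite ler_wpM2r ?w_ge0 ?gM.
have B1 := B _ f1 (fun t ht => le_trans (Re_le_nrm _) (HM t ht)).
have B2 := B _ f2 (fun t ht => le_trans (Im_le_nrm _) (HM t ht)).
by rewrite -mulrA mulr_natl mulr2n lerD.
Qed.

Lemma wint_derivative (K F : R -> C) : ccont F ->
  {in `]a, b[, continuous w} ->
  (forall t, t \in `]a, b[ -> is_cderive t K (F t * ofR (w t))) ->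
  {within `[a, b], continuous (fun t => Re (K t))} ->
  {within `[a, b], continuous (fun t => Im (K t))} ->
  wint F = K b - K a.
Proof.
move=> [f1 f2] wc HK c1 c2; apply: Cx_eqP; rewrite !ReIm /=.
  apply: (@integral_derivative_oo _ a b _ (fun t => Re (K t))) => //; first exact: continuous_mul_integrable.
    by move=> t tab; apply: cvgM; [exact: f1 | exact: wc].
  by move=> t /HK[+ _]; rewrite !ReIm mulr0 subr0.
apply: (@integral_derivative_oo _ a b _ (fun t => Im (K t))) => //; first exact: continuous_mul_integrable.
  by move=> t tab; apply: cvgM; [exact: f2 | exact: wc].
by move=> t /HK[_ +]; rewrite !ReIm mulr0 add0r.
Qed.

End WeightedIntegral.

(** * The weight in the angular variable *)

Section CircularWeight.
Variable R : realType.
Local Notation C := (Cx R).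
Local Notation Re := (@complex.Re R).
Local Notation Im := (@complex.Im R).

Lemma carg_polar (r t : R) : 0 < r -> - pi < t < pi ->
  carg (ofR r * unit_pt t) = t.
Proof.
move=> r0 /andP[t1 t2].
have nz : nrm (ofR r * unit_pt t) = r by rewrite nrmM nrm_ofR nrm_unit_pt mulr1 gtr0_norm.
have E : ofR r * unit_pt t / `|ofR r * unit_pt t : C| = unit_pt t.
  rewrite normE nz mulrAC divff ?mul1r // -ofR0 (inj_eq (@ofR_inj R)) gt_eqF //.
rewrite /carg E ReIm /= mul0r addr0 pmulr_rge0 //.
have [t0|t0] := leP 0 t.
  have -> : 0 <= sin t by rewrite sin_ge0_pi // t0 ltW.
  by rewrite cosK // in_itv /= t0 ltW.
have -> : (0 <= sin t) = false.
  apply/negbTE; rewrite -ltNge -oppr_gt0 -sinN sin_gt0_pi // oppr_gt0 t0 /=.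
  by rewrite ltrNl.
by rewrite cosKN ?opprK // ltW ?ltW.
Qed.

Lemma clog_polar (r t : R) : 0 < r -> - pi < t < pi ->
  clog (ofR r * unit_pt t) = cpt (ln r) t.
Proof.
move=> r0 tp; rewrite /clog carg_polar // -/(nrm _) nrmM nrm_ofR nrm_unit_pt.
by rewrite mulr1 gtr0_norm.
Qed.

(** For [0 <= t <= 2 * pi] this is the distance from 1 to [unit_pt t]. *)
Definition chord (t : R) : R := 2 * sin (t / 2).

Lemma chord_gt0 t : t \in `]0, (2 * pi)[ -> 0 < chord t.
Proof.
rewrite in_itv /= => /andP[t0 t1]; rewrite mulr_gt0 // sin_gt0_pi //.
by rewrite divr_gt0 //= ltr_pdivrMr // mulrC.
Qed.

Lemma one_sub_unit_pt (t : R) : 1 - unit_pt t = ofR (chord t) * unit_pt ((t - pi) / 2) :> C.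
Proof.
rewrite /chord mulrBl; have tE : t = t / 2 *+ 2 by rewrite -mulr_natr divfK.
apply: Cx_eqP; rewrite !ReIm /= ?cosBpihalf ?sinBpihalf ?mul0r ?subr0 ?addr0.
  by rewrite {1}tE cos_mulr2n cos2sin2; ring.
by rewrite {1}tE sin_mulr2n; ring.
Qed.

Lemma is_derive_chord (t : R) : is_derive t 1 chord (cos (t / 2)).
Proof.
have H := is_derive_comp (is_derive_mul (is_derive_id t 1) (is_derive_const 2^-1 t))
  (is_derive_sin (t * 2^-1)).
apply: is_derive_eq (is_derive_mul (is_derive_const 2 t) H) _.
by rewrite /=; field.
Qed.

Variables (lambda eta : R).
Let b : C := ofR lambda + 'i * ofR eta.

(** The weight without the factor [H]: on the open interval, [expR (- eta * (t - pi))] times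
    [4 sin^2(t / 2)] to the power [lambda]. As an exponential it is positive for every [t]. *)
Definition circ_weight (t : R) : R :=
  expR (- eta * (t - pi) + 2 * lambda * ln (chord t)).

(** The principal arguments of [- z] and [1 - z] are [t - pi] and [(t - pi) / 2]. The phase
    [- lambda * (t - pi)] from the first power cancels the phase of the second, whose exponent is
    the real number [2 * lambda]. *)
Lemma weight_unit_pt (H : C -> C) (t : R) : t \in `]0, (2 * pi)[ ->
  weight b H (unit_pt t) = ofR (circ_weight t) * H (unit_pt t).
Proof.
move=> tD; have c0 := chord_gt0 tD; move: (tD); rewrite in_itv /= => /andP[t0 t1].
have tp : - pi < t - pi < pi by apply/andP; split; lra.
have pp := pi_gt0 R.
have tp2 : - pi < (t - pi) / 2 < pi by apply/andP; split; lra.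
rewrite /weight one_sub_unit_pt; congr (_ * _).
have -> : - unit_pt t = ofR 1 * unit_pt (t - pi) :> C.
  rewrite mul1r; apply: Cx_eqP; rewrite ReIm /=.
    by rewrite cosB cospi sinpi; ring.
  by rewrite sinB cospi sinpi; ring.
rewrite /cpow !clog_polar // -cexpD.
rewrite -[RHS]mulr1 -unit_pt0 /circ_weight.
rewrite [LHS]cexpE; congr (ofR (expR _) * unit_pt _). all: by rewrite /b !ReIm ln1; field.
Qed.

Lemma is_derive_circ_weight (t : R) : t \in `]0, (2 * pi)[ ->
  is_derive t 1 circ_weight
    (circ_weight t * (- eta + lambda * (cos (t / 2) / sin (t / 2)))).
Proof.
move=> tD; have c0 := chord_gt0 tD.
have s0 : sin (t / 2) != 0 by move: c0; rewrite /chord pmulr_rgt0 // => /gt_eqF ->.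
have Hl := is_derive_comp (is_derive_chord t) (is_derive1_ln c0).
have He := is_derive_add
   (is_derive_mul (is_derive_const (- eta) t) (is_derive_sub (is_derive_id t 1) (is_derive_const pi t)))
   (is_derive_mul (is_derive_const (2 * lambda) t) Hl).
apply: is_derive_eq (is_derive_comp He (is_derive_expR _)) _.
by rewrite /circ_weight /chord /=; field.
Qed.

(* The first factor is the logarithmic derivative of the weight. *)
Lemma circ_weight_pearson (t : R) : sin (t / 2) != 0 ->
  ofR (- eta + lambda * (cos (t / 2) / sin (t / 2))) * (1 - unit_pt t) =
  'i * (- b^* - b * unit_pt t).
Proof.
move=> s0; have tE : t = t / 2 *+ 2 by rewrite -mulr_natr divfK.
have cE : cos t = 1 - 2 * sin (t / 2) ^+ 2 by rewrite {1}tE cos_mulr2n cos2sin2; ring.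
have sE : sin t = 2 * (cos (t / 2) * sin (t / 2)) by rewrite {1}tE sin_mulr2n; ring.
apply: Cx_eqP; rewrite /b !ReIm cE sE; first by field.
transitivity (2 * eta * (cos (t / 2) * sin (t / 2)) - 2 * lambda * cos (t / 2) ^+ 2); first by field.
by rewrite cos2sin2; ring.
Qed.

Lemma chordE_sym t : chord (2 * pi - t) = chord t.
Proof.
rewrite /chord mulrBl mulrAC divff // mul1r sinB sinpi cospi; ring.
Qed.

Hypothesis lambda_gt : - (1 / 2) < lambda.

(** The product is a bounded exponential times [chord t] to the power [2 * lambda + 1], and
    [lambda_gt] makes this exponent positive. Here [E] bounds the exponential, and [d] to the power
    [al] is [e / E]. *)
Lemma chord_circ_weight_small (e : R) : 0 < e -> exists2 d, 0 < d &
  forall t, t \in `]0, (2 * pi)[ -> chord t < d -> `|chord t * circ_weight t| <= e.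
Proof.
move=> e0; pose E := expR (`|eta| * pi); have E0 : 0 < E by exact: expR_gt0.
pose al := 2 * lambda + 1; have al0 : 0 < al by rewrite /al; have := lambda_gt; lra.
exists (expR (ln (e / E) / al)); first exact: expR_gt0.
move=> t tD cd; have c0 := chord_gt0 tD.
have -> : chord t * circ_weight t = expR (- eta * (t - pi)) * expR (al * ln (chord t)).
  by rewrite -[X in X * _](lnK c0) -!expRD; congr expR; rewrite /al; ring.
rewrite gtr0_norm; last by rewrite mulr_gt0 ?expR_gt0.
have -> : e = E * (e / E) by rewrite mulrC divfK // gt_eqF.
apply: ler_pM; rewrite ?expR_ge0 //.
  rewrite ler_expR; apply: le_trans (ler_norm _) _; rewrite normrM normrN ler_wpM2l //.
  move: tD; rewrite in_itv /= => /andP[t0 t1]; rewrite ler_norml; apply/andP; split; lra.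
rewrite -[leRHS]lnK ?posrE ?divr_gt0 // ler_expR mulrC -ler_pdivlMr //.
by rewrite -ler_expR lnK ?posrE // ltW.
Qed.

(** At both ends [chord] is 0, so the product is 0 there whatever the value of [ln] at 0, and this
    is also its limit. *)
Lemma chord_circ_weight_continuous :
  {within `[0, (2 * pi)], continuous (fun t => chord t * circ_weight t)}.
Proof.
have pp := pi_gt0 R.
have pi2 : 0 < 2 * pi :> R by rewrite mulr_gt0.
have c0 : chord 0 = 0 by rewrite /chord mul0r sin0 mulr0.
have cc : continuous chord.
  by move=> t; exact: is_derive_continuous (is_derive_chord t).
apply/continuous_within_itvP => //; split.
- move=> t tD; apply: cvgM; first exact: cc.
  exact: is_derive_continuous (is_derive_circ_weight tD).
- rewrite c0 mul0r; apply/cvgrPdist_le => e e0.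
  have [d d0 Hd] := chord_circ_weight_small e0.
  have /cvgrPdist_lt/(_ _ d0) := cc 0; rewrite c0 => N.
  near=> t.
  have t0 : 0 < t by near: t; exact: nbhs_right_gt.
  have t1 : t < 2 * pi by near: t; exact: nbhs_right_lt.
  rewrite sub0r normrN; apply: Hd; first by rewrite in_itv /= t0.
  have : `|0 - chord t| < d by near: t; exact: cvg_within N.
  by rewrite sub0r normrN; apply: le_lt_trans; exact: ler_norm.
- have c2 : chord (2 * pi) = 0 by rewrite -[2 * pi]subr0 chordE_sym.
  rewrite c2 mul0r; apply/cvgrPdist_le => e e0.
  have [d d0 Hd] := chord_circ_weight_small e0.
  have /cvgrPdist_lt/(_ _ d0) := cc (2 * pi); rewrite c2 => N.
  near=> t.
  have t0 : 0 < t by near: t; exact: nbhs_left_gt.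
  have t1 : t < 2 * pi by near: t; exact: nbhs_left_lt.
  rewrite sub0r normrN; apply: Hd; first by rewrite in_itv /= t0.
  have : `|0 - chord t| < d by near: t; exact: cvg_within N.
  by rewrite sub0r normrN; apply: le_lt_trans; exact: ler_norm.
Unshelve. all: by end_near. Qed.

End CircularWeight.

Section OnCircle.
Variable R : realType.
Local Notation C := (Cx R).
Local Notation Re := (@complex.Re R).
Local Notation Im := (@complex.Im R).
Local Notation mu := (@lebesgue_measure R).
Implicit Types f g : C -> C.

(* A one-constructor type, so that unification never unfolds continuity. *)
Variant on_circle f : Prop :=
  OnCircle of (forall z, nrm z = 1 -> {for z, continuous f}).

Lemma on_circle_at f z : on_circle f -> nrm z = 1 -> {for z, continuous f}.
Proof. by case=> H; exact: H. Qed.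

Lemma nrm1_unit_pt (z : C) : nrm z = 1 -> exists2 t, 0 <= t <= 2 * pi & z = unit_pt t.
Proof. by move=> z1; have [t tb ->] := polar z; exists t; rewrite // z1 mul1r. Qed.

Lemma on_circle_derive f f' : (forall z, nrm z = 1 -> is_derive z 1 f (f' z)) -> on_circle f.
Proof. by move=> H; split=> z z1; exact: is_derive_continuous (H z z1). Qed.

Lemma on_circleD f g : on_circle f -> on_circle g -> on_circle (fun z => f z + g z).
Proof. by move=> [F] [G]; split=> z z1; exact: (continuousD (F z z1) (G z z1)). Qed.

Lemma on_circleM f g : on_circle f -> on_circle g -> on_circle (fun z => f z * g z).
Proof. by move=> [F] [G]; split=> z z1; exact: (continuousM (F z z1) (G z z1)). Qed.

Lemma on_circle_cst (c : C) : on_circle (fun=> c).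
Proof. by apply: (@on_circle_derive _ (fun=> 0)) => z _; exact: is_derive_const. Qed.

Lemma on_circle_id : on_circle id.
Proof. by apply: (@on_circle_derive _ (fun=> 1)) => z _; exact: is_derive_id. Qed.

Lemma on_circle_sub f g : on_circle f -> on_circle g -> on_circle (fun z => f z - g z).
Proof. by move=> [F] [G]; split=> z z1; exact: (continuousB (F z z1) (G z z1)). Qed.

Lemma on_circleX f n : on_circle f -> on_circle (fun z => f z ^+ n).
Proof.
move=> F; elim: n => [|n IH]; first by under eq_fun do rewrite expr0; exact: on_circle_cst.
by under eq_fun do rewrite exprS; exact: on_circleM.
Qed.

Lemma on_circleV f : on_circle f -> (forall z, nrm z = 1 -> f z != 0) ->
  on_circle (fun z => (f z)^-1).
Proof. by move=> [F] f0; split=> z z1; exact: (continuousV (f0 z z1) (F z z1)). Qed.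

Lemma on_circle_horner (p : {poly C}) : on_circle (fun z => p.[z]).
Proof. by apply: (@on_circle_derive _ (fun z => p^`().[z])) => z _; exact: is_derive_horner. Qed.

Lemma circle_neq0 (z : C) : nrm z = 1 -> z != 0.
Proof. by move=> z1; rewrite -nrm_gt0 z1. Qed.

Lemma circle_sub_neq0 (a z : C) : nrm a <> 1 -> nrm z = 1 -> z - a != 0.
Proof. by move=> a1 z1; rewrite subr_eq0; apply/eqP => E; apply: a1; rewrite -E. Qed.

End OnCircle.

(** Reduces continuity on the circle to the non-vanishing there of each denominator. *)
Ltac circle_cont := lazymatch goal with
  | H : on_circle ?f |- on_circle ?f => exact H
  | H : on_circle ?f |- on_circle (fun z => ?f z) => exact H
  | |- on_circle (fun z => z) => exact: on_circle_id
  | |- on_circle (fun _ => ?c) => exact: (on_circle_cst c)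
  | |- on_circle (fun z => @Algebra.add ?V (@?f z) (@Algebra.opp ?W (@?g z))) =>
      apply: on_circle_sub; circle_cont
  | |- on_circle (fun z => @Algebra.add ?V (@?f z) (@?g z)) => apply: on_circleD; circle_cont
  | |- on_circle (fun z => @GRing.mul ?V (@?f z) (@?g z)) => apply: on_circleM; circle_cont
  | |- on_circle (fun z => @GRing.exp ?V (@?f z) ?n) => apply: on_circleX; circle_cont
  | |- on_circle (fun z => @GRing.inv ?V (@?f z)) => apply: on_circleV; [circle_cont |]
  | |- on_circle (fun z => @horner ?V ?p z) => exact: on_circle_horner
  | |- on_circle (@GRing.mul ?V ?a) =>
      exact: (on_circleM (on_circle_cst a) (@on_circle_id _))
  | |- on_circle (@Algebra.add ?V ?a) =>
      exact: (on_circleD (on_circle_cst a) (@on_circle_id _))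
  | |- on_circle (@horner ?V ?p) => exact: on_circle_horner
  end.

(** * Integration against the measure; Cauchy transforms *)

Section CircleFunctional.
Variable R : realType.
Local Notation C := (Cx R).
Local Notation Re := (@complex.Re R).
Local Notation Im := (@complex.Im R).
Local Notation mu := (@lebesgue_measure R).
Implicit Types f g : C -> C.

Lemma on_circle_bounded f : on_circle f ->
  exists2 M, 0 <= M & forall z, nrm z = 1 -> nrm (f z) <= M.
Proof.
move=> F; have [c1 c2] : ccont (fun t => f (unit_pt t)).
  apply: ccont_comp; first exact: ccont_unit_pt.
  by move=> t; apply: (on_circle_at F); exact: nrm_unit_pt.
have pi2 : 0 <= 2 * pi :> R by rewrite mulr_ge0 // pi_ge0.
have B (g : R -> R) : continuous g ->
    exists2 M, 0 <= M & forall t, 0 <= t <= 2 * pi -> `|g t| <= M.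
  move=> gc; have ngc : continuous (fun t => `|g t|).
    by move=> t; apply: cvg_norm; exact: gc.
  have [c _ Hc] := EVT_max pi2 (continuous_subspaceT ngc).
  by exists `|g c| => // t tb; apply: Hc; rewrite in_itv.
have [M1 M10 H1] := B _ c1; have [M2 M20 H2] := B _ c2.
exists (M1 + M2) => [|z /nrm1_unit_pt[t tb ->]]; first exact: addr_ge0.
by apply: le_trans (nrm_le _) _; rewrite lerD ?H1 ?H2.
Qed.

Variables (lambda eta c : R).
Hypothesis lambda_gt : - (1 / 2) < lambda.
Hypothesis c_gt0 : 0 < c.
Let b : C := ofR lambda + 'i * ofR eta.
Let w (t : R) : R := c * circ_weight lambda eta t.
Hypothesis w_int : mu.-integrable `]0%R, (2 * pi)%R[ (EFin \o w).

Let pi2_gt0 : 0 < 2 * pi :> R.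
Proof. by rewrite mulr_gt0 // pi_gt0. Qed.

Let w_ge0 t : t \in `]0%R, (2 * pi)%R[ -> 0 <= w t.
Proof. by move=> _; rewrite mulr_ge0 ?expR_ge0 // ltW. Qed.

(** Integration against [mu] when [H] is the constant [c]: on the circle [dz / (i z)] is the angular
    measure. *)
Definition circ_fun f : C := wint 0 (2 * pi) w (fun t => f (unit_pt t)).
Local Notation L := circ_fun.

Lemma ccont_circle f : on_circle f -> ccont (fun t => f (unit_pt t)).
Proof.
move=> F; apply: ccont_comp; first exact: ccont_unit_pt.
by move=> t; apply: (on_circle_at F); exact: nrm_unit_pt.
Qed.

Lemma eq_circ_fun f g : (forall z, nrm z = 1 -> f z = g z) -> L f = L g.
Proof. by move=> fg; apply: eq_wint => t _; apply: fg; exact: nrm_unit_pt. Qed.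

Lemma circ_funD f g : on_circle f -> on_circle g -> L (fun z => f z + g z) = L f + L g.
Proof. by move=> F G; apply: wintD => //; exact: ccont_circle. Qed.

Lemma circ_funZ (a : C) f : on_circle f -> L (fun z => a * f z) = a * L f.
Proof. by move=> F; apply: wintZ => //; exact: ccont_circle. Qed.

Lemma circ_funB f g : on_circle f -> on_circle g -> L (fun z => f z - g z) = L f - L g.
Proof.
move=> F G; rewrite (@eq_circ_fun _ (fun z => f z + (-1) * g z)); last first.
  by move=> z _; rewrite mulN1r.
have G1 : on_circle (fun z => (-1) * g z) by exact: on_circleM (on_circle_cst (-1)) G.
by rewrite (circ_funD F G1) (circ_funZ (-1) G) mulN1r.
Qed.

Lemma circ_fun_conj f : on_circle f -> L (fun z => (f z)^*) = (L f)^*.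
Proof.
move=> /ccont_circle[f1 f2]; apply: Cx_eqP; rewrite !ReIm /=.
  by apply: eq_Rintegral => t _; rewrite ReIm.
under eq_Rintegral do rewrite ReIm mulNr -mulN1r.
rewrite -[RHS]mulN1r; apply: RintegralZl => //.
exact: continuous_mul_integrable.
Qed.

Lemma circ_fun_bound : exists2 B, 0 <= B & forall f M, on_circle f -> 0 <= M ->
  (forall z, nrm z = 1 -> nrm (f z) <= M) -> nrm (L f) <= B * M.
Proof.
exists (2 * \int[mu]_(t in `]0%R, (2 * pi)%R[) w t).
  by rewrite mulr_ge0 //; apply: Rintegral_ge0 => t; exact: w_ge0.
move=> f M F M0 HM; rewrite mulrAC.
apply: wint_bound => //; first exact: ccont_circle.
by move=> t _; apply: HM; exact: nrm_unit_pt.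
Qed.

(* The derivative of [(1 - z) f nu] integrates to 0 over the circle, because
   [lambda > -1/2] makes [(1 - z) nu] vanish at 1. *)
Lemma circ_fun_parts f f' : (forall z, nrm z = 1 -> is_derive z 1 f (f' z)) ->
  on_circle f' ->
  L (fun z => z * (1 - z) * f' z - (b^* + (b + 1) * z) * f z) = 0.
Proof.
move=> Hf F'; have F := on_circle_derive Hf.
pose g z : C := z * (1 - z) * f' z - (b^* + (b + 1) * z) * f z.
rewrite -/g; have G : on_circle g by rewrite /g; circle_cont.
have iG : 'i * L g = 0; last first.
  by apply: (mulfI (@Ci_neq0 R)); rewrite iG mulr0.
rewrite -(circ_funZ 'i G).
pose K t := f (unit_pt t) * (1 - unit_pt t) * ofR (w t).
(* [K] is the boundary term. Through [F2] the weight occurs only multiplied by [chord], and this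
   product is continuous up to the endpoints even where the weight itself is unbounded. *)
pose F2 t := f (unit_pt t) * unit_pt ((t - pi) / 2).
have KE t : K t = F2 t * ofR (c * (chord t * circ_weight lambda eta t)).
  by rewrite /K one_sub_unit_pt /F2 /w !ofRM; ring.
have F2c : ccont F2.
  apply: ccontM; first exact: ccont_circle.
  have hc : continuous (fun t : R => (t - pi) / 2).
    move=> t; exact: is_derive_continuous (is_derive_mul
      (is_derive_sub (is_derive_id t (1 : R)) (is_derive_const pi t)) (is_derive_const 2^-1 t)).
  split => t; first exact: (continuous_comp (hc t) (@continuous_cos R _)).
  exact: (continuous_comp (hc t) (@continuous_sin R _)).
have KD t : t \in `]0%R, (2 * pi)%R[ -> is_cderive t K (('i * g (unit_pt t)) * ofR (w t)).
  move=> tD.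
  have s0 : sin (t / 2) != 0.
    by move: (chord_gt0 tD); rewrite /chord pmulr_rgt0 // => /gt_eqF ->.
  have d1 := is_cderive_comp (is_cderive_unit_pt t) (Hf _ (nrm_unit_pt t)).
  have d2 : is_cderive t (fun s => 1 - unit_pt s) (- ('i * unit_pt t) : C).
    have := is_cderive_comp (is_cderive_unit_pt t)
      (is_derive_sub (is_derive_const (1 : C) (unit_pt t)) (is_derive_id (unit_pt t) (1 : C))).
    by apply: eq_is_cderive => //; rewrite sub0r mulN1r.
  have d3 := is_derive_mul (is_derive_const c t) (is_derive_circ_weight lambda eta tD).
  have := is_cderive_mul (is_cderive_mul d1 d2) (is_cderive_ofR d3).
  apply: eq_is_cderive => //.
  (* The Pearson equation removes the quotient by [sin (t / 2)]: the factor [1 - u] absorbs the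
     singularity of the logarithmic derivative [A]. *)
  have := circ_weight_pearson lambda eta s0; rewrite -/b => P.
  rewrite mul0r add0r /g /w !ofRM.
  set u := unit_pt t in P *; set A := ofR (- eta + _) in P *.
  transitivity ((f' u * ('i * u) * (1 - u) + f u * (- ('i * u)) + f u * (A * (1 - u))) *
    (ofR c * ofR (circ_weight lambda eta t))); first by ring.
  by rewrite P; ring.
have within_c (h : R -> R) : continuous h ->
    {within `[0, (2 * pi)], continuous (fun t => h t * (c * (chord t * circ_weight lambda eta t)))}.
  move=> hc t; apply: cvgM; first exact: (continuous_subspaceT hc).
  apply: cvgM; first exact: cvg_cst.
  exact: (@chord_circ_weight_continuous R lambda eta lambda_gt t).
have -> : L (fun z => 'i * g z) = K (2 * pi) - K 0.
  apply: (@wint_derivative R 0 (2 * pi) w pi2_gt0 w_int K (fun t => 'i * g (unit_pt t))).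
  - exact: (ccont_circle (on_circleM (on_circle_cst 'i) G)).
  - move=> t tD; apply: cvgM; first exact: cvg_cst.
    exact: is_derive_continuous (is_derive_circ_weight lambda eta tD).
  - exact: KD.
  - have -> : (fun t => Re (K t)) = (fun t => Re (F2 t) * (c * (chord t * circ_weight lambda eta t))).
      by apply/funext => t; rewrite KE Re_M Re_ofR Im_ofR mulr0 subr0.
    by apply: within_c; exact: F2c.1.
  have -> : (fun t => Im (K t)) = (fun t => Im (F2 t) * (c * (chord t * circ_weight lambda eta t))).
    by apply/funext => t; rewrite KE Im_M Re_ofR Im_ofR mulr0 add0r.
  by apply: within_c; exact: F2c.2.
by rewrite /K unit_pt2pi unit_pt0 subrr !mulr0 !mul0r subrr.
Qed.

(** The factor [t] converts the angular measure into [dt / i], so this is [2 * pi] times the Cauchy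
    transform of [f nu]. *)
Definition cauchy_tr f (z : C) : C := L (fun t => t * f t / (t - z)).

Lemma on_circle_cauchy f (z : C) n : nrm z <> 1 -> on_circle f ->
  on_circle (fun t => t * f t / (t - z) ^+ n).
Proof.
move=> z1 F; circle_cont.
by move=> t t1; rewrite expf_neq0 // circle_sub_neq0.
Qed.

Lemma on_circle_cauchy1 f (z : C) : nrm z <> 1 -> on_circle f ->
  on_circle (fun t => t * f t / (t - z)).
Proof. by move=> z1 F; exact: (@on_circle_cauchy f z 1 z1 F). Qed.

(** The first-order error for the kernel [1 / (t - z)] is exactly [h^2 / ((t - z)^2 (t - z - h))].
    If [d] is the distance from [z] to the circle and [|h| < d / 2], it is at most
    [|h|^2 * 2 / d^3]. *)
Lemma is_derive_cauchy_tr f (z : C) : nrm z <> 1 -> on_circle f ->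
  is_derive z 1 (cauchy_tr f) (L (fun t => t * f t / (t - z) ^+ 2)).
Proof.
move=> z1 F; have [M M0 HM] := on_circle_bounded F; have [B B0 HB] := circ_fun_bound.
pose d := `|1 - nrm z|.
have d0 : 0 < d by rewrite normr_gt0 subr_eq0 eq_sym; exact/eqP.
have dle t : nrm t = 1 -> d <= nrm (t - z).
  move=> t1; rewrite /d ler_norml; apply/andP; split.
    by have := nrmD (z - t) t; rewrite subrK t1 nrmB; lra.
  by have := nrmD (t - z) z; rewrite subrK t1; lra.
apply/Cderive_epsP => e e0.
pose K := B * (M * (2 / d ^+ 3)); have K0 : 0 <= K.
  by rewrite !mulr_ge0 // invr_ge0 exprn_ge0 // ltW.
exists (Num.min (d / 2) (e / (K + 1))).
  by rewrite lt_min !divr_gt0 // ltr_wpDl.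
move=> h; rewrite lt_min => /andP[hd he].
have zh1 : nrm (z + h) <> 1.
  by move=> E; have := dle _ E; rewrite addrAC subrr add0r; lra.
have tzh t : nrm t = 1 -> d / 2 <= nrm (t - (z + h)).
  move=> t1; have := dle t t1; have := nrmD (t - (z + h)) h.
  by rewrite opprD addrA subrK; lra.
have o2 := @on_circle_cauchy f z 2 z1 F.
have o3 : on_circle (fun t => h ^+ 2 * ((t * f t / (t - z) ^+ 2) / (t - (z + h)))).
  by circle_cont => t t1; rewrite ?expf_neq0 // circle_sub_neq0.
have -> : cauchy_tr f (z + h) - cauchy_tr f z - L (fun t => t * f t / (t - z) ^+ 2) * h =
   L (fun t => h ^+ 2 * ((t * f t / (t - z) ^+ 2) / (t - (z + h)))).
  have oh : on_circle (fun t => h * (t * f t / (t - z) ^+ 2)).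
    exact: on_circleM (on_circle_cst h) o2.
  have oa := on_circle_cauchy1 zh1 F.
  have ob := on_circle_cauchy1 z1 F.
  rewrite mulrC -(circ_funZ h o2) /cauchy_tr -(circ_funB oa ob).
  rewrite -(circ_funB (on_circle_sub oa ob) oh).
  apply: eq_circ_fun => t t1; field.
  by rewrite !circle_sub_neq0.
have : nrm (L (fun t => h ^+ 2 * ((t * f t / (t - z) ^+ 2) / (t - (z + h))))) <=
    B * (nrm h ^+ 2 * (M * (2 / d ^+ 3))).
  have P0 : 0 <= 2 / d ^+ 3 by rewrite divr_ge0 // exprn_ge0 // ltW.
  apply: HB => //; first by rewrite mulr_ge0 ?sqr_ge0 // mulr_ge0.
  move=> t t1; rewrite !nrmM !nrmV !nrmX t1 mul1r ler_wpM2l ?sqr_ge0 // -mulrA.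
  apply: ler_pM; rewrite ?nrm_ge0 ?HM //.
    by rewrite mulr_ge0 // invr_ge0 ?nrm_ge0 // exprn_ge0 // nrm_ge0.
  have -> : 2 / d ^+ 3 = (d ^+ 2)^-1 * (d / 2)^-1 by field; rewrite gt_eqF.
  have dt := dle t t1; have ht := tzh t t1.
  have dt0 := lt_le_trans d0 dt.
  have d20 : 0 < d / 2 by rewrite divr_gt0.
  apply: ler_pM; rewrite ?invr_ge0 ?exprn_ge0 ?nrm_ge0 //.
    by rewrite lef_pV2 ?posrE ?exprn_gt0 // ler_sqr ?nnegrE // ltW.
  by rewrite lef_pV2 ?posrE // (lt_le_trans d20).
move/le_trans; apply.
have -> : B * (nrm h ^+ 2 * (M * (2 / d ^+ 3))) = nrm h * (nrm h * K).
  by rewrite /K; move: (2 / d ^+ 3) => x; ring.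
rewrite (mulrC e) ler_wpM2l ?nrm_ge0 //.
apply: le_trans (_ : nrm h * (K + 1) <= _); first by rewrite ler_wpM2l ?nrm_ge0 // lerDl.
by rewrite -ler_pdivlMr ?ltW // ltr_wpDl.
Qed.

Lemma cauchy_trD f g z : nrm z <> 1 -> on_circle f -> on_circle g ->
  cauchy_tr (fun t => f t + g t) z = cauchy_tr f z + cauchy_tr g z.
Proof.
move=> z1 F G; rewrite /cauchy_tr.
rewrite -(circ_funD (on_circle_cauchy1 z1 F) (on_circle_cauchy1 z1 G)).
by apply: eq_circ_fun => t _; rewrite mulrDr mulrDl.
Qed.

Lemma cauchy_trZ a f z : nrm z <> 1 -> on_circle f ->
  cauchy_tr (fun t => a * f t) z = a * cauchy_tr f z.
Proof.
move=> z1 F; rewrite /cauchy_tr -(circ_funZ a (on_circle_cauchy1 z1 F)).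
by apply: eq_circ_fun => t _; rewrite !mulrA (mulrC t).
Qed.

Lemma cauchy_tr_mulX f z : nrm z <> 1 -> on_circle f ->
  cauchy_tr (fun t => t * f t) z = z * cauchy_tr f z + L (fun t => t * f t).
Proof.
move=> z1 F; have o1 := on_circle_cauchy1 z1 F.
rewrite /cauchy_tr -(circ_funZ z o1).
rewrite -(circ_funD (on_circleM (on_circle_cst z) o1) (on_circleM (@on_circle_id R) F)).
by apply: eq_circ_fun => t t1; field; exact: circle_sub_neq0.
Qed.

(** Integration by parts applied to [t f(t) / (t - z)]. Since [t (1 - t) = z (1 - z) + (t - z) (1 -
    t - z)], the double pole leaves the left-hand side, and all other terms have a simple pole. *)
Lemma cauchy_tr_ode f f' z : nrm z <> 1 ->
  (forall t, nrm t = 1 -> is_derive t 1 f (f' t)) -> on_circle f' ->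
  z * (1 - z) * L (fun t => t * f t / (t - z) ^+ 2) =
  cauchy_tr (fun t => t * (1 - t) * f' t - (b^* + (1 + b) * t) * f t + z * f t) z.
Proof.
move=> z1 Hf F'; have F := on_circle_derive Hf.
pose g t := t * f t / (t - z).
pose g' t := (f t + t * f' t) / (t - z) + t * f t * (- 1 / (t - z) ^+ 2).
have Hg t : nrm t = 1 -> is_derive t 1 g (g' t).
  move=> t1; have tz := circle_sub_neq0 z1 t1.
  apply: is_derive_eq (is_derive_mul (is_derive_mul (is_derive_id t (1 : C)) (Hf t t1))
    (is_derive_inv (f := fun t => t - z) tz (is_derive_sub (is_derive_id t (1 : C)) (is_derive_const z t)))) _.
  by rewrite mul1r subr0.
have G' : on_circle g'.
  by rewrite /g'; circle_cont => t t1; rewrite ?expf_neq0 // circle_sub_neq0.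
have P := circ_fun_parts Hg G'.
have G := on_circle_derive Hg.
have o2 := @on_circle_cauchy f z 2 z1 F.
have o3 : on_circle (fun t => t * (1 - t) * f' t - (b^* + (1 + b) * t) * f t + z * f t) by circle_cont.
have o4 : on_circle (fun z => z * (1 - z) * g' z - (b^* + (b + 1) * z) * g z) by circle_cont.
rewrite -(circ_funZ (z * (1 - z)) o2) -[RHS]subr0 -P /cauchy_tr.
rewrite -(circ_funB (on_circle_cauchy1 z1 o3) o4).
by apply: eq_circ_fun => t t1; rewrite /g /g'; field; exact: circle_sub_neq0.
Qed.

End CircleFunctional.

(** * Orthogonal polynomials and their Cauchy transforms *)

Section Polynomials.
Variable R : realType.
Local Notation C := (Cx R).
Implicit Types p q r : {poly C}.

Lemma circle_conj (z : C) : nrm z = 1 -> z^* = z^-1.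
Proof.
move=> z1; apply: (mulfI (circle_neq0 z1)).
rewrite divff ?circle_neq0 //.
by apply: Cx_eqP; rewrite !ReIm; [rewrite mulrN opprK -!expr2 -nrm_sqr z1 expr1n | ring].
Qed.

Lemma on_circle_conj (f : C -> C) : on_circle f -> on_circle (fun z => (f z)^*).
Proof.
move=> F; split=> z z1; apply/Ccontinuous_epsP => e e0.
have [r r0 Hr] := (Ccontinuous_epsP _ _).1 (on_circle_at F z1) _ e0.
by exists r => // y /Hr; rewrite -rmorphB nrm_conj.
Qed.

(* [z^m conj(p(1 / conj z))] as a polynomial, provided [size p <= m + 1]. *)
Definition revp (m : nat) p : {poly C} := \poly_(i < m.+1) (p`_(m - i))^*.

Lemma size_revp m p : (size (revp m p) <= m.+1)%N.
Proof. exact: size_poly. Qed.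

Lemma coef0_revp m p : (revp m p)`_0 = (p`_m)^*.
Proof. by rewrite coef_poly subn0. Qed.

Lemma coef_revp_max m p : (revp m p)`_m = (p`_0)^*.
Proof. by rewrite coef_poly ltnSn subnn. Qed.

Lemma horner_revp m p (z : C) : (size p <= m.+1)%N -> z != 0 ->
  (revp m p).[z] = z ^+ m * (p.[1 / z^*])^*.
Proof.
move=> sp z0; rewrite (horner_coef_wide _ (size_revp m p)) (horner_coef_wide _ sp).
rewrite rmorph_sum mulr_sumr (reindex_inj rev_ord_inj) /=.
apply: eq_bigr => i _; rewrite coef_poly subSS.
have im : (i <= m)%N by rewrite -ltnS.
have cE : ((1 / z^*) ^+ i)^* = z ^- i by rewrite div1r rmorphXn /= fmorphV /= conjCK exprVn.
rewrite ltnS leq_subr subKn // rmorphM /= cE mulrCA; congr (_ * _).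
have -> : z ^+ m = z ^+ (m - i) * z ^+ i by rewrite -exprD subnK.
by rewrite mulfK // expf_neq0.
Qed.

Lemma horner_revp_circle m p (z : C) : (size p <= m.+1)%N -> nrm z = 1 ->
  (revp m p).[z] = z ^+ m * (p.[z])^*.
Proof.
move=> sp z1; rewrite horner_revp ?circle_neq0 //.
by rewrite (circle_conj z1) mul1r invrK.
Qed.

Lemma reversedE m p (z : C) : (size p <= m.+1)%N -> z != 0 ->
  reversed m p z = (revp m p).[z].
Proof. by move=> sp z0; rewrite horner_revp. Qed.

(** These are the densities, relative to [nu], of the Cauchy integrals [Gfun] and [Gstar]. *)
Definition laurent p n (z : C) : C := p.[z] / z ^+ n.

Definition laurent' p n (z : C) : C := laurent p^`() n z - n%:R * laurent p n.+1 z.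

Lemma is_derive_laurent p n (z : C) : z != 0 -> is_derive z 1 (laurent p n) (laurent' p n z).
Proof.
move=> z0; have zn : z ^+ n != 0 by rewrite expf_neq0.
apply: is_derive_eq (is_derive_mul (is_derive_horner p z)
  (is_derive_inv (f := fun z => z ^+ n) zn (is_derive_pow n (is_derive_id z (1 : C))))) _.
rewrite /laurent' /laurent; case: n zn => [|n] zn; first by rewrite !expr0; field.
rewrite !exprS /=; move: zn; rewrite exprS mulf_eq0 negb_or => /andP[_].
by move: (z ^+ n) => u u0; field; rewrite u0 z0.
Qed.

Lemma on_circle_laurent p n : on_circle (laurent p n).
Proof.
rewrite /laurent; apply: on_circleM; first exact: on_circle_horner.
by circle_cont => z z1; rewrite expf_neq0 // circle_neq0.
Qed.

Lemma on_circle_laurent' p n : on_circle (laurent' p n).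
Proof.
apply: on_circle_sub; first exact: on_circle_laurent.
apply: on_circleM; [exact: on_circle_cst | exact: on_circle_laurent].
Qed.

Variables (lambda eta c : R).
Hypothesis lambda_gt : - (1 / 2) < lambda.
Hypothesis c_gt0 : 0 < c.
Let b : C := ofR lambda + 'i * ofR eta.
Hypothesis w_int : (@lebesgue_measure R).-integrable `]0%R, (2 * pi)%R[
  (EFin \o (fun t => c * circ_weight lambda eta t)).
Local Notation L := (circ_fun lambda eta c).

Definition ip p q : C := L (fun z => p.[z] * (q.[z])^*).

Lemma on_circle_ip p q : on_circle (fun z => p.[z] * (q.[z])^*).
Proof. by apply: on_circleM; [|apply: on_circle_conj]; exact: on_circle_horner. Qed.

Lemma ipDl p p' q : ip (p + p') q = ip p q + ip p' q.
Proof.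
rewrite /ip -(circ_funD w_int (on_circle_ip p q) (on_circle_ip p' q)).
by apply: eq_circ_fun => z _; rewrite hornerD mulrDl.
Qed.

Lemma ipZl (a : C) p q : ip (a *: p) q = a * ip p q.
Proof.
rewrite /ip -(circ_funZ w_int a (on_circle_ip p q)).
by apply: eq_circ_fun => z _; rewrite hornerZ mulrA.
Qed.

Lemma ip_conj p q : (ip p q)^* = ip q p.
Proof.
rewrite /ip -(circ_fun_conj w_int (on_circle_ip p q)).
by apply: eq_circ_fun => z _; rewrite rmorphM /= conjCK mulrC.
Qed.

Lemma ipDr p q q' : ip p (q + q') = ip p q + ip p q'.
Proof. by rewrite -ip_conj ipDl rmorphD /= !ip_conj. Qed.

Lemma ipZr (a : C) p q : ip p (a *: q) = a^* * ip p q.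
Proof. by rewrite -ip_conj ipZl rmorphM /= ip_conj. Qed.

Lemma ip0l q : ip 0 q = 0.
Proof. by rewrite -(scale0r 0) ipZl mul0r. Qed.

Lemma ip0r q : ip q 0 = 0.
Proof. by rewrite -ip_conj ip0l rmorph0. Qed.

Lemma ipBl p p' q : ip (p - p') q = ip p q - ip p' q.
Proof. by rewrite ipDl -scaleN1r ipZl mulN1r. Qed.

Lemma ipXX p q : ip ('X * p) ('X * q) = ip p q.
Proof.
apply: eq_circ_fun => z z1; rewrite !hornerM !hornerX rmorphM /= (circle_conj z1).
by field; exact: circle_neq0.
Qed.

(** On the circle both integrands are [z ^+ m] times the conjugates of [p] and [q]. *)
Lemma ip_revp m p q : (size p <= m.+1)%N -> (size q <= m.+1)%N ->
  ip (revp m p) q = ip (revp m q) p.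
Proof.
move=> sp sq; apply: eq_circ_fun => z z1.
by rewrite !horner_revp_circle //; ring.
Qed.

Lemma ip_sumr p q : ip p q = \sum_(i < size q) (q`_i)^* * ip p 'X^i.
Proof.
rewrite -[X in ip p X]coefK poly_def.
elim/big_ind2: _ => [|x y x' y' <- <-|i _]; [exact: ip0r | exact: ipDr |].
by rewrite ipZr.
Qed.

(** Integration by parts for [p / z^(k+1)], because conjugation inverts [z] on the circle. Only two
    neighbouring moments of [p] appear, so orthogonality of [p] to powers of [z] passes to
    [z (1 - z) p']. *)
Lemma ip_parts p k :
  ip ('X * (1 - 'X) * p^`()) 'X^(k.+1) =
  (k.+1%:R + b^*) * ip p 'X^(k.+1) + (b - k%:R) * ip p 'X^k.
Proof.
have Hf z (z1 : nrm z = 1) := is_derive_laurent p k.+1 (circle_neq0 z1).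
have P := circ_fun_parts lambda_gt w_int Hf (on_circle_laurent' p k.+1).
rewrite -/b in P.
have o1 := on_circle_ip ('X * (1 - 'X) * p^`()) 'X^(k.+1).
have o2 := on_circle_ip p 'X^(k.+1).
have o3 := on_circle_ip p 'X^k.
have o2' := on_circleM (on_circle_cst (k.+1%:R + b^*)) o2.
have o3' := on_circleM (on_circle_cst (b - k%:R)) o3.
apply/eqP; rewrite -subr_eq0 -P /ip.
rewrite -(circ_funZ w_int _ o2) -(circ_funZ w_int _ o3) -(circ_funD w_int o2' o3').
rewrite -(circ_funB w_int o1 (on_circleD o2' o3')); apply/eqP.
apply: eq_circ_fun => z z1; have z0 := circle_neq0 z1.
rewrite /laurent' /laurent !hornerM !hornerXn hornerD hornerN hornerX (hornerC 1) !rmorphXn /= (circle_conj z1).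
rewrite !exprVn !exprS -natr1.
have zk : z ^+ k != 0 by rewrite expf_neq0.
move: (z ^+ k) zk => u u0; field; by rewrite u0 z0.
Qed.

Variables (Phi : nat -> {poly C}) (kappa : nat -> R).
Hypothesis Phi_monic : forall n, Phi n \is monic.
Hypothesis size_Phi : forall n, size (Phi n) = n.+1.
Hypothesis kappa_gt0 : forall n, 0 < kappa n.
Hypothesis ip_Phi : forall n m, ip (Phi n) (Phi m) = ofR (kappa n ^- 2) *+ (n == m).

Lemma Phi_lead n : (Phi n)`_n = 1.
Proof. by have /monicP := Phi_monic n; rewrite lead_coefE size_Phi. Qed.

Lemma size_sub_lead n p : (size p <= n.+1)%N -> (size (p - p`_n *: Phi n)%R <= n)%N.
Proof.
move=> sp; apply/leq_sizeP => j; rewrite leq_eqVlt => /predU1P[<-|nj].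
  by rewrite coefB coefZ Phi_lead mulr1 subrr.
have pj : p`_j = 0 by rewrite nth_default // (leq_trans sp).
have Pj : (Phi n)`_j = 0 by rewrite nth_default // size_Phi.
by rewrite coefB coefZ pj Pj mulr0 subr0.
Qed.

Lemma ip_Phi_lower n q : (size q <= n)%N -> ip (Phi n) q = 0.
Proof.
have H m : (m <= n)%N -> forall q, (size q <= m)%N -> ip (Phi n) q = 0.
  elim: m => [|m IH] mn r sr; first by move: sr; rewrite leqn0 size_poly_eq0 => /eqP ->; exact: ip0r.
  rewrite -[r](subrK (r`_m *: Phi m)) ipDr IH ?size_sub_lead ?(ltnW mn) //.
  by rewrite ipZr ip_Phi gtn_eqF // mulr0 addr0.
exact: (H n).
Qed.

Lemma kappa_neq0 n : ofR (kappa n ^- 2) != 0 :> C.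
Proof. by rewrite -nrm_gt0 nrm_ofR normr_gt0 invr_eq0 expf_eq0 /= gt_eqF. Qed.

(** Pairing with the orthogonal polynomial of top degree isolates the leading coefficient, since its
    squared norm is nonzero; then the degree drops. *)
Lemma ip_nondegenerate n p : (size p <= n)%N ->
  (forall q, (size q <= n)%N -> ip p q = 0) -> p = 0.
Proof.
elim: n => [|n IH] in p * => sp H; first by apply/eqP; rewrite -size_poly_eq0 -leqn0.
have pn : p`_n = 0.
  have := H (Phi n); rewrite size_Phi => /(_ (leqnn _)).
  rewrite -[p in ip p _](subrK (p`_n *: Phi n)) ipDl -ip_conj ip_Phi_lower ?size_sub_lead //.
  rewrite rmorph0 add0r ipZl ip_Phi eqxx mulr1n => /eqP.
  by rewrite mulf_eq0 (negbTE (kappa_neq0 n)) orbF => /eqP.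
have := size_sub_lead sp; rewrite pn scale0r subr0 => sp'.
by apply: IH => // q sq; apply: H; exact: leqW.
Qed.

(** After the exchange [ip_revp], pairing with [Phi m] extracts the top coefficient of the reversal
    of [q], the conjugate of its constant coefficient. *)
Lemma ip_revp_Phi m q : (size q <= m.+1)%N ->
  ip (revp m (Phi m)) q = (q`_0)^* * ofR (kappa m ^- 2).
Proof.
move=> sq; rewrite ip_revp ?size_Phi //.
rewrite -[revp m q](subrK ((revp m q)`_m *: Phi m)) ipDl -ip_conj ip_Phi_lower.
  by rewrite rmorph0 add0r ipZl ip_Phi eqxx mulr1n coef_revp_max.
exact/size_sub_lead/size_revp.
Qed.

Lemma revp_Phi0 m : (revp m (Phi m)).[0] = 1.
Proof. by rewrite horner_coef0 coef0_revp Phi_lead rmorph1. Qed.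

(** The reversed polynomial spans the polynomials of degree at most [m] orthogonal to [z, ..., z^m].
    Indeed [r - r.[0] *: revp m (Phi m)] vanishes at 0; divided by [z], which is an isometry, it is
    orthogonal to its whole space. *)
Lemma ip_revp_Phi_char m r : (size r <= m.+1)%N ->
  (forall q, (size q <= m)%N -> ip r ('X * q) = 0) ->
  r = r.[0] *: revp m (Phi m).
Proof.
move=> sr H; apply/eqP; rewrite -subr_eq0; set t := _ - _.
have : root t 0 by rewrite /root /t hornerD hornerN hornerZ revp_Phi0 mulr1 subrr.
move/factor_theorem => [t' tE]; rewrite subr0 mulrC in tE.
have st : (size t <= m.+1)%N.
  by rewrite /t (leq_trans (size_polyD _ _)) // geq_max sr size_polyN (leq_trans (size_scale_leq _ _)) // size_revp.
have [t0|t0] := eqVneq t' 0; first by rewrite tE t0 mulr0.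
have st' : (size t' <= m)%N by move: st; rewrite tE mulrC size_mulX.
suff t'0 : t' = 0 by rewrite t'0 eqxx in t0.
apply: (ip_nondegenerate st') => q sq; rewrite -ipXX -tE /t ipBl ipZl H // ip_revp_Phi.
  by rewrite coefXM /= rmorph0 mul0r mulr0 subr0.
have [->|q0] := eqVneq q 0; first by rewrite mulr0 size_poly0.
by rewrite mulrC size_mulX.
Qed.

End Polynomials.

(** * The linear system for the entries of [Y_n], with [n = m.+1] *)

Section RiemannHilbert.
Variable R : realType.
Local Notation C := (Cx R).
Implicit Types p q r : {poly C}.
Variables (lambda eta c : R).
Hypothesis lambda_gt : - (1 / 2) < lambda.
Hypothesis c_gt0 : 0 < c.
Let b : C := ofR lambda + 'i * ofR eta.
Hypothesis w_int : (@lebesgue_measure R).-integrable `]0%R, (2 * pi)%R[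
  (EFin \o (fun t => c * circ_weight lambda eta t)).
Local Notation L := (circ_fun lambda eta c).
Local Notation ip := (ip lambda eta c).
Local Notation CT := (cauchy_tr lambda eta c).
Variables (Phi : nat -> {poly C}) (kappa : nat -> R).
Hypothesis Phi_monic : forall n, Phi n \is monic.
Hypothesis size_Phi : forall n, size (Phi n) = n.+1.
Hypothesis kappa_gt0 : forall n, 0 < kappa n.
Hypothesis ip_Phi : forall n m, ip (Phi n) (Phi m) = ofR (kappa n ^- 2) *+ (n == m).
Variable m : nat.
Let P := Phi m.+1.
Let S := revp m (Phi m).

Lemma ip_mulX_eq0 r : (forall k, (k < m)%N -> ip r 'X^(k.+1) = 0) ->
  forall q, (size q <= m)%N -> ip r ('X * q) = 0.
Proof.
move=> H q sq; rewrite ip_sumr // big1 // => -[[|k] kq] _ /=.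
  by rewrite coefXM /= rmorph0 mul0r.
rewrite H ?mulr0 //; apply: leq_trans sq.
rewrite -ltnS; apply: leq_trans kq _; have [->|q0] := eqVneq q 0.
  by rewrite mulr0 !size_poly0.
by rewrite mulrC size_mulX.
Qed.

Lemma coef_pearson p j :
  ('X * (1 - 'X) * p^`())`_j = j%:R * p`_j - j.-1%:R * p`_j.-1.
Proof.
have -> : 'X * (1 - 'X) * p^`() = 'X * (p^`() - 'X * p^`()) by ring.
rewrite coefXM; case: j => [|[|j]] /=; rewrite ?mul0r ?subr0 // coefB coefXM /= !coef_deriv.
  by rewrite subr0 mulr1n mul1r.
by rewrite !mulr_natl.
Qed.

Lemma ip_P_X k : (k <= m)%N -> ip P 'X^k = 0.
Proof. by move=> km; apply: (ip_Phi_lower w_int) => //; rewrite size_polyXn. Qed.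

Lemma ip_S_X k : (k <= m)%N -> ip S 'X^k = (k == 0)%:R * ofR (kappa m ^- 2).
Proof.
move=> km; rewrite /S (ip_revp_Phi w_int Phi_monic size_Phi ip_Phi) ?size_polyXn //.
by rewrite coefXn eq_sym rmorph_nat.
Qed.

(** The leading term of [z (1 - z) P'] is cancelled by [m.+1%:R *: ('X * P)], and a multiple of [P]
    removes the next one. By [ip_parts] the rest, of degree at most [m], is orthogonal to
    [z, ..., z^m], hence a multiple of [S]. *)
Lemma pearson_P : exists c0 c2 : C,
  'X * (1 - 'X) * P^`() = c0 *: P - m.+1%:R *: ('X * P) + c2 *: S.
Proof.
set A := _ * _ * _; pose r1 := A + m.+1%:R *: ('X * P).
have s1 : (size r1 <= m.+2)%N.
  apply/leq_sizeP => j; rewrite leq_eqVlt => /predU1P[<-|jm];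
    rewrite /r1 coefD coefZ coefXM coef_pearson /=.
    by rewrite (nth_default _ (_ : size P <= m.+2)%N) ?size_Phi // mulr0 sub0r addNr.
  have Pj i : (m.+1 < i)%N -> P`_i = 0 by move=> mi; rewrite nth_default // size_Phi.
  case: j jm => [//|j] jm /=.
  by rewrite (Pj j) ?(Pj j.+1) ?mulr0 ?subr0 ?addr0 // ltnW.
have := size_sub_lead Phi_monic size_Phi s1; set r := r1 - _ => sr.
have H : r = r.[0] *: S.
  apply: (ip_revp_Phi_char w_int Phi_monic size_Phi kappa_gt0 ip_Phi) => //.
  apply: ip_mulX_eq0 => k km.
  rewrite /r /r1 ipBl // ipDl // !ipZl // (ip_parts lambda_gt w_int).
  rewrite exprS ipXX // -exprS !ip_P_X ?(ltnW km) //.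
  by rewrite !mulr0 !addr0 subr0.
exists r1`_m.+1, r.[0]; rewrite -H /r /r1 /P.
by rewrite addrA addrAC addrC [RHS]addrA; ring.
Qed.

(** The coefficient of ['X * S] is forced by the pairing with [z]: there [ip_parts] leaves [b] times
    the pairing of [S] with 1, which is nonzero and equals that of ['X * S] with [z]. The pairings
    with [z^2, ..., z^m] vanish for both terms. *)
Lemma pearson_S : exists d0 e0 : C,
  'X * (1 - 'X) * S^`() = d0 *: P + (e0 *: S + b *: ('X * S)).
Proof.
set A := _ * _ * _; pose r1 := A - b *: ('X * S).
have sS : (size S <= m.+1)%N := size_revp m _.
have s1 : (size r1 <= m.+2)%N.
  apply/leq_sizeP => j jm; rewrite /r1 coefB coefZ coefXM coef_pearson /=.
  have Sj i : (m < i)%N -> S`_i = 0 by move=> mi; rewrite nth_default // (leq_trans sS).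
  case: j jm => [//|j] jm /=.
  by rewrite (Sj j) ?(Sj j.+1) ?mulr0 ?subr0 // ltnW.
have := size_sub_lead Phi_monic size_Phi s1; set r := r1 - _ => sr.
have H : r = r.[0] *: S.
  apply: (ip_revp_Phi_char w_int Phi_monic size_Phi kappa_gt0 ip_Phi) => //.
  apply: ip_mulX_eq0 => k km.
  rewrite /r /r1 !ipBl // !ipZl // (ip_parts lambda_gt w_int).
  rewrite exprS ipXX // -exprS ip_P_X // !ip_S_X ?(ltnW km) // -/b.
  by case: k {km} => [|k] /=; ring.
by exists r1`_m.+1, r.[0]; rewrite -H /r /r1 /P; ring.
Qed.

Definition GP := CT (laurent P m.+1).
Definition GS := CT (laurent S m.+1).

(** Up to the scaling of the entries, this is [det Y_n = 1]. Dividing [P] and [S] by [t - z] with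
    quotients [Q] and [T] gives [P(z) S(t) - S(z) P(t) = (t - z) (T P - Q S)], so the kernel
    cancels. [T P] integrates to 0 by orthogonality, and [Q S] sees only the leading coefficient 1
    of [Q]. *)
Lemma wronskian z : nrm z <> 1 ->
  P.[z] * GS z - S.[z] * GP z = - ofR (kappa m ^- 2).
Proof.
move=> z1.
have quo p : exists q, p = q * ('X - z%:P) + p.[z]%:P.
  have : root (p - p.[z]%:P) z by rewrite /root !hornerE subrr.
  by move/factor_theorem => [q E]; exists q; rewrite -E subrK.
have [Q QE] := quo P; have [T TE] := quo S.
have sz p q : p = q * ('X - z%:P) + p.[z]%:P -> (size p <= m.+2)%N -> (size q <= m.+1)%N.
  move=> E sp; have [->|q0] := eqVneq q 0; first by rewrite size_poly0.
  have : (size (p - p.[z]%:P)%R <= m.+2)%N.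
    by rewrite (leq_trans (size_polyD _ _)) // geq_max sp size_polyN (leq_trans (size_polyC_leq1 _)).
  rewrite {1}E addrK size_Mmonic ?monicXsubC // size_XsubC addn2 /=.
  by [].
have sQ := sz _ _ QE; rewrite size_Phi in sQ; move/(_ (leqnn _)): sQ => sQ.
have sT := sz _ _ TE (leqW (size_revp m _)).
have Qm : Q`_m = 1.
  have := Phi_lead Phi_monic size_Phi m.+1; rewrite -/P {1}QE coefD coefC addr0.
  rewrite mulrBr coefB coefMX coefMC /= (nth_default _ sQ) mul0r subr0 //.
have oP := on_circle_cauchy1 z1 (on_circle_laurent P m.+1).
have oS := on_circle_cauchy1 z1 (on_circle_laurent S m.+1).
have oP' := on_circleM (on_circle_cst S.[z]) oP.
have oS' := on_circleM (on_circle_cst P.[z]) oS.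
rewrite /GP /GS /cauchy_tr -(circ_funZ w_int _ oP) -(circ_funZ w_int _ oS).
rewrite -(circ_funB w_int oS' oP').
transitivity (ip P (revp m T) - ip S (revp m Q)).
  rewrite -(circ_funB w_int (on_circle_ip _ _) (on_circle_ip _ _)).
  apply: eq_circ_fun => t t1; rewrite (horner_revp_circle sT t1) (horner_revp_circle sQ t1).
  rewrite !rmorphM /= !conjCK rmorphXn /= (circle_conj t1) exprVn /laurent exprS.
  have t0 := circle_neq0 t1; have tz := circle_sub_neq0 z1 t1.
  have Pt : P.[t] = Q.[t] * (t - z) + P.[z] by rewrite {1}QE !hornerE.
  have St : S.[t] = T.[t] * (t - z) + S.[z] by rewrite {1}TE !hornerE.
  have tm : t ^+ m != 0 by rewrite expf_neq0.
  rewrite Pt St; move: (t ^+ m) tm => u u0.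
  by field; rewrite u0 t0 tz.
rewrite (ip_Phi_lower w_int Phi_monic size_Phi ip_Phi (size_revp m T)) sub0r.
rewrite /S (ip_revp_Phi w_int Phi_monic size_Phi ip_Phi (size_revp m Q)).
by rewrite coef0_revp Qm conjCK mul1r.
Qed.

Variables c0 c2 d0 e0 : C.
Hypothesis HP : 'X * (1 - 'X) * P^`() = c0 *: P - m.+1%:R *: ('X * P) + c2 *: S.
Hypothesis HS : 'X * (1 - 'X) * S^`() = d0 *: P + (e0 *: S + b *: ('X * S)).

Lemma ode_P z : z * (1 - z) * P^`().[z] = (c0 - m.+1%:R * z) * P.[z] + c2 * S.[z].
Proof.
have := congr1 (fun p => p.[z]) HP; rewrite !(hornerD, hornerN, hornerZ, hornerM, hornerX, hornerC) => ->; ring.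
Qed.

Lemma ode_S z : z * (1 - z) * S^`().[z] = d0 * P.[z] + (e0 + b * z) * S.[z].
Proof.
have := congr1 (fun p => p.[z]) HS; rewrite !(hornerD, hornerN, hornerZ, hornerM, hornerX, hornerC) => ->; ring.
Qed.

Lemma ode_GP z : nrm z <> 1 -> exists2 d, is_derive z 1 GP d &
  z * (1 - z) * d = (c0 - m.+1%:R - b^* - b * z) * GP z + c2 * GS z.
Proof.
move=> z1; have oP := on_circle_laurent P m.+1; have oS := on_circle_laurent S m.+1.
have := is_derive_cauchy_tr c_gt0 w_int z1 oP; set d := L _ => Hd.
exists d => //.
have Hf t (t1 : nrm t = 1) := is_derive_laurent P m.+1 (circle_neq0 t1).
rewrite /d (cauchy_tr_ode lambda_gt w_int z1 Hf (on_circle_laurent' P m.+1)) -/b.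
have oXP := on_circleM (@on_circle_id R) oP.
have o1 := on_circleM (on_circle_cst (c0 - m.+1%:R - b^* + z)) oP.
have o2 := on_circleM (on_circle_cst c2) oS.
have o3 := on_circleM (on_circle_cst (- (1 + b))) oXP.
(* The power [t^(-n)] contributes [- n (1 - t)] and the weight [- b^* - (1 + b) t + z]. The terms
   with a factor [t] then become [z] times the transform, up to the moment of [P] against [z^m],
   which vanishes. *)
transitivity (CT (fun t => (c0 - m.+1%:R - b^* + z) * laurent P m.+1 t +
   (c2 * laurent S m.+1 t + (- (1 + b)) * (t * laurent P m.+1 t))) z).
  apply: eq_circ_fun => t t1; congr (t * _ / _).
  have t0 := circle_neq0 t1; have tm : t ^+ m != 0 by rewrite expf_neq0.
  have E := ode_P t; rewrite /laurent' /laurent !exprS.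
  transitivity ((t * (1 - t) * P^`().[t]) / (t * t ^+ m)
    - (m.+1%:R * (1 - t) + (b^* + (1 + b) * t) - z) * (P.[t] / (t * t ^+ m))).
    by move: (t ^+ m) tm => u u0; field; rewrite u0 t0.
  by rewrite E; move: (t ^+ m) tm => u u0; field; rewrite u0 t0.
rewrite (cauchy_trD w_int z1 o1 (on_circleD o2 o3)) (cauchy_trD w_int z1 o2 o3).
rewrite (cauchy_trZ w_int _ z1 oP) (cauchy_trZ w_int _ z1 oS) (cauchy_trZ w_int _ z1 oXP).
rewrite (cauchy_tr_mulX w_int z1 oP) -/GP -/GS.
have -> : L (fun t => t * laurent P m.+1 t) = 0.
  rewrite -(ip_P_X (leqnn m)); apply: eq_circ_fun => t t1.
  rewrite hornerXn rmorphXn /= (circle_conj t1) /laurent exprS exprVn.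
  have t0 := circle_neq0 t1; have tm : t ^+ m != 0 by rewrite expf_neq0.
  by field; rewrite tm t0.
by rewrite /GP /GS; ring.
Qed.

Lemma ode_GS z : nrm z <> 1 -> exists2 d, is_derive z 1 GS d &
  z * (1 - z) * d = d0 * GP z + (e0 - m.+1%:R - b^* + m.+1%:R * z) * GS z.
Proof.
move=> z1; have oP := on_circle_laurent P m.+1; have oS := on_circle_laurent S m.+1.
have := is_derive_cauchy_tr c_gt0 w_int z1 oS; set d := L _ => Hd.
exists d => //.
have Hf t (t1 : nrm t = 1) := is_derive_laurent S m.+1 (circle_neq0 t1).
rewrite /d (cauchy_tr_ode lambda_gt w_int z1 Hf (on_circle_laurent' S m.+1)) -/b.
have oXS := on_circleM (@on_circle_id R) oS.
have o1 := on_circleM (on_circle_cst (e0 - m.+1%:R - b^* + z)) oS.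
have o2 := on_circleM (on_circle_cst d0) oP.
have o3 := on_circleM (on_circle_cst m%:R) oXS.
transitivity (CT (fun t => (e0 - m.+1%:R - b^* + z) * laurent S m.+1 t +
   (d0 * laurent P m.+1 t + m%:R * (t * laurent S m.+1 t))) z).
  apply: eq_circ_fun => t t1; congr (t * _ / _).
  have t0 := circle_neq0 t1; have tm : t ^+ m != 0 by rewrite expf_neq0.
  have E := ode_S t; rewrite /laurent' /laurent !exprS -natr1.
  transitivity ((t * (1 - t) * S^`().[t]) / (t * t ^+ m)
    - ((m%:R + 1) * (1 - t) + (b^* + (1 + b) * t) - z) * (S.[t] / (t * t ^+ m))).
    by move: (t ^+ m) tm => u u0; field; rewrite u0 t0.
  by rewrite E; move: (t ^+ m) tm => u u0; field; rewrite u0 t0.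
rewrite (cauchy_trD w_int z1 o1 (on_circleD o2 o3)) (cauchy_trD w_int z1 o2 o3).
rewrite (cauchy_trZ w_int _ z1 oP) (cauchy_trZ w_int _ z1 oS) (cauchy_trZ w_int _ z1 oXS).
rewrite (cauchy_tr_mulX w_int z1 oS).
(* For [m > 0] this moment vanishes by orthogonality; for [m = 0] it is the nonzero pairing with 1,
   but its coefficient is 0. *)
have E : m%:R * L (fun t => t * laurent S m.+1 t) = 0.
  have -> : L (fun t => t * laurent S m.+1 t) = ip S 'X^m.
    apply: eq_circ_fun => t t1.
    rewrite hornerXn rmorphXn /= (circle_conj t1) /laurent exprS exprVn.
    have t0 := circle_neq0 t1; have tm : t ^+ m != 0 by rewrite expf_neq0.
    by field; rewrite tm t0.
  by rewrite ip_S_X //; case: (m) => [|k]; rewrite /= ?mul0r ?mulr0.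
rewrite mulrDr E addr0 -/GP -/GS -natr1 /GP /GS; ring.
Qed.

End RiemannHilbert.

(** * Branches of the logarithm *)

Section Logarithms.
Variable R : realType.
Local Notation C := (Cx R).
Local Notation Re := (@complex.Re R).
Local Notation Im := (@complex.Im R).

Definition log1 (z : C) : C := cpt (ln (nrm z)) (atan (Im z / Re z)).

Lemma cexp_log1 (z : C) : 0 < Re z -> cexp (log1 z) = z.
Proof.
move=> x0; have z0 : 0 < nrm z.
  by rewrite nrm_gt0; apply/eqP => E; rewrite E ltxx in x0.
set u := Im z / Re z.
have sq : nrm z = Re z * Num.sqrt (1 + u ^+ 2).
  rewrite nrmE -{2}(ger0_norm (ltW x0)) -sqrtr_sqr -sqrtrM ?sqr_ge0 //.
  by congr Num.sqrt; rewrite /u; field; rewrite gt_eqF.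
have s0 : Num.sqrt (1 + u ^+ 2) != 0.
  by rewrite gt_eqF // sqrtr_gt0 ltr_pwDl // sqr_ge0.
have ca : cos (atan u) = (Num.sqrt (1 + u ^+ 2))^-1 := cos_atan u.
have c0 : cos (atan u) != 0 by rewrite ca invr_eq0.
have sa : sin (atan u) = u * (Num.sqrt (1 + u ^+ 2))^-1.
  have E : sin (atan u) / cos (atan u) = u by exact: atanK.
  by rewrite -ca -[X in X * _]E divfK.
rewrite /log1 cexpE Re_cpt Im_cpt lnK // -/u; apply: Cx_eqP; rewrite !ReIm ca sa sq mul0r ?subr0 ?addr0.
  by rewrite mulfK.
by rewrite mulrACA mulfV // mulr1 /u mulrC divfK // gt_eqF.
Qed.

Lemma continuous_log1 (z : C) : 0 < Re z -> {for z, continuous log1}.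
Proof.
move=> x0; have z0 : 0 < nrm z.
  by rewrite nrm_gt0; apply/eqP => E; rewrite E ltxx in x0.
have cn : @nrm R @ z --> nrm z.
  apply/(@cvgrPdist_lt R R C (nbhs z) (nbhs_filter z)) => e e0.
  apply/Cnear_epsP; exists e => // y; apply: le_lt_trans.
  have n1 := nrmD (z - y) y; have n2 := nrmD (y - z) z.
  rewrite subrK (nrmB z y) in n1; rewrite subrK in n2.
  by rewrite ler_norml; apply/andP; split; lra.
have cq : (fun w : C => Im w / Re w) @ z --> Im z / Re z.
  have x1 : Re z != 0 by rewrite gt_eqF.
  exact: (cvgM (@continuous_Im R z) (cvgV x1 (@continuous_Re R z))).
have c1 := cvg_comp _ _ cn (continuous_ln z0).
have c2 := cvg_comp _ _ cq (@continuous_atan R _).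
exact: (cvg_cpt c1 c2).
Qed.

(* Inverse function rule: [l] is a continuous local inverse of [cexp]. *)
Lemma is_derive_log1 (z : C) : 0 < Re z -> is_derive z 1 log1 z^-1.
Proof.
move=> x0; have z0 : 0 < nrm z.
  by rewrite nrm_gt0; apply/eqP => E; rewrite E ltxx in x0.
have zn : z != 0 by rewrite -nrm_gt0.
apply/Cderive_epsP => e e0.
(* The bound [1 / 2] first gives [nrm k <= 2 * nrm h / nrm z] for the increment [k] of the
   logarithm; the last condition then turns the error [e' * nrm k] into [e * nrm h]. *)
have [e' [e'0 e'1 e'2]] : exists e', [/\ 0 < e', e' <= 1 / 2 & e' * (2 * (nrm z)^-1) <= e].
  exists (Num.min (1 / 2) (e / (2 * (nrm z)^-1))).
  have p0 : 0 < 2 * (nrm z)^-1 by rewrite mulr_gt0 // invr_gt0.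
  split; first by rewrite lt_min !divr_gt0.
    by rewrite ge_min lexx.
  by rewrite -ler_pdivlMr // ge_min lexx orbT.
have [r r0 Hr] := (Cderive_epsP _ _ _).1 (is_derive_cexp0 R) _ e'0.
have r20 : 0 < r / 2 by rewrite divr_gt0.
have [s s0 Hs] := (Ccontinuous_epsP _ _).1 (continuous_log1 x0) _ r20.
exists (Num.min s (Re z)); first by rewrite lt_min s0.
move=> h; rewrite lt_min => /andP[hs hx].
have xh : 0 < Re (z + h).
  have := le_lt_trans (Re_le_nrm h) hx; rewrite ltr_norml Re_D => /andP[? _]; lra.
set k := log1 (z + h) - log1 z.
have kr : nrm k < r.
  have : nrm k <= r / 2 by apply: Hs; rewrite addrAC subrr add0r.
  by lra.
have := Hr k kr; rewrite add0r cexp0 mul1r => K.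
have kE : cexp k - 1 = z^-1 * h.
  rewrite /k cexpD cexpN !cexp_log1 //; by field.
rewrite kE in K.
have kn : nrm k <= 2 * ((nrm z)^-1 * nrm h).
  have := nrmD (k - z^-1 * h) (z^-1 * h); rewrite subrK (nrmB k) nrmM nrmV => N.
  have : e' * nrm k <= 1 / 2 * nrm k by rewrite ler_wpM2r ?nrm_ge0.
  by lra.
rewrite (nrmB k); apply: le_trans K _; apply: (@le_trans _ _ (e' * (2 * ((nrm z)^-1 * nrm h)))).
  by rewrite ler_pM2l.
by rewrite (mulrA 2) (mulrA e') ler_wpM2r ?nrm_ge0.
Qed.

Lemma cexp_surj (z : C) : z != 0 -> exists k, cexp k = z.
Proof.
move=> z0; have [t _ E] := polar z; exists (cpt (ln (nrm z)) t).
by rewrite cexpE Re_cpt Im_cpt lnK ?posrE ?nrm_gt0.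
Qed.

(** Near [z] the quotient [f w / f z] stays in the right half-plane, where [log1] is the logarithm;
    a constant with exponential [f z] corrects the value. *)
Lemma log_branch_exists (f : C -> C) z : entire f -> f z != 0 ->
  exists l, log_branch f l z.
Proof.
move=> ef fz; have [k kE] := cexp_surj fz.
exists (fun w => log1 (f w / f z) + k).
have cf := @entire_continuous R f ef z.
have [r r0 Hr] := (Ccontinuous_epsP _ _).1 cf (nrm (f z) / 2) (divr_gt0 (etrans (nrm_gt0 _) fz) (ltr0n _ 2)).
rewrite /log_branch; apply: (iffRL (Cnear_epsP _ _)); exists r; first exact: r0.
move=> w /Hr H.
have fz0 : 0 < nrm (f z) by rewrite nrm_gt0.
have p : 0 < Re (f w / f z).
  have : nrm ((f w - f z) / f z) <= 1 / 2.
    by rewrite nrmM nrmV ler_pdivrMr // mulrAC mul1r.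
  move/(le_trans (Re_le_nrm _)); rewrite mulrBl divff // Re_D Re_N Re_1 ler_norml => /andP[? _].
  by lra.
split; last by rewrite cexpD cexp_log1 // kE divfK.
have H1 := is_derive_mul (derivableP (ef w)) (is_derive_const (f z)^-1 w).
have H2 := is_derive_comp H1 (is_derive_log1 p).
by have [] := is_derive_add H2 (is_derive_const k w).
Qed.

Lemma is_derive_unique (f : C -> C) (z d1 d2 : C) :
  is_derive z 1 f d1 -> is_derive z 1 f d2 -> d1 = d2.
Proof. by move=> [_ <-] [_ <-]. Qed.

(** Every branch has the same derivative, which is why the structure matrix does not depend on the
    branches. *)
Lemma log_branch_derive (f l : C -> C) (z df : C) : log_branch f l z ->
  is_derive z 1 f df -> is_derive z 1 l (df / f z).
Proof.
move=> H Hf; have [dl lz] := nbhs_singleton H.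
have Hl := derivableP dl; have Hc := is_derive_comp Hl (is_derive_cexp (l z)).
have N : \forall w \near z, (@cexp R \o l) w = f w by apply: filterS H => w [].
have E := is_derive_unique (near_eq_is_derive N Hc) Hf.
rewrite lz in E; apply: is_derive_eq Hl _.
by rewrite -E mulrAC divff ?mul1r // -lz cexp_neq0.
Qed.

End Logarithms.

(** * Two by two matrices and their derivatives *)

Section Mx2.
Variable K : numFieldType.
Local Notation V := 'M[K]_2.

Lemma mx2_mul (a b c d a' b' c' d' : K) :
  mx2 a b c d *m mx2 a' b' c' d' =
  mx2 (a * a' + b * c') (a * b' + b * d') (c * a' + d * c') (c * b' + d * d').
Proof.
apply/matrixP => i j; rewrite !mxE !big_ord_recl big_ord0 addr0 !mxE /=.
by case: i => -[|[|]] //= ?; case: j => -[|[|]].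
Qed.

Lemma mx2_det (a b c d : K) : \det (mx2 a b c d) = a * d - b * c.
Proof.
rewrite (expand_det_row _ ord0) !big_ord_recl big_ord0 addr0 /cofactor !det_mx11 !mxE /=.
by rewrite expr0 expr1 mul1r mulN1r mulrN.
Qed.

Lemma mx2D (a b c d a' b' c' d' : K) :
  mx2 a b c d + mx2 a' b' c' d' = mx2 (a + a') (b + b') (c + c') (d + d').
Proof. by apply/matrixP => i j; rewrite !mxE; case: ifP => _; case: ifP. Qed.

Lemma mx2Z (x a b c d : K) : x *: mx2 a b c d = mx2 (x * a) (x * b) (x * c) (x * d).
Proof. by apply/matrixP => i j; rewrite !mxE; case: ifP => _; case: ifP. Qed.

Lemma mx2_inj (a b c d a' b' c' d' : K) : mx2 a b c d = mx2 a' b' c' d' ->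
  [/\ a = a', b = b', c = c' & d = d'].
Proof.
move=> /matrixP E; have := E ord0 ord0; have := E ord0 (lift ord0 ord0).
have := E (lift ord0 ord0) ord0; have := E (lift ord0 ord0) (lift ord0 ord0).
by rewrite !mxE.
Qed.

Lemma is_derive_scalel (f : K -> K) (x d : K) (A : V) : is_derive x 1 f d ->
  is_derive x 1 (fun t => f t *: A) (d *: A).
Proof.
move=> [df dE].
have cv : (fun h => h^-1 *: (((fun t => f t *: A) \o shift x) (h *: 1) - f x *: A)) @ 0^' --> d *: A.
  have -> : (fun h => h^-1 *: (((fun t => f t *: A) \o shift x) (h *: 1) - f x *: A)) =
     (fun h => (h^-1 *: ((f \o shift x) (h *: 1) - f x)) *: A).
    by apply/funext => h /=; rewrite -scalerBl scalerA.
  by apply: cvgZr_tmp; rewrite -dE; exact: df.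
by split; [apply/cvg_ex; exists (d *: A) | exact: cvg_lim cv].
Qed.

Lemma is_derive_addmx (f g : K -> V) (x : K) (df dg : V) :
  is_derive x 1 f df -> is_derive x 1 g dg -> is_derive x 1 (fun t => f t + g t) (df + dg).
Proof. by move=> Hf Hg; exact: is_deriveD. Qed.

Lemma mx2E (a b c d : K) :
  mx2 a b c d = a *: mx2 1 0 0 0 + b *: mx2 0 1 0 0 + (c *: mx2 0 0 1 0 + d *: mx2 0 0 0 1).
Proof. by rewrite !mx2Z !mx2D !(mulr0, mulr1, addr0, add0r). Qed.

Lemma is_derive_mx2 (a b c d : K -> K) (x a' b' c' d' : K) :
  is_derive x 1 a a' -> is_derive x 1 b b' -> is_derive x 1 c c' -> is_derive x 1 d d' ->
  is_derive x 1 (fun t => mx2 (a t) (b t) (c t) (d t)) (mx2 a' b' c' d').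
Proof.
move=> Ha Hb Hc Hd; under eq_fun do rewrite mx2E; rewrite mx2E.
by do 2 apply: is_derive_addmx; exact: is_derive_scalel.
Qed.

Lemma is_derive_continuous_mx (f : K -> V) (x : K) df :
  is_derive x 1 f df -> f t @[t --> x] --> f x.
Proof. by move=> [fx _]; exact/differentiable_continuous/derivable1_diffP. Qed.

End Mx2.

(** * Reduction to a constant [H] and an integrable weight *)

Section Reduction.
Variable R : realType.
Local Notation C := (Cx R).
Local Notation Re := (@complex.Re R).
Local Notation Im := (@complex.Im R).
Local Notation mu := (@lebesgue_measure R).
Variables (lambda eta : R) (H : C -> C).
Let b : C := ofR lambda + 'i * ofR eta.
Let nu := weight b H.
Hypothesis entire_H : entire H.
Hypothesis nu_pos : forall z : C, `|z| = 1 -> z <> 1 -> 0 < nu z.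

(* [H] is real on the circle, which forces it to be constant. *)
Lemma symbol_constant : exists2 c, 0 < c & forall z, H z = ofR c.
Proof.
have pos t : t \in `]0%R, (2 * pi)%R[ -> 0 < H (unit_pt t).
  move=> tD; have := @nu_pos (unit_pt t); rewrite normE nrm_unit_pt /nu weight_unit_pt //.
  rewrite pmulr_rgt0; last by rewrite -ofR0 ltr_ofR expR_gt0.
  apply => // E; have := one_sub_unit_pt t; rewrite E subrr => /(congr1 (@nrm R)).
  rewrite nrm0 nrmM nrm_unit_pt mulr1 nrm_ofR => /esym/eqP.
  by rewrite normr_eq0 gt_eqF // chord_gt0.
have im t : t \in `]0%R, (2 * pi)%R[ -> Im (H (unit_pt t)) = 0.
  by move=> /pos; rewrite ltcE /= => /andP[/eqP].
have cH := entire_continuous entire_H.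
(* Positivity of the weight says nothing at the point 1; there the value follows by continuity along
   the circle. *)
have im1 : Im (H 1) = 0.
  apply/eqP; rewrite -normr_le0; apply/ler_addgt0Pl => e e0; rewrite addr0.
  have [c1 c2] : ccont (fun t => H (unit_pt t)).
    by apply: ccont_comp; [exact: ccont_unit_pt | move=> t; exact: cH].
  have /continuous_epsP/(_ _ e0)[r r0 Hr] := c2 0.
  pose s := Num.min (r / 2) 1.
  have s0 : 0 < s by rewrite lt_min ltr01 divr_gt0.
  have sr : s < r.
    by rewrite (@le_lt_trans _ _ (r / 2)) ?ge_min ?lexx // ltr_pdivrMr // ltr_pMr // ltr1n.
  have s1 : s <= 1 by rewrite ge_min lexx orbT.
  have := Hr s; rewrite subr0 gtr0_norm // => /(_ sr).
  have sD : s \in `]0%R, (2 * pi)%R[.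
    by rewrite in_itv /= s0 /=; have := pi_ge2 R; lra.
  by rewrite (im _ sD) sub0r normrN unit_pt0.
have imT t : Im (H (unit_pt t)) = 0.
  have [s sb ->] := nrm1_unit_pt (nrm_unit_pt t).
  move: sb; rewrite le_eqVlt => /andP[/predU1P[<-|s0]]; first by rewrite unit_pt0.
  rewrite le_eqVlt => /predU1P[->|s1]; first by rewrite unit_pt2pi.
  by apply: im; rewrite in_itv /= s0.
(* The sign of the constant is then read off at angle [pi], that is, at the point -1. *)
have HE := entire_real_on_circle_const entire_H imT.
have piD : (pi : R) \in `]0%R, (2 * pi)%R[.
  by rewrite in_itv /= pi_gt0 ltr_pMl ?pi_gt0 // ltr1n.
have p := pos _ piD; rewrite HE in p.
by have [c c0 cE] := pos_ofR p; exists c => // z; rewrite HE cE.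
Qed.

Variable c : R.
Hypothesis c_gt0 : 0 < c.
Hypothesis HE : forall z, H z = ofR c.
Let w (t : R) : R := c * circ_weight lambda eta t.

Lemma nu_unit_pt t : t \in `]0%R, (2 * pi)%R[ -> nu (unit_pt t) = ofR (w t).
Proof. by move=> tD; rewrite /nu weight_unit_pt // HE -ofRM mulrC. Qed.

Lemma circle_intE (f : C -> C) :
  circle_int (fun z => f z * nu z) = circ_fun lambda eta c (fun z => 'i * (z * f z)).
Proof.
rewrite /circle_int /circ_fun /wint; congr (Complex _ _); apply: eq_Rintegral => t;
  rewrite mem_setE => /nu_unit_pt ->; rewrite -/(w t).
  rewrite (_ : f (unit_pt t) * ofR (w t) * ('i * unit_pt t) = 'i * (unit_pt t * f (unit_pt t)) * ofR (w t)).
    by rewrite [LHS]Re_M Re_ofR Im_ofR mulr0 subr0.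
  by ring.
rewrite (_ : f (unit_pt t) * ofR (w t) * ('i * unit_pt t) = 'i * (unit_pt t * f (unit_pt t)) * ofR (w t)).
  by rewrite [LHS]Im_M Re_ofR Im_ofR mulr0 add0r.
by ring.
Qed.

Lemma mu_intE (f : C -> C) : mu_int nu f = circ_fun lambda eta c f.
Proof.
rewrite /mu_int (_ : (fun z => _) = (fun z => (f z / ('i * z)) * nu z)); last first.
  by apply/funext => z; rewrite mulrA mulrAC.
rewrite circle_intE; apply: eq_circ_fun => z z1.
by field; rewrite Ci_neq0 circle_neq0.
Qed.

(* [fine] turns an infinite integral into 0, so a nonzero total mass gives
   integrability. *)
Lemma weight_integrable : mu_int nu (fun=> 1) <> 0 ->
  mu.-integrable `]0%R, (2 * pi)%R[ (EFin \o w).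
Proof.
move=> H0.
have mw : measurable_fun `]0%R, (2 * pi)%R[ w.
  apply: open_continuous_measurable_fun; first exact: interval_open.
  move=> t /set_mem tD; apply: cvgM; first exact: cvg_cst.
  exact: is_derive_continuous (is_derive_circ_weight lambda eta tD).
apply/integrableP; split; first exact/measurable_EFinP.
rewrite ltey; apply/eqP => E; apply: H0.
rewrite mu_intE /circ_fun /wint.
have E1 : \int[mu]_(t in `]0%R, (2 * pi)%R[) (Re (1 : C) * w t) = 0.
  rewrite /Rintegral (_ : (\int[mu]_(t in `]0%R, (2 * pi)%R[) (Re (1 : C) * w t)%:E = +oo)%E) //.
  rewrite -E; apply: eq_integral => t _ /=.
  by rewrite mul1r ger0_norm // mulr_ge0 ?expR_ge0 // ltW.
have E2 : \int[mu]_(t in `]0%R, (2 * pi)%R[) (Im (1 : C) * w t) = 0.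
  rewrite (_ : \int[mu]_(t in `]0%R, (2 * pi)%R[) (Im (1 : C) * w t) =
     \int[mu]_(t in `]0%R, (2 * pi)%R[) 0).
    by rewrite Rintegral_cst ?mul0r.
  by apply: eq_Rintegral => t _; rewrite Im_1 mul0r.
by rewrite E1 E2.
Qed.

End Reduction.

(** * The structure matrix *)

Section StructureMatrix.
Variable R : realType.
Local Notation C := (Cx R).
Local Notation mu := (@lebesgue_measure R).
Variables (lambda eta c : R) (H : C -> C).
Let b : C := ofR lambda + 'i * ofR eta.
Let nu := weight b H.
Hypothesis lambda_gt : - (1 / 2) < lambda.
Hypothesis c_gt0 : 0 < c.
Hypothesis HE : forall z, H z = ofR c.
Hypothesis w_int : mu.-integrable `]0%R, (2 * pi)%R[
  (EFin \o (fun t => c * circ_weight lambda eta t)).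
Variables (Phi : nat -> {poly C}) (kappa : nat -> R).
Hypothesis Phi_monic : forall n, Phi n \is monic.
Hypothesis size_Phi : forall n, size (Phi n) = n.+1.
Hypothesis kappa_gt0 : forall n, 0 < kappa n.
Hypothesis ip_Phi : forall n m,
  ip lambda eta c (Phi n) (Phi m) = ofR (kappa n ^- 2) *+ (n == m).
Variable m : nat.
Let P := Phi m.+1.
Let S := revp m (Phi m).
Let G := GP lambda eta c Phi m.
Let Gs := GS lambda eta c Phi m.
Let beta := bcoef kappa m.
Let a : C := (2 * ofR pi)^-1.

Let pi_neq0 : ofR pi != 0 :> C.
Proof. by rewrite -nrm_gt0 nrm_ofR normr_gt0 gt_eqF // pi_gt0. Qed.

Let beta_neq0 : beta != 0.
Proof.
by rewrite -nrm_gt0 /beta /bcoef nrm_ofR normr_gt0 !mulf_neq0 // ?gt_eqF ?pi_gt0.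
Qed.

(** The closed form of [Y_n] is valid off the circle and off 0, where [reversed] is not the reversed
    polynomial; differentiating it needs a whole neighbourhood of such points. *)
Lemma off_circle_near (z : C) : nrm z <> 1 -> z != 0 ->
  \forall w \near z, nrm w <> 1 /\ w != 0.
Proof.
move=> z1 z0; apply: (iffRL (Cnear_epsP _ _)).
have d0 : 0 < `|1 - nrm z| by rewrite normr_gt0 subr_eq0 eq_sym; exact/eqP.
have n0 : 0 < nrm z by rewrite nrm_gt0.
exists (Num.min `|1 - nrm z| (nrm z)); first by rewrite lt_min d0.
move=> w; rewrite lt_min => /andP[w1 w0]; split.
  move=> W; move: w1; rewrite ltNge => /negP; apply.
  have n1 := nrmD (w - z) z; have n2 := nrmD (z - w) w.
  rewrite subrK W in n1; rewrite subrK W (nrmB z) in n2.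
  by rewrite ler_norml; apply/andP; split; lra.
by apply/eqP => W; move: w0; rewrite W sub0r nrmN ltxx.
Qed.

Let cauchy_kernelE (f : C -> C) (p : {poly C}) (z : C) : nrm z <> 1 ->
  (forall t, nrm t = 1 -> f t = p.[t]) ->
  (2 * ofR pi * 'i)^-1 * circle_int (fun t => f t / (t - z) * (nu t / t ^+ m.+1)) =
  a * cauchy_tr lambda eta c (laurent p m.+1) z.
Proof.
move=> z1 fp.
rewrite (_ : (fun t => _) = (fun t => (f t / (t - z) / t ^+ m.+1) * nu t)); last first.
  by apply/funext => t; rewrite mulrA mulrAC.
rewrite (circle_intE lambda eta HE).
have o := on_circle_cauchy1 z1 (on_circle_laurent p m.+1).
rewrite (@eq_circ_fun _ _ _ _ _ (fun t => 'i * (t * laurent p m.+1 t / (t - z)))); last first.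
  move=> t t1; rewrite fp // /laurent; congr ('i * _).
  by rewrite -!mulrA; congr (t * (p.[t] * _)); rewrite mulrC.
rewrite (circ_funZ w_int 'i o) /cauchy_tr mulrA; congr (_ * _).
by rewrite /a invfM mulfVK // Ci_neq0.
Qed.

Lemma YmxE (z : C) : nrm z <> 1 -> z != 0 ->
  Ymx nu Phi kappa m.+1 z =
  mx2 P.[z] (a * G z) (- beta * S.[z]) (- beta * (a * Gs z)).
Proof.
move=> z1 z0; rewrite /Ymx /=; congr mx2.
- exact: cauchy_kernelE.
- by rewrite reversedE ?size_Phi.
congr (_ * _); apply: cauchy_kernelE => // t t1.
by rewrite reversedE ?size_Phi ?circle_neq0.
Qed.

Lemma Cmx_branch_exists (z : C) : nrm z <> 1 -> z != 0 ->
  exists D, Cmx_branch b H m.+1 z D.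
Proof.
move=> z1 z0.
have eid : entire (@id C) by move=> w; have [] := is_derive_id w (1 : C).
have eopp : entire (fun w : C => - w).
  by move=> w; have [] := is_derive_opp (is_derive_id w (1 : C)).
have eone : entire (fun w : C => 1 - w).
  by move=> w; have [] := is_derive_sub (is_derive_const (1 : C) w) (is_derive_id w (1 : C)).
have [l Hl] := log_branch_exists eid z0.
have mz0 : - z != 0 by rewrite oppr_eq0.
have [lm Hm] := log_branch_exists eopp mz0.
have oz0 : 1 - z != 0.
  by rewrite subr_eq0; apply/eqP => E; apply: z1; rewrite -E nrm1.
have [l1 H1] := log_branch_exists eone oz0.
(* Since [H] is the constant [c], the sum of the chosen logarithms and [ln c] is a branch of the
   logarithm of the weight. *)
pose lnu w : C := - b^* * lm w + (b + b^*) * l1 w + ofR (ln c).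
exists (fun w => mx2 (cexp (- (m.+1%:R / 2) * l w) * cexp (2^-1 * lnu w)) 0
                 0 (cexp (m.+1%:R / 2 * l w) * cexp (- 2^-1 * lnu w))).
exists l, lm, l1, lnu; split; [exact: Hl | exact: Hm | exact: H1 | | by apply: (iffRL (Cnear_epsP _ _)); exists 1].
rewrite /log_branch; move: Hm H1; rewrite /log_branch; apply: filterS2 => w [dm _] [d1 _].
split.
  have := is_derive_add (is_derive_add
    (is_derive_mul (is_derive_const (- b^*) w) (derivableP dm))
    (is_derive_mul (is_derive_const (b + b^*) w) (derivableP d1)))
    (is_derive_const (ofR (ln c)) w).
  by case.
by rewrite /lnu !cexpD HE (cexpE (ofR _)) Re_ofR Im_ofR unit_pt0 mulr1 lnK.
Qed.

Variables c0 c2 d0 e0 : C.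
Hypothesis HP : 'X * (1 - 'X) * P^`() = c0 *: P - m.+1%:R *: ('X * P) + c2 *: S.
Hypothesis HS : 'X * (1 - 'X) * S^`() = d0 *: P + (e0 *: S + b *: ('X * S)).

(** [- h0 + h1 * z] is [z * (1 - z)] times the logarithmic derivative of z^(-n/2) nu^(1/2), with
    [n = m.+1]. *)
Let h0 : C := (m.+1%:R + b^*) / 2.
Let h1 : C := (m.+1%:R - b) / 2.

(** The factor [- beta] in the second row of [Y_n] conjugates the system for [P] and [S]: it divides
    [c2] and multiplies [d0]. *)
Definition struct_N0 : 'M[C]_2 := mx2 (c0 - h0) (- c2 / beta) (- beta * d0) (e0 - h0).
Definition struct_N1 : 'M[C]_2 := mx2 (h1 - m.+1%:R) 0 0 (h1 + b).
Definition struct_M (z : C) : 'M[C]_2 :=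
  (z * (1 - z))^-1 *: struct_N0 + (1 - z)^-1 *: struct_N1.

Lemma struct_N0_neq0 : struct_N0 != 0.
Proof.
apply/eqP => N0; have Z : 0 = mx2 0 0 0 0 :> 'M[C]_2.
  by apply/matrixP => i j; rewrite !mxE; do 2 case: ifP.
rewrite Z in N0; have [_ _ bd eh] := mx2_inj N0.
have d00 : d0 = 0.
  by move/eqP: bd; rewrite mulf_eq0 oppr_eq0 (negbTE beta_neq0) => /eqP.
(* The reversed polynomial has value 1 at 0, because [Phi m] is monic; so the equation at 0 reads
   [e0 = 0], and then [h0 = 0], although its real part is positive. *)
have := ode_S HS 0; rewrite !mul0r d00 mul0r add0r mulr0 addr0 /S revp_Phi0 // mulr1.
move=> /esym E0; rewrite E0 sub0r in eh; move/eqP: eh; rewrite oppr_eq0 /h0 mulf_eq0.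
rewrite invr_eq0 (_ : (2 == 0 :> C) = false) ?orbF; last by rewrite pnatr_eq0.
move=> /eqP /(congr1 (@complex.Re R)); rewrite /b -[m.+1%:R]ofRn !ReIm.
rewrite mul0r mul1r subr0 addr0 => /eqP; rewrite gt_eqF //.
have m1 : 1 <= m.+1%:R :> R by rewrite ler1n.
by have := lambda_gt; lra.
Qed.

Lemma struct_M_near0 (z : C) : z != 0 ->
  z *: struct_M z = (1 - z)^-1 *: struct_N0 + (z / (1 - z)) *: struct_N1.
Proof. by move=> z0; rewrite /struct_M scalerDr !scalerA invfM mulrA divff // mul1r. Qed.

Lemma struct_M_near1 (z : C) : z != 1 ->
  (z - 1) *: struct_M z = - z^-1 *: struct_N0 + (-1) *: struct_N1.
Proof.
move=> z1; have z1' : 1 - z != 0 by rewrite subr_eq0 eq_sym.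
rewrite /struct_M scalerDr !scalerA invfM; congr (_ *: _ + _ *: _).
  by rewrite mulrCA -opprB mulNr divff // mulrN1.
by rewrite -opprB mulNr divff.
Qed.

Lemma derivable_struct_M (z : C) : z != 0 -> z != 1 -> derivable struct_M z 1.
Proof.
move=> z0 z1; have z1' : 1 - z != 0 by rewrite subr_eq0 eq_sym.
have D1 := is_derive_sub (is_derive_const (1 : C) z) (is_derive_id z (1 : C)).
have D2 := is_derive_mul (is_derive_id z (1 : C)) D1.
have H1 := is_derive_scalel struct_N0 (is_derive_inv (f := fun z => z * (1 - z)) (mulf_neq0 z0 z1') D2).
have H2 := is_derive_scalel struct_N1 (is_derive_inv (f := fun z => 1 - z) z1' D1).
by have [] := is_derive_addmx H1 H2.
Qed.

Lemma struct_simple_pole0 : simple_pole struct_M 0.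
Proof.
exists struct_N0; first exact: struct_N0_neq0.
pose g (z : C) := (1 - z)^-1 *: struct_N0 + (z / (1 - z)) *: struct_N1.
have o0 : 1 - 0 != 0 :> C by rewrite subr0 oner_neq0.
have D1 := is_derive_sub (is_derive_const (1 : C) 0) (is_derive_id (0 : C) (1 : C)).
have DV := is_derive_inv (f := fun z => 1 - z) o0 D1.
have gc := is_derive_continuous_mx (is_derive_addmx (is_derive_scalel struct_N0 DV)
  (is_derive_scalel struct_N1 (is_derive_mul (is_derive_id (0 : C) (1 : C)) DV))).
rewrite subr0 invr1 mul0r scale0r addr0 scale1r in gc.
apply: cvg_trans (cvg_within_filter _ gc); apply: near_eq_cvg.
near=> z; have z0 : z != 0 by near: z; exact: nbhs_dnbhs_neq.
by rewrite subr0 struct_M_near0.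
Unshelve. all: by end_near. Qed.

(** If [struct_N0 + struct_N1] vanishes, the two fractions combine to [z^-1 *: struct_N0], regular
    at 1; otherwise its opposite is the nonzero limit. *)
Lemma struct_pole1 : removable_singularity struct_M 1 \/ simple_pole struct_M 1.
Proof.
have n1 : (1 : C) != 0 by exact: oner_neq0.
have DV := is_derive_inv (f := id) n1 (is_derive_id (1 : C) (1 : C)).
have [N|N] := eqVneq (struct_N0 + struct_N1) 0.
  left; have N1 : struct_N1 = - struct_N0 by apply/eqP; rewrite -addr_eq0 addrC N.
  exists (fun z => z^-1 *: struct_N0); split.
    apply: (iffRL (Cnear_epsP _ _)); exists 1 => // y y1.
    have y0 : y != 0 by apply/eqP => E; move: y1; rewrite E sub0r nrmN nrm1 ltxx.
    by have [] := is_derive_scalel struct_N0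
      (is_derive_inv (f := id) y0 (is_derive_id y (1 : C))).
  near=> z; have z1 : z != 1 by near: z; exact: nbhs_dnbhs_neq.
  have z0 : z != 0.
    near: z; apply: nbhs_dnbhs; apply: (iffRL (Cnear_epsP _ _)); exists 1 => // y y1.
    by apply/eqP => E; move: y1; rewrite E sub0r nrmN nrm1 ltxx.
  have z1' : 1 - z != 0 by rewrite subr_eq0 eq_sym.
  rewrite /struct_M N1 scalerN -scalerBl; congr (_ *: _).
  by field; rewrite z0 z1'.
right; exists (- (struct_N0 + struct_N1)); first by rewrite oppr_eq0.
have gc := is_derive_continuous_mx (is_derive_addmx (is_derive_scalel struct_N0 (is_derive_opp DV))
  (is_derive_scalel struct_N1 (is_derive_const (-1 : C) 1))).
rewrite invr1 !scaleN1r -opprD in gc.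
apply: cvg_trans (cvg_within_filter _ gc); apply: near_eq_cvg.
near=> z; have z1 : z != 1 by near: z; exact: nbhs_dnbhs_neq.
by rewrite struct_M_near1 // scaleN1r.
Unshelve. all: by end_near. Qed.

Lemma structure_matrix_struct_M (z : C) : nrm z <> 1 -> z != 0 ->
  structure_matrix_at b H Phi kappa m.+1 z (struct_M z).
Proof.
move=> z1 z0; split; first exact: Cmx_branch_exists.
move=> D [l [lm [l1 [lnu [Hl Hm H1 Hn HD]]]]] Z.
have oz0 : 1 - z != 0.
  by rewrite subr_eq0; apply/eqP => E; apply: z1; rewrite -E nrm1.
have idz := is_derive_id z (1 : C).
have dl := log_branch_derive Hl idz.
have dm := log_branch_derive Hm (is_derive_opp idz).
have d1 := log_branch_derive H1 (is_derive_sub (is_derive_const (1 : C) z) idz).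
have dH : is_derive z 1 H 0.
  by rewrite (_ : H = fun=> ofR c); [exact: is_derive_const | exact/funext].
have dexp (f : C -> C) df : is_derive z 1 f df ->
    is_derive z 1 (fun w => cexp (f w)) (cexp (f z) * df).
  by move=> Hf; exact: is_derive_comp Hf (is_derive_cexp (f z)).
have Em := dexp _ _ (is_derive_mul (is_derive_const (- b^*) z) dm).
have E1 := dexp _ _ (is_derive_mul (is_derive_const (b + b^*) z) d1).
have dn := log_branch_derive Hn (is_derive_mul (is_derive_mul Em E1) dH).
(* The logarithmic derivatives of the diagonal entries [e1] and [e2] of [C_n] are [q] and [- q]. *)
pose q : C := (- h0 + h1 * z) / (z * (1 - z)).
pose e1 w := cexp (- (m.+1%:R / 2) * l w) * cexp (2^-1 * lnu w).
pose e2 w := cexp (m.+1%:R / 2 * l w) * cexp (- 2^-1 * lnu w).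
have dn' : is_derive z 1 lnu (- b^* / z - (b + b^*) / (1 - z)).
  apply: is_derive_eq dn _; rewrite HE.
  have := cexp_neq0 (- b^* * lm z); have := cexp_neq0 ((b + b^*) * l1 z).
  have cn : ofR c != 0 :> C by rewrite -nrm_gt0 nrm_ofR normr_gt0 gt_eqF.
  move: (cexp (- b^* * lm z)) (cexp ((b + b^*) * l1 z)) (ofR c) cn => u v x x0 v0 u0.
  by field; rewrite oz0 z0 x0 v0 u0.
have de1 : is_derive z 1 e1 (e1 z * q).
  apply: is_derive_eq (is_derive_mul (dexp _ _ (is_derive_mul (is_derive_const _ z) dl))
    (dexp _ _ (is_derive_mul (is_derive_const _ z) dn'))) _.
  by rewrite /e1 /q /h0 /h1; field; rewrite oz0 z0.
have de2 : is_derive z 1 e2 (- (e2 z * q)).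
  apply: is_derive_eq (is_derive_mul (dexp _ _ (is_derive_mul (is_derive_const _ z) dl))
    (dexp _ _ (is_derive_mul (is_derive_const _ z) dn'))) _.
  by rewrite /e2 /q /h0 /h1; field; rewrite oz0 z0.
have [dG HG GE] := ode_GP lambda_gt c_gt0 w_int Phi_monic size_Phi ip_Phi HP z1.
have [dGs HGs GsE] := ode_GS lambda_gt c_gt0 w_int Phi_monic size_Phi ip_Phi HS z1.
have PE := ode_P HP z; have SE := ode_S HS z.
rewrite -/G -/Gs -/P -/S -/b in GE GsE PE SE.
have zz : z * (1 - z) != 0 by rewrite mulf_neq0.
have dGE : dG = ((c0 - m.+1%:R - b^* - b * z) * G z + c2 * Gs z) / (z * (1 - z)).
  by rewrite -GE mulrC mulKf.
have dGsE : dGs = (d0 * G z + (e0 - m.+1%:R - b^* + m.+1%:R * z) * Gs z) / (z * (1 - z)).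
  by rewrite -GsE mulrC mulKf.
have dPE : P^`().[z] = ((c0 - m.+1%:R * z) * P.[z] + c2 * S.[z]) / (z * (1 - z)).
  by rewrite -PE mulrC mulKf.
have dSE : S^`().[z] = (d0 * P.[z] + (e0 + b * z) * S.[z]) / (z * (1 - z)).
  by rewrite -SE mulrC mulKf.
have NZ : \forall w \near z,
    mx2 (P.[w] * e1 w) (a * G w * e2 w) (- beta * S.[w] * e1 w) (- beta * (a * Gs w) * e2 w) = Z w.
  move: (off_circle_near z1 z0) HD; apply: filterS2 => w [w1 w0] Dw.
  by rewrite /Z Dw YmxE // mx2_mul !mulr0 !addr0 !add0r.
have Zz := nbhs_singleton NZ.
have dP := is_derive_horner P z; have dS := is_derive_horner S z.
have cst x := is_derive_const (x : C) z.
have dZ := near_eq_is_derive NZ (is_derive_mx2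
  (is_derive_mul dP de1)
  (is_derive_mul (is_derive_mul (cst a) HG) de2)
  (is_derive_mul (is_derive_mul (cst (- beta)) dS) de1)
  (is_derive_mul (is_derive_mul (cst (- beta)) (is_derive_mul (cst a) HGs)) de2)).
have [drZ DZ] := dZ.
have e10 : e1 z != 0 by rewrite /e1 mulf_neq0 // cexp_neq0.
have e20 : e2 z != 0 by rewrite /e2 mulf_neq0 // cexp_neq0.
have a0 : a != 0 by rewrite /a invr_eq0 mulf_neq0 // pnatr_eq0.
(* The determinant is [e1 z * e2 z] times that of [Y_n], to which [wronskian] applies. *)
have ZU : Z z \in unitmx.
  rewrite -Zz unitmxE mx2_det unitfE.
  have := wronskian w_int Phi_monic size_Phi ip_Phi m z1; rewrite -/P -/S -/G -/Gs => W.
  rewrite (_ : _ - _ = - beta * a * e1 z * e2 z * (P.[z] * Gs z - S.[z] * G z)); last by ring.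
  have kn := kappa_neq0 kappa_gt0 m.
  have bn : - beta != 0 by rewrite oppr_eq0.
  rewrite W; apply: mulf_neq0; last by rewrite oppr_eq0.
  by apply: mulf_neq0 e20; apply: mulf_neq0 e10; exact: mulf_neq0.
split=> //.
(* The Cauchy column has [2 * q] more on its diagonal coefficients than the polynomial column;
   adding [q] to one and [- q] to the other gives one matrix for both. *)
suff -> : 'D_1 Z z = struct_M z *m Z z by rewrite -mulmxA mulmxV ?mulmx1.
rewrite DZ -Zz /struct_M /struct_N0 /struct_N1 !mx2Z mx2D mx2_mul dPE dSE dGE dGsE /q /h0 /h1.
rewrite -/G -/Gs; move: (beta) beta_neq0 => be be0.
by congr mx2; field; rewrite ?oz0 ?z0 ?be0.
Qed.

End StructureMatrix.

Theorem proposition4p2 (R : realType) (lambda eta : R) (H : Cx R -> Cx R)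
  (Phi : nat -> {poly Cx R}) (kappa : nat -> R) :
  let b : Cx R := ofR lambda + 'i * ofR eta in
  let nu := weight b H in
  - (1 / 2) < lambda ->
  entire H ->
  (forall z : Cx R, `|z| = 1 -> z <> 1 -> 0 < nu z) ->
  monic_orthogonal nu Phi kappa ->
  forall n : nat, (0 < n)%N ->
  exists M : Cx R -> 'M[Cx R]_2,
    [/\ forall z : Cx R, `|z| <> 1 -> z <> 0 ->
          structure_matrix_at b H Phi kappa n z (M z),
        forall z : Cx R, z <> 0 -> z <> 1 -> derivable M z 1,
        simple_pole M 0 &
        removable_singularity M 1 \/ simple_pole M 1].
Proof.
move=> b nu lambda_gt entire_H nu_pos [monic_size kappa_gt0 orth] n n_gt0.
have [c c_gt0 HE] := symbol_constant entire_H nu_pos.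
have Phi_monic k : Phi k \is monic := (monic_size k).1.
have size_Phi k : size (Phi k) = k.+1 := (monic_size k).2.
(* Hence [orth 0 0] is the total mass of the measure; it is nonzero, which is what integrability of
   the weight is deduced from. *)
have Phi0 : Phi 0%N = 1.
  have [x _ E] : exists2 x, x != 0 & Phi 0%N = x%:P by apply/size_poly1P; rewrite size_Phi.
  by have /monicP := Phi_monic 0%N; rewrite E lead_coefC => ->.
have w_int : (@lebesgue_measure R).-integrable `]0%R, (2 * pi)%R[
    (EFin \o (fun t => c * circ_weight lambda eta t)).
  apply: (weight_integrable c_gt0 HE) => E.
  have := orth 0%N 0%N; rewrite Phi0 (_ : (fun z => _) = (fun=> 1)); last first.
    by apply/funext => z; rewrite hornerC rmorph1 mulr1.
  by rewrite E => /esym/eqP; rewrite mulr1n (negbTE (kappa_neq0 kappa_gt0 _)).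
have ip_Phi k l : ip lambda eta c (Phi k) (Phi l) = ofR (kappa k ^- 2) *+ (k == l).
  by rewrite -orth (mu_intE lambda eta HE).
case: n n_gt0 => // m _.
have [c0 [c2 HP]] := pearson_P lambda_gt w_int Phi_monic size_Phi kappa_gt0 ip_Phi m.
have [d0 [e0 HS]] := pearson_S lambda_gt w_int Phi_monic size_Phi kappa_gt0 ip_Phi m.
exists (struct_M lambda eta kappa m c0 c2 d0 e0); split.
- move=> z z1 z0; apply: (structure_matrix_struct_M lambda_gt c_gt0 HE w_int Phi_monic
    size_Phi kappa_gt0 ip_Phi HP HS); last exact/eqP.
  by move=> E; apply: z1; rewrite normE E ofR1.
- by move=> z /eqP z0 /eqP z1; exact: derivable_struct_M.
- exact: (struct_simple_pole0 lambda_gt Phi_monic size_Phi kappa_gt0 c0 c2 HS).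
- exact: struct_pole1.
Qed.
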